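(* Let $r\ge 1$ and $n\ge 3$ be integers. The pure monomial braid group $P(r,1,n)$ is not residually free.
   Context: For integers $r\ge1$ and $n\ge 1$, the full monomial arrangement $\mathcal{A}_{r,1,n}$ is the complex hyperplane arrangement in $\mathbb{C}^n$ with defining polynomial \[Q(z_1,\dots,z_n)=z_1\cdots z_n\prod_{1\le i<j\le n}(z_i^r-z_j^r),\] i.e. its hyperplanes are the kernels of the linear factors of $Q$. Its complement is $M(\mathcal{A}_{r,1,n})=\mathbb{C}^n\smallsetminus Q^{-1}(0)$, and the pure monomial braid group is the fundamental group $P(r,1,n)=\pi_1(M(\mathcal{A}_{r,1,n}))$. A group $G$ is residually free if for every $x\neq 1$ in $G$ there is a homomorphism $f$ from $G$ to a free group $F$ with $f(x)\neq 1$. *)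

(* Defs.v *)
From HB Require Import structures.
From mathcomp Require Import all_boot all_order all_algebra generic_quotient.
From mathcomp Require Import complex ring lra.
From mathcomp Require Import all_classical all_reals all_analysis homotopy.

Set Implicit Arguments.
Unset Strict Implicit.
Unset Printing Implicit Defensive.

Import Order.TTheory GRing.Theory Num.Theory.
Import numFieldNormedType.Exports.

Local Open Scope classical_set_scope.
Local Open Scope ring_scope.
Local Open Scope quotient_scope.

Definition itv01 (R : realType) : Type := set_type (`[0 : R, 1]%classic).

HB.instance Definition _ (R : realType) := Topological.on (itv01 R).

Lemma clamp01_subproof (R : realType) (t : R) :
  Num.max 0 (Num.min 1 t) \in `[0 : R, 1]%classic.
Proof.
rewrite inE /= in_itv /= le_max lexx /= ge_max ler01 /=.
by rewrite ge_min lexx.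
Qed.

(* The retraction of the line onto [0, 1]. *)
Definition clamp01 (R : realType) (t : R) : itv01 R :=
  exist _ (Num.max 0 (Num.min 1 t)) (clamp01_subproof t).

Lemma val_clamp01 (R : realType) (t : R) :
  0 <= t <= 1 -> val (clamp01 t) = t.
Proof. by case/andP=> t0 t1; rewrite /= min_r // max_r. Qed.

Lemma itv01_bounds (R : realType) (t : itv01 R) : 0 <= val t <= 1.
Proof. by case: t => t /=; rewrite inE /= in_itv. Qed.

Lemma clamp01K (R : realType) (t : itv01 R) : clamp01 (val t) = t.
Proof. by apply/val_inj; apply: val_clamp01; exact: itv01_bounds. Qed.

Lemma clamp01_neq (R : realType) : clamp01 (0 : R) != clamp01 (1 : R).
Proof.
apply/eqP => /(congr1 val); rewrite !val_clamp01 ?lexx ?ler01 //.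
by move/eqP; rewrite eq_sym oner_eq0.
Qed.

HB.instance Definition _ (R : realType) :=
  isBiPointed.Build (itv01 R) (clamp01_neq R).

Lemma val_zero01 (R : realType) : val (zero : itv01 R) = 0.
Proof. by rewrite val_clamp01 // lexx ler01. Qed.

Lemma val_one01 (R : realType) : val (one : itv01 R) = 1.
Proof. by rewrite val_clamp01 // lexx ler01. Qed.

Lemma val01_continuous (R : realType) : continuous (val : itv01 R -> R).
Proof. exact: initial_continuous. Qed.

Lemma clamp01_continuous (R : realType) : continuous (@clamp01 R).
Proof.
apply: (@continuous_comp_initial _ R R).
move=> t; apply: (@continuous_max R R (fun=> 0) (fun t => Num.min 1 t)).
  exact: cst_continuous.
apply: (@continuous_min R R (fun=> 1) id); first exact: cst_continuous.
exact: cvg_id.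
Qed.

Lemma paste_continuous (R : realType) (X T : topologicalType) (h : X -> R)
    (c : R) (u v : X -> T) :
  continuous h -> continuous u -> continuous v ->
  (forall z, h z = c -> u z = v z) ->
  continuous (fun z => if h z <= c then u z else v z).
Proof.
move=> ch cu cv uv; pose f z := if h z <= c then u z else v z.
have cA : closed [set z | h z <= c].
  by apply: (@preimage_closed _ _ h [set y | y <= c]) => [z _|]; [exact: ch|exact: closed_le].
have cB : closed [set z | c <= h z].
  by apply: (@preimage_closed _ _ h [set y | c <= y]) => [z _|]; [exact: ch|exact: closed_ge].
have fA : {within [set z | h z <= c], continuous f}.
  apply: (@subspace_eq_continuous _ _ _ u); last exact: continuous_subspaceT.
  by move=> z; rewrite inE /= => zc; change (u z = f z); rewrite /f zc.
have fB : {within [set z | c <= h z], continuous f}.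
  apply: (@subspace_eq_continuous _ _ _ v); last exact: continuous_subspaceT.
  move=> z; rewrite inE /= => cz; change (v z = f z); rewrite /f.
  by case: ifPn => // zc; rewrite uv //; apply: le_anti; rewrite zc cz.
have := withinU_continuous cA cB fA fB.
rewrite (_ : _ `|` _ = setT); first by move=> fc; apply/(continuous_subspace_setT f).
by apply/seteqP; split=> // z _ /=; apply/orP; exact: le_total.
Qed.

Lemma affine_continuous (R : realType) (X : topologicalType) (g : X -> R)
    (a b : R) :
  continuous g -> continuous (fun z => a * g z + b).
Proof.
move=> cg z; apply: cvgD; last exact: cvg_cst.
by apply: cvgM; [exact: cvg_cst|exact: cg].
Qed.

Lemma clamp01_comp_continuous (R : realType) (X : topologicalType)
    (g : X -> R) :
  continuous g -> continuous (fun z => clamp01 (g z)).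
Proof.
by move=> cg z; apply: continuous_comp; [exact: cg|exact: clamp01_continuous].
Qed.

Lemma pair_comp_continuous (X Y Z W : topologicalType) (f : Y * Z -> W)
    (g : X -> Y) (h : X -> Z) :
  continuous f -> continuous g -> continuous h ->
  continuous (fun z => f (g z, h z)).
Proof.
move=> cf cg ch z; apply: (@continuous_comp _ _ _ (fun z => (g z, h z)) f).
  by apply: cvg_pair; [exact: cg|exact: ch].
exact: cf.
Qed.

Lemma comp_continuous (X Y Z : topologicalType) (f : Y -> Z) (g : X -> Y) :
  continuous f -> continuous g -> continuous (fun z => f (g z)).
Proof. by move=> cf cg z; apply: continuous_comp; [exact: cg|exact: cf]. Qed.

Lemma fst_continuous (X Y : topologicalType) : continuous (@fst X Y).
Proof. by move=> z; exact: cvg_fst. Qed.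

Lemma snd_continuous (X Y : topologicalType) : continuous (@snd X Y).
Proof. by move=> z; exact: cvg_snd. Qed.

Section path_operations.
Context {R : realType} {T : topologicalType}.
Local Notation I := (itv01 R).
Implicit Types x y z : T.

Definition path_cat_fun (p q : I -> T) (t : I) : T :=
  if val t <= 2^-1 then p (clamp01 (2 * val t))
  else q (clamp01 (2 * val t - 1)).

Lemma path_cat_continuous x y z (p : {path I from x to y in T})
    (q : {path I from y to z in T}) :
  continuous (path_cat_fun p q).
Proof.
apply: paste_continuous; first exact: val01_continuous.
- apply: comp_continuous; first exact: cts_fun.
  apply: clamp01_comp_continuous.
  under eq_fun do rewrite -[2 * _]addr0.
  by apply: affine_continuous; exact: val01_continuous.
- apply: comp_continuous; first exact: cts_fun.
  apply: clamp01_comp_continuous.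
  by apply: affine_continuous; exact: val01_continuous.
- move=> t ->; rewrite divff ?pnatr_eq0 // subrr.
  by rewrite [LHS]path_one [RHS]path_zero.
Qed.

Lemma path_cat_zero x y z (p : {path I from x to y in T})
    (q : {path I from y to z in T}) :
  path_cat_fun p q zero = x.
Proof.
by rewrite /path_cat_fun val_zero01 invr_ge0 ler0n mulr0 [LHS]path_zero.
Qed.

Lemma path_cat_one x y z (p : {path I from x to y in T})
    (q : {path I from y to z in T}) :
  path_cat_fun p q one = z.
Proof.
rewrite /path_cat_fun val_one01 ifF; last by apply/negbTE; rewrite -ltNge; lra.
by rewrite (_ : 2 * 1 - 1 = 1 :> R); [rewrite [LHS]path_one|ring].
Qed.

Definition path_cat x y z (p : {path I from x to y in T})
    (q : {path I from y to z in T}) : {path I from x to z in T} :=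
  mk_path (@path_cat_continuous x y z p q) (path_cat_zero p q)
    (path_cat_one p q).

Definition path_rev_fun (p : I -> T) (t : I) : T := p (clamp01 (1 - val t)).

Lemma path_rev_continuous x y (p : {path I from x to y in T}) :
  continuous (path_rev_fun p).
Proof.
apply: comp_continuous; first exact: cts_fun.
apply: clamp01_comp_continuous.
under eq_fun do rewrite addrC -mulN1r.
by apply: affine_continuous; exact: val01_continuous.
Qed.

Lemma path_rev_zero x y (p : {path I from x to y in T}) :
  path_rev_fun p zero = y.
Proof. by rewrite /path_rev_fun val_zero01 subr0 [LHS]path_one. Qed.

Lemma path_rev_one x y (p : {path I from x to y in T}) :
  path_rev_fun p one = x.
Proof. by rewrite /path_rev_fun val_one01 subrr [LHS]path_zero. Qed.

Definition path_rev x y (p : {path I from x to y in T}) :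
    {path I from y to x in T} :=
  mk_path (@path_rev_continuous x y p) (path_rev_zero p) (path_rev_one p).

Definition path_cst x : {path I from x to x in T} := cst x.

End path_operations.

(* Homotopy relative to the end points. *)
Definition path_homotopic (R : realType) (T : topologicalType) (x y : T)
    (p q : {path itv01 R from x to y in T}) : Prop :=
  exists H : itv01 R * itv01 R -> T,
    [/\ continuous H,
        forall t, H (zero, t) = p t,
        forall t, H (one, t) = q t,
        forall s, H (s, zero) = x &
        forall s, H (s, one) = y].

Section homotopy.
Context {R : realType} {T : topologicalType}.
Local Notation I := (itv01 R).
Implicit Types x y z w : T.

Lemma val_fst_continuous : continuous (fun st : I * I => val st.1).
Proof. by apply: comp_continuous; [exact: val01_continuous|exact: fst_continuous]. Qed.

Lemma val_snd_continuous : continuous (fun st : I * I => val st.2).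
Proof. by apply: comp_continuous; [exact: val01_continuous|exact: snd_continuous]. Qed.

Lemma clamp01_double_continuous (X : topologicalType) (g : X -> R) :
  continuous g -> continuous (fun u => clamp01 (2 * g u)).
Proof.
move=> cg; apply: clamp01_comp_continuous.
by under eq_fun do rewrite -[2 * _]addr0; exact: affine_continuous.
Qed.

Lemma clamp01_opp_continuous (X : topologicalType) (g : X -> R) :
  continuous g -> continuous (fun u => clamp01 (1 - g u)).
Proof.
move=> cg; apply: clamp01_comp_continuous.
by under eq_fun do rewrite addrC -mulN1r; exact: affine_continuous.
Qed.

(* Two reparametrizations of the same path are homotopic. *)
Lemma path_homotopic_reparam x y x' y' (p : {path I from x to y in T})
    (f g : I -> R) (q1 q2 : {path I from x' to y' in T}) :
  continuous f -> continuous g -> f zero = g zero -> f one = g one ->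
  (forall t, q1 t = p (clamp01 (f t))) ->
  (forall t, q2 t = p (clamp01 (g t))) ->
  path_homotopic q1 q2.
Proof.
move=> cf cg fg0 fg1 q1E q2E.
exists (fun st => p (clamp01 (f st.2 + val st.1 * (g st.2 - f st.2)))); split.
- apply: comp_continuous; first exact: cts_fun.
  apply: clamp01_comp_continuous => st.
  have cf2 : {for st, continuous (fun st : I * I => f st.2)}.
    by apply: comp_continuous; [exact: cf|exact: snd_continuous].
  have cg2 : {for st, continuous (fun st : I * I => g st.2)}.
    by apply: comp_continuous; [exact: cg|exact: snd_continuous].
  apply: cvgD; first exact: cf2.
  apply: cvgM; first exact: val_fst_continuous.
  by apply: cvgB; [exact: cg2|exact: cf2].
- by move=> t; rewrite val_zero01 mul0r addr0 q1E.
- by move=> t; rewrite val_one01 mul1r addrC subrK q2E.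
- move=> s /=; rewrite fg0 subrr mulr0 addr0 -fg0 -q1E.
  by rewrite [LHS]path_zero.
- move=> s /=; rewrite fg1 subrr mulr0 addr0 -fg1 -q1E.
  by rewrite [LHS]path_one.
Qed.

Lemma path_homotopic_refl x y (p : {path I from x to y in T}) :
  path_homotopic p p.
Proof.
apply: (@path_homotopic_reparam _ _ _ _ p val val) => //.
- exact: val01_continuous.
- exact: val01_continuous.
- by move=> t; rewrite clamp01K.
- by move=> t; rewrite clamp01K.
Qed.

Lemma path_homotopic_sym x y (p q : {path I from x to y in T}) :
  path_homotopic p q -> path_homotopic q p.
Proof.
case=> H [cH H0 H1 Hx Hy].
exists (fun st => H (clamp01 (1 - val st.1), st.2)); split => [|t|t|s|s]; cbn beta iota delta [fst snd].
- apply: pair_comp_continuous => //; last exact: snd_continuous.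
  by apply: clamp01_opp_continuous; exact: val_fst_continuous.
- by rewrite val_zero01 subr0 -H1.
- by rewrite val_one01 subrr -H0.
- exact: Hx.
- exact: Hy.
Qed.

Lemma path_homotopic_trans x y (p q r : {path I from x to y in T}) :
  path_homotopic p q -> path_homotopic q r -> path_homotopic p r.
Proof.
case=> H [cH H0 H1 Hx Hy] [K [cK K0 K1 Kx Ky]].
exists (fun st => if val st.1 <= 2^-1 then H (clamp01 (2 * val st.1), st.2)
                  else K (clamp01 (2 * val st.1 - 1), st.2)).
split => [|t|t|s|s]; cbn beta iota delta [fst snd].
- apply: paste_continuous; first exact: val_fst_continuous.
  + apply: pair_comp_continuous => //; last exact: snd_continuous.
    by apply: clamp01_double_continuous; exact: val_fst_continuous.
  + apply: pair_comp_continuous => //; last exact: snd_continuous.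
    apply: clamp01_comp_continuous.
    by apply: affine_continuous; exact: val_fst_continuous.
  + move=> [s t] /= ->; rewrite divff ?pnatr_eq0 // subrr.
    by rewrite [LHS]H1 [RHS]K0.
- by rewrite val_zero01 invr_ge0 ler0n mulr0 [LHS]H0.
- rewrite val_one01 ifF; last by apply/negbTE; rewrite -ltNge; lra.
  by rewrite (_ : 2 * 1 - 1 = 1 :> R); [rewrite [LHS]K1|ring].
- by rewrite /= Hx Kx if_same.
- by rewrite /= Hy Ky if_same.
Qed.

Lemma path_homotopic_cat x y z (p p' : {path I from x to y in T})
    (q q' : {path I from y to z in T}) :
  path_homotopic p p' -> path_homotopic q q' ->
  path_homotopic (path_cat p q) (path_cat p' q').
Proof.
case=> H [cH H0 H1 Hx Hy] [K [cK K0 K1 Kx Ky]].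
exists (fun st => if val st.2 <= 2^-1 then H (st.1, clamp01 (2 * val st.2))
                  else K (st.1, clamp01 (2 * val st.2 - 1))).
split => [|t|t|s|s]; cbn beta iota delta [fst snd].
- apply: paste_continuous; first exact: val_snd_continuous.
  + apply: pair_comp_continuous => //; first exact: fst_continuous.
    by apply: clamp01_double_continuous; exact: val_snd_continuous.
  + apply: pair_comp_continuous => //; first exact: fst_continuous.
    apply: clamp01_comp_continuous.
    by apply: affine_continuous; exact: val_snd_continuous.
  + move=> [s t] /= ->; rewrite divff ?pnatr_eq0 // subrr.
    by rewrite [LHS]Hy [RHS]Kx.
- by rewrite -[RHS]/(path_cat_fun p q t) /path_cat_fun H0 K0.
- by rewrite -[RHS]/(path_cat_fun p' q' t) /path_cat_fun H1 K1.
- by rewrite val_zero01 invr_ge0 ler0n mulr0 [LHS]Hx.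
- rewrite val_one01 ifF; last by apply/negbTE; rewrite -ltNge; lra.
  by rewrite (_ : 2 * 1 - 1 = 1 :> R); [rewrite [LHS]Ky|ring].
Qed.

Lemma path_homotopic_rev x y (p q : {path I from x to y in T}) :
  path_homotopic p q -> path_homotopic (path_rev p) (path_rev q).
Proof.
case=> H [cH H0 H1 Hx Hy].
exists (fun st => H (st.1, clamp01 (1 - val st.2))); split => [|t|t|s|s]; cbn beta iota delta [fst snd].
- apply: pair_comp_continuous => //; first exact: fst_continuous.
  by apply: clamp01_opp_continuous; exact: val_snd_continuous.
- exact: H0.
- exact: H1.
- by rewrite val_zero01 subr0 Hy.
- by rewrite val_one01 subrr Hx.
Qed.

Lemma path_catE x y z (p : {path I from x to y in T})
    (q : {path I from y to z in T}) (t : R) : 0 <= t <= 1 ->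
  path_cat p q (clamp01 t) =
  if t <= 2^-1 then p (clamp01 (2 * t)) else q (clamp01 (2 * t - 1)).
Proof.
by move=> t01; rewrite -[LHS]/(path_cat_fun p q _) /path_cat_fun val_clamp01.
Qed.

Lemma max_continuous (f g : I -> R) :
  continuous f -> continuous g -> continuous (fun t => Num.max (f t) (g t)).
Proof.
by move=> cf cg t; apply: (@continuous_max R _ f g); [exact: cf|exact: cg].
Qed.

Lemma min_continuous (f g : I -> R) :
  continuous f -> continuous g -> continuous (fun t => Num.min (f t) (g t)).
Proof.
by move=> cf cg t; apply: (@continuous_min R _ f g); [exact: cf|exact: cg].
Qed.

Lemma affine01_continuous (a b : R) :
  continuous (fun t : I => a * val t + b).
Proof. by apply: affine_continuous; exact: val01_continuous. Qed.

Lemma clamp01_le0 (t : R) : t <= 0 -> clamp01 t = zero.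
Proof.
move=> t0; apply/val_inj; rewrite val_zero01 /=.
by rewrite min_r ?(le_trans t0) // max_l.
Qed.

Lemma clamp01_ge1 (t : R) : 1 <= t -> clamp01 t = one.
Proof.
by move=> t1; apply/val_inj; rewrite val_one01 /= min_l // max_r.
Qed.

Lemma path_cat1p x y (p : {path I from x to y in T}) :
  path_homotopic (path_cat (path_cst x) p) p.
Proof.
apply: (@path_homotopic_reparam _ _ _ _ p
  (fun t => Num.max (0 * val t + 0) (2 * val t + -1)) val).
- by apply: max_continuous; exact: affine01_continuous.
- exact: val01_continuous.
- by rewrite val_zero01 mul0r mulr0 !add0r max_l //; lra.
- by rewrite val_one01 mul0r addr0 max_r; lra.
- move=> t; have /andP[t0 t1] := itv01_bounds t.
  rewrite -[t in LHS]clamp01K path_catE ?t0 // mul0r addr0.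
  case: ifPn => [th|]; last by rewrite -ltNge => th; rewrite max_r //; lra.
  by rewrite max_l; [rewrite [RHS]path_zero|lra].
- by move=> t; rewrite clamp01K.
Qed.

Lemma path_catp1 x y (p : {path I from x to y in T}) :
  path_homotopic (path_cat p (path_cst y)) p.
Proof.
apply: (@path_homotopic_reparam _ _ _ _ p
  (fun t => Num.min (0 * val t + 1) (2 * val t + 0)) val).
- by apply: min_continuous; exact: affine01_continuous.
- exact: val01_continuous.
- by rewrite val_zero01 mul0r mulr0 !add0r min_r //; lra.
- by rewrite val_one01 mul0r add0r min_l //; lra.
- move=> t; have /andP[t0 t1] := itv01_bounds t.
  rewrite -[t in LHS]clamp01K path_catE ?t0 // mul0r add0r addr0.
  case: ifPn => [th|]; first by rewrite min_r //; lra.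
  rewrite -ltNge => th; rewrite min_l; last lra.
  by rewrite [RHS]path_one.
- by move=> t; rewrite clamp01K.
Qed.

Lemma path_cat_revr x y (p : {path I from x to y in T}) :
  path_homotopic (path_cat p (path_rev p)) (path_cst x).
Proof.
apply: (@path_homotopic_reparam _ _ _ _ p
  (fun t => Num.min (2 * val t + 0) (- 2 * val t + 2)) (fun=> 0)).
- by apply: min_continuous; exact: affine01_continuous.
- exact: cst_continuous.
- by rewrite val_zero01 min_l; lra.
- by rewrite val_one01 min_r; lra.
- move=> t; have /andP[t0 t1] := itv01_bounds t.
  rewrite -[t in LHS]clamp01K path_catE ?t0 // addr0.
  case: ifPn => [th|]; first by rewrite min_l //; lra.
  rewrite -ltNge => th; rewrite min_r; last lra.
  rewrite -[LHS]/(path_rev_fun p _) /path_rev_fun val_clamp01; last by apply/andP; split; lra.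
  by congr (p (clamp01 _)); lra.
- by move=> t; rewrite [RHS]path_zero.
Qed.

Lemma path_cat_revl x y (p : {path I from x to y in T}) :
  path_homotopic (path_cat (path_rev p) p) (path_cst y).
Proof.
apply: (@path_homotopic_reparam _ _ _ _ p
  (fun t => Num.max (2 * val t + -1) (- 2 * val t + 1)) (fun=> 1)).
- by apply: max_continuous; exact: affine01_continuous.
- exact: cst_continuous.
- by rewrite val_zero01 max_r; lra.
- by rewrite val_one01 max_l; lra.
- move=> t; have /andP[t0 t1] := itv01_bounds t.
  rewrite -[t in LHS]clamp01K path_catE ?t0 //.
  case: ifPn => [th|]; last by rewrite -ltNge => th; rewrite max_l //; lra.
  rewrite max_r; last lra.
  rewrite -[LHS]/(path_rev_fun p _) /path_rev_fun val_clamp01; last by apply/andP; split; lra.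
  by congr (p (clamp01 _)); lra.
- by move=> t; rewrite [RHS]path_one.
Qed.

Lemma path_catA x y z w (p : {path I from x to y in T})
    (q : {path I from y to z in T}) (r : {path I from z to w in T}) :
  path_homotopic (path_cat p (path_cat q r)) (path_cat (path_cat p q) r).
Proof.
apply: (@path_homotopic_reparam _ _ _ _ (path_cat (path_cat p q) r)
  (fun t => Num.max (2^-1 * val t + 0)
                    (Num.max (1 * val t + - 4^-1) (2 * val t + -1))) val).
- apply: max_continuous; first exact: affine01_continuous.
  by apply: max_continuous; exact: affine01_continuous.
- exact: val01_continuous.
- rewrite val_zero01 max_l; first lra.
  by rewrite ge_max; apply/andP; split; lra.
- rewrite val_one01 [Num.max (1 * 1 + _) _]max_r; last lra.
  by rewrite max_r; lra.
- move=> t; have /andP[t0 t1] := itv01_bounds t.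
  rewrite -[t in LHS]clamp01K; set u := val t in t0 t1 *.
  rewrite path_catE ?t0 // addr0 mul1r.
  have [u2|u2] := leP u 2^-1.
    rewrite max_l; last by rewrite ge_max; apply/andP; split; lra.
    rewrite path_catE; last by apply/andP; split; lra.
    rewrite ifT; last lra.
    rewrite path_catE; last by apply/andP; split; lra.
    rewrite ifT; last lra.
    by congr (p (clamp01 _)); lra.
  have [u4|u4] := leP u (3 / 4).
    rewrite [Num.max (u + _) _]max_l; last lra.
    rewrite max_r; last lra.
    rewrite path_catE; last by apply/andP; split; lra.
    rewrite ifT; last lra.
    rewrite path_catE; last by apply/andP; split; lra.
    rewrite ifT; last lra.
    rewrite path_catE; last by apply/andP; split; lra.
    rewrite ifF; last by apply/negbTE; rewrite -ltNge; lra.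
    by congr (q (clamp01 _)); lra.
  rewrite [Num.max (u + _) _]max_r; last lra.
  rewrite max_r; last lra.
  rewrite path_catE; last by apply/andP; split; lra.
  rewrite ifF; last by apply/negbTE; rewrite -ltNge; lra.
  rewrite path_catE; last by apply/andP; split; lra.
  by rewrite ifF; last by apply/negbTE; rewrite -ltNge; lra.
- by move=> t; rewrite clamp01K.
Qed.

End homotopy.

Section fundamental_group.
Context (R : realType) (T : topologicalType) (x0 : T).
Local Notation loop := {path itv01 R from x0 to x0 in T}.

Definition loop_homotopic : rel loop := fun p q => `[< path_homotopic p q >].

Lemma loop_homotopic_refl : reflexive loop_homotopic.
Proof. by move=> p; apply/asboolP; exact: path_homotopic_refl. Qed.

Lemma loop_homotopic_sym : symmetric loop_homotopic.
Proof.
move=> p q; apply/idP/idP => /asboolP pq; apply/asboolP;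
exact: path_homotopic_sym.
Qed.

Lemma loop_homotopic_trans : transitive loop_homotopic.
Proof.
move=> q p r /asboolP pq /asboolP qr; apply/asboolP.
exact: path_homotopic_trans qr.
Qed.

Definition loop_homotopic_equiv :=
  EquivRel loop_homotopic loop_homotopic_refl loop_homotopic_sym
    loop_homotopic_trans.

Definition pi1 := {eq_quot loop_homotopic_equiv}.

HB.instance Definition _ := Choice.on pi1.
HB.instance Definition _ := EqQuotient.on pi1.

Definition pi1_class (p : loop) : pi1 := \pi_pi1 p.

Lemma pi1_classP (p q : loop) :
  pi1_class p = pi1_class q <-> path_homotopic p q.
Proof.
by split=> [/eqmodP/asboolP //|pq]; apply/eqmodP/asboolP.
Qed.

Lemma pi1_class_repr (a : pi1) : pi1_class (repr a) = a.
Proof. exact: reprK. Qed.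

Lemma pi1_repr_class (p : loop) : path_homotopic (repr (pi1_class p)) p.
Proof. by apply/pi1_classP; exact: pi1_class_repr. Qed.

Definition pi1_one : pi1 := pi1_class (path_cst x0).
Definition pi1_mul (a b : pi1) : pi1 := pi1_class (path_cat (repr a) (repr b)).
Definition pi1_inv (a : pi1) : pi1 := pi1_class (path_rev (repr a)).

Lemma pi1_mul_class (p q : loop) :
  pi1_mul (pi1_class p) (pi1_class q) = pi1_class (path_cat p q).
Proof.
by apply/pi1_classP; apply: path_homotopic_cat; exact: pi1_repr_class.
Qed.

Lemma pi1_inv_class (p : loop) :
  pi1_inv (pi1_class p) = pi1_class (path_rev p).
Proof. by apply/pi1_classP/path_homotopic_rev; exact: pi1_repr_class. Qed.

Lemma pi1_mulA : associative pi1_mul.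
Proof.
move=> a b c; rewrite -(pi1_class_repr a) -(pi1_class_repr b).
rewrite -(pi1_class_repr c) !pi1_mul_class.
by apply/pi1_classP; exact: path_catA.
Qed.

Lemma pi1_mul1 : left_id pi1_one pi1_mul.
Proof.
move=> a; rewrite -(pi1_class_repr a) pi1_mul_class.
by apply/pi1_classP; exact: path_cat1p.
Qed.

Lemma pi1_mulr1 : right_id pi1_one pi1_mul.
Proof.
move=> a; rewrite -(pi1_class_repr a) pi1_mul_class.
by apply/pi1_classP; exact: path_catp1.
Qed.

Lemma pi1_mulV : left_inverse pi1_one pi1_inv pi1_mul.
Proof.
move=> a; rewrite -(pi1_class_repr a) pi1_inv_class pi1_mul_class.
by apply/pi1_classP; exact: path_cat_revl.
Qed.

Lemma pi1_mulrV : right_inverse pi1_one pi1_inv pi1_mul.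
Proof.
move=> a; rewrite -(pi1_class_repr a) pi1_inv_class pi1_mul_class.
by apply/pi1_classP; exact: path_cat_revr.
Qed.

HB.instance Definition _ :=
  isGroup.Build pi1 pi1_mulA pi1_mul1 pi1_mulr1 pi1_mulV pi1_mulrV.

End fundamental_group.

(* Homomorphisms are {multiplicative G -> H}: between groups, preserving the
   product entails preserving 1 and inverses. *)
Definition free_basis (F : groupType) (B : set F) : Prop :=
  forall (H : groupType) (f : F -> H),
    exists phi : {multiplicative F -> H},
      (forall b, B b -> phi b = f b) /\
      (forall psi : {multiplicative F -> H},
         (forall b, B b -> psi b = f b) -> psi =1 phi).

Definition free_group (F : groupType) : Prop :=
  exists B : set F, free_basis B.

Definition residually_free (G : groupType) : Prop :=
  forall x : G, x <> 1%g ->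
    exists (F : groupType) (f : {multiplicative G -> F}),
      free_group F /\ f x <> 1%g.

Section monomial_arrangement.
Context (R : realType) (r n : nat).
(* R[i] itself carries no topology: without the ascription the norm topology
   of the numeric field is not inferred. *)
Local Notation C := (R[i] : numClosedFieldType).

Definition monomial_Q (z : 'rV[C]_n) : C :=
  (\prod_(i < n) z 0 i) *
  \prod_(i < n) \prod_(j < n | (i < j)%N) (z 0 i ^+ r - z 0 j ^+ r).

Definition monomial_complement : set 'rV[C]_n := ~` (monomial_Q @^-1` [set 0]).

Definition pure_monomial_braid_group (x0 : monomial_complement) : groupType :=
  pi1 R x0.

End monomial_arrangement.

Arguments monomial_complement : clear implicits.
Arguments pure_monomial_braid_group : clear implicits.

(* Main.v *)
Require Import Defs.
From HB Require Import structures.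
From mathcomp Require Import all_boot all_order all_algebra complex ring lra zify.
From mathcomp Require Import all_classical all_reals all_analysis homotopy.

Set Implicit Arguments.
Unset Strict Implicit.
Unset Printing Implicit Defensive.

Import Order.TTheory GRing.Theory Num.Theory.
Import numFieldNormedType.Exports.

(** Only three coordinates matter.  While z1 and z2 start near each other and z3
close by, let A be the loop in which z1 and z2 rotate around their midpoint,
and let s, a, b be the loops in which z3 alone moves: around both z1 and z2,
around 0, and around z1.  Three tori in the complement give the relations
[A s = s A], [A a = a A] and [(A s) b = b (A s)]: the last one because A s is
the rigid rotation of the cluster z1, z2, z3, which commutes with any motion
inside the cluster.

In a free group, two elements commuting with the same nontrivial element
commute with each other ([free_commute_trans]).  So under a morphism
to a free group either A s dies, and then the image of s, being
inverse to that of A, commutes with the image of a; or it survives, and then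
the images of s and b commute.  With u = b s (s b)^-1 and v = a s (s a)^-1,
every morphism to a free group thus kills u or v, hence their commutator
([not_residually_free_of]).  It remains to see that u and v do not commute.

On the cover of the space of triples (z1, z2, z3) given by square roots alpha,
beta, gamma of z3, z3 - z1 and z3 - z2, the function
rho = (alpha + beta) / (beta + gamma) avoids 0 and 1, since
1 - rho = - (alpha - gamma) / (beta + gamma).  The loops u and v lift to loops
of the cover.  Along the lift of u, rho and 1 - rho both turn once around 0;
along that of v, rho turns once and 1 - rho turns minus once.  If u and v
commuted, their images under rho would be commuting loops in the plane minus
0 and 1, both turning once around 0.  Through a cube root of rho this forces
the numbers of turns around 1 to be congruent modulo 3 ([commuting_turns]),
and 1 and -1 are not ([no_commuting_homotopy]).

Two tools are built for this.  Turns are defined by continuous arguments,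
which exist on compact contractible spaces ([arg_lift_exists]); they also give
the lifting of homotopies through n-th roots ([root_homotopy]).  Commutative
transitivity comes from representing a free group by transvections over the
polynomials with integer coefficients ([transvection_prod]).  Finally the base
point is arbitrary because the complement is path connected
([complement_path], [residually_free_change_base]). *)

(** * Free groups are commutative-transitive *)

Section Morphisms.
Context (G H : groupType) (f : {multiplicative G -> H}).
Local Open Scope group_scope.

Lemma morph1 : f 1 = 1.
Proof. by apply: (@mulgI _ (f 1)); rewrite -gmulfM !mulg1. Qed.

Lemma morphV x : f x^-1 = (f x)^-1.
Proof. by apply: (@mulgI _ (f x)); rewrite -gmulfM !mulgV morph1. Qed.

Lemma morphX x n : f (x ^+ n) = f x ^+ n.
Proof. by elim: n => [|n IH]; rewrite ?expg0 ?morph1 // !expgS gmulfM IH. Qed.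

End Morphisms.

Section UnitGroup.
Context (K : unitRingType).
Local Open Scope ring_scope.

(** Freeness only provides morphisms into groups, so a representation by
invertible matrices needs their group as a target. *)
Definition unit_group : Type := {x : K | x \is a GRing.unit}.
HB.instance Definition _ := Choice.on unit_group.

Definition unit_one : unit_group := exist _ 1 (unitr1 K).
Lemma unit_mul_subproof (x y : unit_group) :
  sval x * sval y \is a GRing.unit.
Proof. by rewrite unitrMr ?(svalP x) ?(svalP y). Qed.
Definition unit_mul (x y : unit_group) : unit_group :=
  exist _ (sval x * sval y) (unit_mul_subproof x y).

Lemma unit_inv_subproof (x : unit_group) : (sval x)^-1 \is a GRing.unit.
Proof. by rewrite unitrV (svalP x). Qed.
Definition unit_inv (x : unit_group) : unit_group :=
  exist _ (sval x)^-1 (unit_inv_subproof x).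

Lemma unit_mulA : associative unit_mul.
Proof. by move=> x y z; apply/val_inj; rewrite /= mulrA. Qed.
Lemma unit_mul1 : left_id unit_one unit_mul.
Proof. by move=> x; apply/val_inj; rewrite /= mul1r. Qed.
Lemma unit_mulr1 : right_id unit_one unit_mul.
Proof. by move=> x; apply/val_inj; rewrite /= mulr1. Qed.
Lemma unit_mulV : left_inverse unit_one unit_inv unit_mul.
Proof. by move=> x; apply/val_inj; rewrite /= mulVr // (svalP x). Qed.
Lemma unit_mulrV : right_inverse unit_one unit_inv unit_mul.
Proof. by move=> x; apply/val_inj; rewrite /= mulrV // (svalP x). Qed.

HB.instance Definition _ :=
  isGroup.Build unit_group unit_mulA unit_mul1 unit_mulr1 unit_mulV unit_mulrV.
End UnitGroup.

Section Generation.
Context (F : groupType) (B : set F) (freeB : free_basis B).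
Local Open Scope group_scope.

(** The exponent of a syllable is an integer, encoded as a difference of two
natural numbers because groups only have powers [x ^+ n]. *)
Definition syllable (s : F * (nat * nat)) : F := s.1 ^+ s.2.1 / s.1 ^+ s.2.2.
Definition word_val (w : seq (F * (nat * nat))) : F := \prod_(s <- w) syllable s.
Definition in_basis (w : seq (F * (nat * nat))) := forall s, s \in w -> B s.1.

Lemma word_val_cons s w : word_val (s :: w) = syllable s * word_val w.
Proof. by rewrite /word_val big_cons. Qed.
Lemma word_val_cat v w : word_val (v ++ w) = word_val v * word_val w.
Proof. by rewrite /word_val big_cat. Qed.

Lemma syllableM b p q :
  syllable (b, p) * syllable (b, q) =
  syllable (b, ((p.1 + q.1)%N, (p.2 + q.2)%N)).
Proof.
have cbb : commute (b ^- p.2) (b ^+ q.1).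
  by apply/commute_sym/commuteV/commuteX/commute_sym/commuteX.
rewrite /syllable /= (addnC p.2) !expgnDr invgM !mulgA.
by rewrite -(mulgA (b ^+ p.1)) cbb !mulgA.
Qed.

Lemma syllableV b p : (syllable (b, p))^-1 = syllable (b, (p.2, p.1)).
Proof. by rewrite /syllable /= invgF. Qed.

Lemma syllable_eq1 b p : p.1 = p.2 -> syllable (b, p) = 1.
Proof. by rewrite /syllable /= => ->; rewrite mulgV. Qed.

Definition inv_word (w : seq (F * (nat * nat))) :=
  rev [seq (s.1, (s.2.2, s.2.1)) | s <- w].

Lemma word_val_inv w : word_val (inv_word w) = (word_val w)^-1.
Proof.
elim: w => [|[b p] w IH]; first by rewrite /word_val !big_nil invg1.
rewrite word_val_cons invgM -IH syllableV /inv_word map_cons rev_cons -cats1.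
by rewrite word_val_cat; congr (_ * _); rewrite /word_val big_seq1.
Qed.

Definition generated : {pred F} :=
  fun x => `[< exists2 w, in_basis w & x = word_val w >].

Lemma generated_closed : group_closed generated.
Proof.
split; first by apply/asboolP; exists [::] => //; rewrite /word_val big_nil.
move=> _ _ /asboolP[v Bv ->] /asboolP[w Bw ->]; apply/asboolP.
exists (v ++ inv_word w); last by rewrite word_val_cat word_val_inv.
by move=> s; rewrite mem_cat mem_rev => /orP[/Bv//|/mapP[t /Bw Bt ->]].
Qed.

Definition generated_group : Type := {x : F | x \in generated}.
HB.instance Definition _ := [isSub for @sval _ _ : generated_group -> F].
HB.instance Definition _ := [Choice of generated_group by <:].
HB.instance Definition _ :=
  SubChoice_isSubGroup.Build F generated generated_group generated_closed.

(** The morphism extending the inclusion of the basis into the subgroup that it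
generates, followed by the inclusion of this subgroup, fixes the basis.  By the
uniqueness part of freeness it is the identity, so the subgroup is everything. *)
Lemma basis_generates x : exists2 w, in_basis w & x = word_val w.
Proof.
(* Outside the basis the value 1 is arbitrary. *)
pose incl (b : F) : generated_group := insubd (1 : generated_group) b.
have [phi [phiB _]] := freeB incl.
have [iota [_ iota_uniq]] := freeB id.
have mS : {morph (fun x => val (phi x)) : x y / x * y}.
  by move=> u v; rewrite gmulfM valM.
pose psi : {multiplicative F -> F} :=
  HB.pack (fun x => val (phi x)) (isMultiplicative.Build _ _ _ mS).
have E1 : psi =1 iota.
  apply: iota_uniq => b Bb; rewrite /= phiB // /incl val_insubd.
  case: ifP => // /negP[]; apply/asboolP; exists [:: (b, (1, 0)%N)].
    by move=> s; rewrite inE => /eqP->.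
  by rewrite /word_val big_seq1 /syllable /= expg1 expg0 invg1 mulg1.
have m_id : {morph @id F : x y / x * y} by [].
pose idF : {multiplicative F -> F} :=
  HB.pack (@id F) (isMultiplicative.Build _ _ _ m_id).
have E2 : idF =1 iota by apply: iota_uniq.
have -> : x = val (phi x) by have := E1 x; rewrite -(E2 x) /= => ->.
by have := valP (phi x) => /asboolP.
Qed.
End Generation.

Section Reduction.
Context (F : groupType) (B : set F).
Local Open Scope group_scope.
Local Notation word := (seq (F * (nat * nat))).

Definition reduced (w : word) : bool :=
  all (fun s => s.2.1 != s.2.2) w &&
  sorted (fun s t => s.1 != t.1) w.

Lemma reduced_tail s w : reduced (s :: w) -> reduced w.
Proof. by case/andP => /= /andP[_ aw] /path_sorted sw; rewrite /reduced aw. Qed.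

(** The new syllable is trivial, or differs in its letter from the head of the
word, or merges with this head; in the last case the merged syllable may vanish,
which exposes a tail that is still reduced.  The inclusion of the letters keeps
the words over a given basis. *)
Lemma reduce_cons (s : F * (nat * nat)) (w : word) :
  reduced w -> exists w', [/\ reduced w',
    {subset map fst w' <= map fst (s :: w)} & word_val w' = word_val (s :: w)].
Proof.
case: s => b p rw; have [p12|p12] := eqVneq p.1 p.2.
  exists w; split=> //; first by move=> c cw; rewrite inE cw orbT.
  by rewrite word_val_cons syllable_eq1 // mul1g.
case: w rw => [|[c q] w] rw.
  by exists [:: (b, p)]; split; rewrite // /reduced /= p12.
have [cb|cb] := eqVneq c b; last first.
  exists [:: (b, p), (c, q) & w]; split=> //.
  by move: rw; rewrite /reduced /= p12 (eq_sym b c) cb.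
subst c; pose pq := ((p.1 + q.1)%N, (p.2 + q.2)%N).
have E : word_val [:: (b, p), (b, q) & w] = syllable (b, pq) * word_val w.
  by rewrite !word_val_cons mulgA syllableM.
have [pq12|pq12] := eqVneq pq.1 pq.2.
  exists w; split; first exact: reduced_tail rw.
    by move=> c cw; rewrite /= !inE cw !orbT.
  by rewrite E syllable_eq1 // mul1g.
exists ((b, pq) :: w); split; last by rewrite E word_val_cons.
  case/andP: rw => /= /andP[_ aw] pw; rewrite /reduced; apply/andP; split.
      by rewrite /= pq12.
    by move: pw; rewrite /=; case: (w).
by move=> c; rewrite /= !inE => ->; rewrite orbT.
Qed.

Lemma reduce_word (w : word) :
  exists w', [/\ reduced w', {subset map fst w' <= map fst w} &
    word_val w' = word_val w].
Proof.
elim: w => [|s w [v [rv vw E]]]; first by exists [::].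
have [w' [rw' w'v E']] := reduce_cons s rv.
exists w'; split=> //; last by rewrite E' !word_val_cons E.
move=> b /w'v; rewrite /= !inE => /orP[->//|/vw ->]; exact: orbT.
Qed.

End Reduction.

Section Transvections.
Local Open Scope ring_scope.
Local Notation M2 := 'M[{poly int}]_2.

(** The column (i, 1) times the row (1, -i), which annihilates it: hence a
square-zero matrix, and the transvections below fix the line of (i, 1). *)
Definition nilmx (i : nat) : M2 :=
  (\col_(p < 2) (if p == 0 then i%:R else 1)) *m
  (\row_(q < 2) (if q == 0 then 1 else - i%:R)).

Definition transvection (i : nat) (k : int) : M2 := 1 + (k%:~R * 'X) *: nilmx i.

Lemma nilmx2 i : nilmx i * nilmx i = 0.
Proof.
rewrite /nilmx -[_ * _]/(_ *m _) mulmxA -[X in X *m _]mulmxA.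
set m := _ *m (\col_p _); have -> : m = 0.
  by apply/matrixP=> p q; rewrite !mxE big_ord_recl big_ord1 !mxE /=; ring.
by rewrite mulmx0 mul0mx.
Qed.

Lemma transvectionD i k l :
  transvection i k * transvection i l = transvection i (k + l).
Proof.
rewrite /transvection mulrDl mul1r mulrDr mulr1 -scalerAl -scalerAr nilmx2.
by rewrite !scaler0 addr0 -addrA -scalerDl -mulrDl -intrD [l + k]addrC.
Qed.

Lemma transvection0 i : transvection i 0 = 1.
Proof. by rewrite /transvection mul0r scale0r addr0. Qed.

Lemma transvection_unit i k : transvection i k \is a GRing.unit.
Proof.
apply/unitrP; exists (transvection i (- k)).
by rewrite !transvectionD subrr addNr transvection0.
Qed.

Lemma transvectionV i k : (transvection i k)^-1 = transvection i (- k).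
Proof.
apply: (mulrI (transvection_unit i k)).
by rewrite mulrV ?transvection_unit // transvectionD subrr transvection0.
Qed.

Lemma transvection_mulE i k (W : M2) p q :
  (transvection i k * W) p q =
  W p q + (k%:~R * 'X) * (if p == 0 then i%:R else 1) * (W 0 q - i%:R * W 1 q).
Proof.
rewrite mulrDl mul1r mxE -scalerAl mxE; congr (_ + _); rewrite -mulrA.
congr (_ * _); rewrite /nilmx -[_ * W]/(_ *m W) -mulmxA mxE big_ord1 !mxE.
congr (_ * _).
rewrite big_ord_recl big_ord1 !mxE /= mul1r mulNr.
by congr (_ - _ * W _ _); apply/val_inj.
Qed.

(** Multiplying by the transvection of index i adds to a column the vector
(i, 1), scaled by [k * 'X] times the pairing of the column with (1, -i).  If the
top coefficients of the column are proportional to (j, 1), those of the pairing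
are proportional to j - i, which is nonzero because neighbours in the word
differ; so each syllable raises the degree by exactly one.  The second column of
the identity is (0, 1): the empty word counts as having index 0, and the letters
must avoid this index. *)
Lemma transvection_prod (w : seq (nat * int)) :
  all (fun s => (s.1 != 0)%N && (s.2 != 0)) w ->
  sorted (fun s t => s.1 != t.1) w ->
  let W : M2 := \prod_(s <- w) transvection s.1 s.2 in
  exists2 c : int, c != 0 &
    forall p : 'I_2, (size (W p 1%R) <= (size w).+1)%N /\
      (W p 1)`_(size w) = c * (if p == 0 then (head (0%N, 0) w).1%:R else 1).
Proof.
elim: w => [|[i k] w IH] /=.
  move=> _ _; exists 1 => // p; rewrite big_nil mxE.
  case: p => -[|[]] //= ?; rewrite ?size_poly0 ?coef0 ?mulr0 //.
  by rewrite -[_%:R]/(1 : {poly int}) size_poly1 coef1 mulr1.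
move=> /andP[/andP[i0 k0] aw] pw.
have [c c0 cW] := IH aw (path_sorted pw).
pose j := (head (0%N, 0) w).1; have ij : i != j.
  by move: pw; rewrite /j; case: (w) => [|s v] //= /andP[].
exists (k * (c * (j%:R - i%:R))).
  by rewrite !mulf_neq0 // subr_eq0 eqr_nat eq_sym.
move=> p; rewrite big_cons /= transvection_mulE.
set W := \prod_(s <- w) _ in cW *.
have [s0 e0] := cW 0; have [s1 e1] := cW 1; have [sp ep] := cW p.
pose D := W 0 1 - i%:R * W 1 1.
have EI : (i%:R : {poly int}) = (i%:R)%:P by rewrite rmorph_nat.
have sD : (size D <= (size w).+1)%N.
  rewrite /D (leq_trans (size_polyD _ _)) // geq_max s0 size_polyN EI mul_polyC.
  exact: leq_trans (size_scale_leq _ _) s1.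
have eD : D`_(size w) = c * (j%:R - i%:R).
  rewrite /D EI mul_polyC coefB coefZ e0 e1 /= mulr1 mulrBr.
  by rewrite [i%:R * c]mulrC.
have -> : k%:~R * 'X * (if p == 0 then i%:R else 1) * D =
          ((k * (if p == 0 then i%:R else 1)) *: D) * 'X.
  have -> : (k%:~R : {poly int}) = k%:P by rewrite -[in RHS](intz k) rmorph_int.
  by rewrite -!mul_polyC EI; case: ifP => _; ring.
set v : int := if p == 0 then i%:R else 1.
split.
  rewrite (leq_trans (size_polyD _ _)) // geq_max (leq_trans sp) //=.
  have [->|Z0] := eqVneq ((k * v) *: D) 0; first by rewrite mul0r size_poly0.
  by rewrite size_mulX // ltnS (leq_trans (size_scale_leq _ _)).
rewrite coefD coefMX /= coefZ eD nth_default // add0r; ring.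
Qed.

Lemma transvection_prod_neq0 (w : seq (nat * int)) : w != [::] ->
  all (fun s => (s.1 != 0)%N && (s.2 != 0)) w ->
  sorted (fun s t => s.1 != t.1) w ->
  (\prod_(s <- w) transvection s.1 s.2) 0 1 != 0.
Proof.
case: w => [//|s w] _ aw sw; have [c c0 /(_ 0)[_ E]] := transvection_prod aw sw.
apply/eqP => W0; move/eqP: E; rewrite W0 coef0 eq_sym /= mulf_eq0 (negPf c0) /=.
by case/andP: aw => /andP[s0 _] _; rewrite pnatr_eq0 (negPf s0).
Qed.

(** Over the field of fractions, a matrix commuting with X, whose corner is
nonzero, is a combination of 1 and X, and such combinations commute. *)
Lemma mx2_commute_trans (K : idomainType) (X Y Z : 'M[K]_2) : X 0 1 != 0 ->
  Y * X = X * Y -> X * Z = Z * X -> Y * Z = Z * Y.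
Proof.
move=> x0 YX XZ.
have E (A C : 'M[K]_2) p q : (A * C) p q = A p 0 * C 0 q + A p 1 * C 1 q.
  rewrite mxE big_ord_recl big_ord1; congr (_ + A _ _ * C _ _); exact/val_inj.
have e (A C : 'M[K]_2) (AC : A * C = C * A) p q :
  A p 0 * C 0 q + A p 1 * C 1 q = C p 0 * A 0 q + C p 1 * A 1 q.
  by have := congr1 (fun M : 'M[K]_2 => M p q) AC; rewrite !E.
have y00 := e _ _ YX 0 0; have y01 := e _ _ YX 0 1; have y10 := e _ _ YX 1 0.
have z00 := e _ _ XZ 0 0; have z01 := e _ _ XZ 0 1; have z10 := e _ _ XZ 1 0.
apply/matrixP => p q; rewrite !E.
have I2 (i : 'I_2) : i = 0 \/ i = 1.
  by case: i => -[|[]] //= ?; [left|right]; exact/val_inj.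
pose x := X 0 1; pose d := X 0 0 - X 1 1.
have lin (a b c l : K) : c = l -> a - b = c - l -> a = b.
  by move=> -> /eqP; rewrite subrr subr_eq0 => /eqP.
have yA : x * Y 1 0 = Y 0 1 * X 1 0 by apply: (lin _ _ _ _ (esym y00)); rewrite /x; ring.
have zA : x * Z 1 0 = Z 0 1 * X 1 0 by apply: (lin _ _ _ _ z00); rewrite /x; ring.
have yB : (Y 0 0 - Y 1 1) * x = Y 0 1 * d by apply: (lin _ _ _ _ y01); rewrite /x /d; ring.
have zB : (Z 0 0 - Z 1 1) * x = Z 0 1 * d.
  by apply: (lin _ _ _ _ (esym z01)); rewrite /x /d; ring.
(* The relations yA to zB determine the entries of Y and Z only up to the factor
   x, so the identity is proved after multiplication by x ^+ 2. *)
apply: (mulfI x0); apply: (mulfI x0); rewrite -/x.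
apply/eqP; rewrite -subr_eq0 -!mulrBr; apply/eqP.
case: (I2 p) => ->; case: (I2 q) => ->.
- rewrite (_ : x * _ = x * (Y 0 1 * (x * Z 1 0) - Z 0 1 * (x * Y 1 0))); last ring.
  rewrite yA zA; ring.
- rewrite (_ : x * _ = x * (((Y 0 0 - Y 1 1) * x) * Z 0 1
    - ((Z 0 0 - Z 1 1) * x) * Y 0 1)); last ring.
  rewrite yB zB; ring.
- rewrite (_ : x * _ = ((Z 0 0 - Z 1 1) * x) * (x * Y 1 0)
    - ((Y 0 0 - Y 1 1) * x) * (x * Z 1 0)); last ring.
  rewrite yA zA yB zB; ring.
- rewrite (_ : x * _ = x * (Z 0 1 * (x * Y 1 0) - Y 0 1 * (x * Z 1 0))); last ring.
  rewrite yA zA; ring.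
Qed.
End Transvections.

Section FreeGroups.
Local Open Scope group_scope.

(** Number the finitely many letters of the reduced words of b and of
[a * c / (c * a)], and send each one to a transvection.  A nontrivial element
with a reduced word in these letters is then mapped to a matrix with a nonzero
corner.  This applies to b, so the images of a and c, which commute with that of
b, commute with each other; then [a * c / (c * a)] is mapped to 1, whose corner
vanishes, and so it is trivial. *)
Lemma free_commute_trans (F : groupType) (a b c : F) : free_group F ->
  b <> 1 -> a * b = b * a -> b * c = c * b -> a * c = c * a.
Proof.
case=> B freeB b1 ab bc; apply: contrapT => ac.
have w1 : a * c / (c * a) <> 1 by move=> /divg1_eq.
have reducedE x : exists2 w, in_basis B w & reduced w /\ x = word_val w.
  have [v Bv ->] := basis_generates freeB x.
  have [w [rw wv E]] := reduce_word v; exists w; last by [].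
  move=> s /(map_f fst)/wv/mapP[s' /Bv + ->]; exact.
have [wb Bb [rb Eb]] := reducedE b.
have [w Bw [rw Ew]] := reducedE (a * c / (c * a)).
pose S := map fst (wb ++ w).
(* The successor keeps the letters away from the index 0 of the empty word. *)
pose code x := (index x S).+1.
pose f x : unit_group 'M[{poly int}]_2 :=
  exist _ (transvection (code x) 1) (transvection_unit (code x) 1).
have [phi [phiB _]] := freeB _ f.
pose rho (x : F) : 'M[{poly int}]_2 := sval (phi x).
have rhoM x y : rho (x * y) = (rho x * rho y)%R by rewrite /rho gmulfM.
have rho1 : rho 1 = 1%R by rewrite /rho morph1.
have rho_word_val v : in_basis B v -> rho (word_val v) =
    (\prod_(s <- [seq (code s.1, s.2.1%:Z - s.2.2%:Z) | s <- v])
       transvection s.1 s.2)%R.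
  elim: v => [|[x p] v IH] Bv; first by rewrite /word_val !big_nil.
  rewrite word_val_cons rhoM big_cons IH => [|s sv]; last first.
    by apply: Bv; rewrite inE sv orbT.
  congr (_ * _)%R; rewrite /syllable /rho gmulfM morphV !morphX /=.
  rewrite phiB; last by apply: (Bv (x, p)); rewrite inE eqxx.
  have X n : sval (f x ^+ n) = transvection (code x) n.
    elim: n => [|n IHn]; first by rewrite expg0 transvection0.
    by rewrite expgS /= IHn transvectionD -intS.
  by rewrite X X transvectionV transvectionD.
have rho_neq0 v : word_val v <> 1 -> in_basis B v -> reduced v ->
    {subset map fst v <= S} -> rho (word_val v) ord0 1%R != 0%R.
  move=> v1 Bv /andP[nv sv] vS; rewrite rho_word_val //.
  apply: transvection_prod_neq0.
  - by case: (v) v1 => // -[]; rewrite /word_val big_nil.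
  - rewrite all_map; apply: sub_all nv => -[x p] /= p12.
    by rewrite subr_eq0 eqz_nat.
  rewrite sorted_map; apply: (@sub_in_sorted _ [pred s | s.1 \in S] _ _ _ v) sv.
    move=> s t sS tS /=; apply: contraNneq => -[] E.
    by rewrite -(nth_index 1 sS) -(nth_index 1 tS) E.
  by apply/allP => s sv'; apply/vS/map_f.
have rb0 : rho b ord0 1%R != 0%R.
  by rewrite Eb rho_neq0 -?Eb // => x xw; rewrite /S map_cat mem_cat xw.
have /eqP[] : rho (a * c / (c * a)) ord0 1%R != 0%R.
  by rewrite Ew rho_neq0 -?Ew // => x xw; rewrite /S map_cat mem_cat xw orbT.
have AC : rho (a * c) = rho (c * a).
  rewrite !rhoM; apply: mx2_commute_trans rb0 _ _; first by rewrite -!rhoM ab.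
  by rewrite -!rhoM bc.
have : rho (a * c / (c * a)) = rho (c * a / (c * a)) by rewrite !(rhoM _ (_^-1)) AC.
by rewrite mulgV rho1 => ->; rewrite mxE.
Qed.
End FreeGroups.

Local Open Scope classical_set_scope.
Local Open Scope ring_scope.
Local Open Scope complex_scope.

(** * Continuity over the complex numbers and the exponential of an angle *)

Section ComplexContinuity.
Context {R : realType}.
Local Notation C := (R[i] : numClosedFieldType).

Lemma Re_continuous : continuous (fun z : C => complex.Re z : R).
Proof.
move=> z; apply/(@cvgrPdist_lt _ _ C (nbhs z)) => e e0; near=> w.
rewrite -raddfB -ltcR; apply: (le_lt_trans (normc_ge_Re _)).
by near: w; apply: (@cvgr_dist_lt C C C (nbhs z)) => //; rewrite ltcR.
Unshelve. all: by end_near. Qed.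

Lemma Im_continuous : continuous (fun z : C => complex.Im z : R).
Proof.
have -> : (fun z : C => complex.Im z : R) = (fun z : C => - complex.Re (z * 'i%C)).
  by apply/funext => z; rewrite ReiNIm opprK.
move=> z; apply: (@cvgN _ _ C (nbhs z) _ (fun z : C => complex.Re (z * 'i%C : C))).
have ci : continuous (fun z : C => z * 'i%C : C).
  exact: (@mulrr_continuous C).
exact: (@continuous_comp C C R _ (fun z : C => complex.Re z : R) z (ci z)
  (@Re_continuous (z * 'i%C))).
Qed.

Lemma real_complex_continuous : continuous (fun x : R => x%:C : C).
Proof.
move=> x; apply/(@cvgrPdist_lt C C R (nbhs x)) => e.
rewrite ltcE /= => /andP[/eqP e0 e1].
have -> : e = (complex.Re e)%:C by case: e e0 e1 => a b /= ->.
near=> y; rewrite -rmorphB /= normc_def /= expr0n /= addr0 sqrtr_sqr ltcR.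
by near: y; apply: (@cvgr_dist_lt _ _ R (nbhs x)).
Unshelve. all: by end_near. Qed.

Context {X : topologicalType}.
Implicit Types (f g : X -> C) (u v : X -> R).

Lemma cadd_continuous f g : continuous f -> continuous g ->
  continuous (fun x => f x + g x : C).
Proof. by move=> cf cg x; apply: cvgD; [exact: cf|exact: cg]. Qed.
Lemma csub_continuous f g : continuous f -> continuous g ->
  continuous (fun x => f x - g x : C).
Proof. by move=> cf cg x; apply: cvgB; [exact: cf|exact: cg]. Qed.
Lemma cmul_continuous f g : continuous f -> continuous g ->
  continuous (fun x => f x * g x : C).
Proof. by move=> cf cg x; apply: cvgM; [exact: cf|exact: cg]. Qed.
Lemma cinv_continuous f : continuous f -> (forall x, f x != 0) ->
  continuous (fun x => (f x)^-1 : C).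
Proof. by move=> cf f0 x; apply: cvgV; [exact: f0|exact: cf]. Qed.
Lemma creal_continuous u : continuous u -> continuous (fun x => (u x)%:C : C).
Proof.
move=> cu x; apply: (continuous_comp (cu x)); exact: real_complex_continuous.
Qed.
Lemma cRe_continuous f : continuous f -> continuous (fun x => complex.Re (f x) : R).
Proof. move=> cf x; apply: (continuous_comp (cf x)); exact: Re_continuous. Qed.
Lemma cIm_continuous f : continuous f -> continuous (fun x => complex.Im (f x) : R).
Proof. move=> cf x; apply: (continuous_comp (cf x)); exact: Im_continuous. Qed.

(** The norm of a complex number is itself a complex number; this is its value as
a real number. *)
Definition modulus (z : C) : R := complex.Re `|z|.

Lemma modulusE z : (modulus z)%:C = `|z|.
Proof. by rewrite /modulus normc_def. Qed.
Lemma modulus_gt0 z : (0 < modulus z) = (z != 0).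
Proof. by rewrite -ltcR modulusE normr_gt0. Qed.

Lemma modulus_continuous f : continuous f -> continuous (fun x => modulus (f x)).
Proof.
move=> cf; apply: cRe_continuous => x; apply: (continuous_comp (cf x)).
exact: (@norm_continuous C C).
Qed.

Definition expi (t : R) : C := cos t +i* sin t.

Lemma expi0 : expi 0 = 1.
Proof. by rewrite /expi cos0 sin0. Qed.
Lemma expiD s t : expi (s + t) = expi s * expi t.
Proof.
by apply/eqP; rewrite /expi cosD sinD eq_complex /=; apply/andP; split;
  apply/eqP; ring.
Qed.
Lemma expi_norm t : `|expi t| = 1.
Proof. by rewrite normc_def /= cos2Dsin2 sqrtr1. Qed.
Lemma expi_neq0 t : expi t != 0.
Proof. by rewrite -normr_gt0 expi_norm ltr01. Qed.
Lemma expiN t : expi (- t) = (expi t)^-1.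
Proof.
by apply: (mulfI (expi_neq0 t)); rewrite -expiD subrr expi0 mulfV ?expi_neq0.
Qed.
Lemma expiB s t : expi (s - t) = expi s / expi t.
Proof. by rewrite expiD expiN. Qed.
Lemma expiM t n : expi (t *+ n) = expi t ^+ n.
Proof.
by elim: n => [|n IH]; rewrite ?mulr0n ?expi0 // mulrS expiD IH exprS.
Qed.
Lemma expi_pi : expi pi = -1.
Proof. by rewrite /expi cospi sinpi complexr0 rmorphN1. Qed.
Lemma expi_2pi : expi (2 * pi) = 1.
Proof. by rewrite mulr_natl expiM expi_pi sqrrN expr1n. Qed.

Lemma expi_continuous u : continuous u -> continuous (fun x => expi (u x)).
Proof.
move=> cu.
have -> : (fun x => expi (u x)) =
    (fun x => (cos (u x))%:C + 'i%C * (sin (u x))%:C : C).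
  by apply/funext => x; rewrite [LHS]complexE.
apply: cadd_continuous; last apply: cmul_continuous.
- by apply: creal_continuous => x; apply: (continuous_comp (cu x)); exact: continuous_cos.
- exact: cst_continuous.
- by apply: creal_continuous => x; apply: (continuous_comp (cu x)); exact: continuous_sin.
Qed.

(** On [0, pi] the cosine is injective, and beyond pi the sine stays negative
until a full turn is completed. *)
Lemma expi_eq1_small t : expi t = 1 -> `|t| < 2 * pi -> t = 0.
Proof.
wlog t0 : t / 0 <= t => [H|].
  have [/H//|/ltW t0 e] := leP 0 t; rewrite -normrN => tpi.
  apply/eqP; rewrite -oppr_eq0; apply/eqP; apply: H => //; first by rewrite oppr_ge0.
  by rewrite expiN e invr1.
move=> [ct st]; rewrite ger0_norm // => t2.
have [tpi|tpi] := leP t pi.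
  by apply: (@cos_inj R); rewrite ?in_itv /= ?lexx ?pi_ge0 ?t0 ?tpi // cos0.
have := @sin_gt0_pi R (t - pi); rewrite sinB cospi sinpi st mulr0 mul0r subrr ltxx.
suff -> : 0 < t - pi < pi by move/(_ isT).
by apply/andP; split; lra.
Qed.

Lemma expi_eq1 t : expi t = 1 -> exists k : int, t = 2 * pi * k%:~R.
Proof.
move=> e; have p0 : 0 < 2 * pi :> R by rewrite mulr_gt0 ?pi_gt0.
exists (Num.floor (t / (2 * pi))); set k := Num.floor _.
have kt : expi (t - 2 * pi * k%:~R) = 1.
  suff ek : expi (2 * pi * k%:~R) = 1 by rewrite expiB e ek divr1.
  by case: k => n; rewrite ?NegzE ?mulrNz ?mulrN ?expiN -[_%:~R]/(_%:R) mulr_natr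
     expiM expi_2pi expr1n ?invr1.
apply/eqP; rewrite -subr_eq0; apply/eqP; apply: expi_eq1_small => //.
have := @floor_itv _ (t / (2 * pi)); rewrite -/k intrD => /andP[k1 k2].
move: k1 k2; rewrite ler_pdivlMr // ltr_pdivrMr // => k1 k2.
by rewrite ger0_norm; lra.
Qed.

End ComplexContinuity.

(** * Continuous arguments on contractible compact spaces *)

Section ArgumentLifts.
Context {R : realType}.
Local Notation C := (R[i] : numClosedFieldType).
Local Notation I := (itv01 R).

(** Meaningful on the right half-plane only, where the argument is the arctangent
of the slope. *)
Definition arg1 (z : C) : R := atan (complex.Im z / complex.Re z).

Lemma arg1_bound z : `|arg1 z| < pi / 2.
Proof. by rewrite ltr_norml atan_gtNpi2 atan_ltpi2. Qed.

Lemma arg1P (z : C) : 0 < complex.Re z -> 0 < z / expi (arg1 z).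
Proof.
case: z => x y /= x0; set t := arg1 _.
have ct : 0 < cos t by apply: cos_gt0_pihalf; rewrite atan_gtNpi2 atan_ltpi2.
have st : sin t = cos t * (y / x).
  have := atanK (y / x); rewrite -/(arg1 (x +i* y)) -/t /tan => <-.
  by rewrite mulrCA divff ?mulr1 // gt_eqF.
rewrite (_ : x +i* y = (x / cos t)%:C * expi t :> C).
  by rewrite mulfK ?expi_neq0 // ltcR divr_gt0.
apply/eqP; rewrite /expi st eq_complex /=; apply/andP.
by split; apply/eqP; field; rewrite !gt_eqF.
Qed.

Lemma argD (z w : C) (s t : R) :
  0 < z / expi s -> 0 < w / expi t -> 0 < (z * w) / expi (s + t).
Proof. by move=> zs wt; rewrite expiD -mulf_div mulr_gt0. Qed.

Lemma argV (z : C) (s : R) : 0 < z / expi s -> 0 < z^-1 / expi (- s).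
Proof. by move=> zs; rewrite expiN -invfM invr_gt0. Qed.

Lemma arg_expi (t : R) : 0 < expi t / expi t :> C.
Proof. by rewrite divff ?expi_neq0 ?ltr01. Qed.

Lemma arg_neq0 (z : C) s : 0 < z / expi s -> z != 0.
Proof. by apply: contraTneq => ->; rewrite mul0r ltxx. Qed.

(** One of the rotations by 0, pi, pi / 2 and - pi / 2 brings z into the right
half-plane. *)
Lemma arg_exists (z : C) : z != 0 -> exists s, 0 < z / expi s.
Proof.
move=> z0.
have rot b : 0 < complex.Re (z / expi b) -> exists s, 0 < z / expi s.
  move=> /arg1P zb; exists (arg1 (z / expi b) + b).
  by have := argD zb (arg_expi b); rewrite divfK ?expi_neq0.
have piE : expi (pi / 2) = 'i%C :> C by rewrite /expi cos_pihalf sin_pihalf.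
case: (ltgtP (complex.Re z) 0) => [x0|x0|x0].
- apply: (rot pi); rewrite expi_pi invrN1 mulrN1; case: z x0 {z0 rot} => a b /=; lra.
- by apply: (rot 0); rewrite expi0 divr1.
have y0 : complex.Im z != 0.
  by apply: contraNneq z0 => y0; rewrite eq_complex x0 y0 eqxx.
case: (ltgtP (complex.Im z) 0) => [y1|y1|y1]; last by rewrite y1 eqxx in y0.
- apply: (rot (- (pi / 2))); rewrite expiN invrK piE.
  case: z y1 {z0 rot x0 y0} => a b /=; lra.
- apply: (rot (pi / 2)); rewrite piE.
  case: z y1 {z0 rot x0 y0} => a b /= b0.
  by rewrite expr0n expr1n /= add0r !divr1; lra.
Qed.

Lemma arg_unique (z : C) (s t : R) : 0 < z / expi s -> 0 < z / expi t ->
  expi (s - t) = 1.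
Proof.
move=> zs zt; have z0 := arg_neq0 zs.
have : 0 < expi (s - t).
  have := mulr_gt0 zt (_ : 0 < (z / expi s)^-1).
  rewrite invr_gt0 => /(_ zs); rewrite invf_div mulrC mulrA divfK // expiB //.
by move=> e0; rewrite -(gtr0_norm e0) expi_norm.
Qed.

Section OnSpace.
Context {X : topologicalType}.

Lemma arg1_continuous (f : X -> C) : continuous f -> (forall x, 0 < complex.Re (f x)) ->
  continuous (fun x => arg1 (f x)).
Proof.
move=> cf f0 x; apply: (@continuous_comp _ _ _
  (fun x => complex.Im (f x) / complex.Re (f x)) atan).
  apply: cvgM; first exact: cIm_continuous.
  by apply: cvgV; [rewrite gt_eqF|exact: cRe_continuous].
exact: continuous_atan.
Qed.

(** Positivity of a complex number includes its being real, so [phi x] is an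
argument of [f x]. *)
Definition is_arg (f : X -> C) (phi : X -> R) :=
  continuous phi /\ forall x, 0 < f x / expi (phi x).

Lemma is_argM f g phi psi : is_arg f phi -> is_arg g psi ->
  is_arg (fun x => f x * g x) (fun x => phi x + psi x).
Proof.
move=> [cf f0] [cg g0]; split=> [x|x]; last exact: argD.
by apply: cvgD; [exact: cf|exact: cg].
Qed.

Lemma is_argV f phi : is_arg f phi ->
  is_arg (fun x => (f x)^-1) (fun x => - phi x).
Proof.
by move=> [cf f0]; split=> [x|x]; [apply: cvgN; exact: cf|exact: argV].
Qed.

End OnSpace.

(** Cut the contraction into N steps so short that f changes at each of them by a
factor of positive real part; compactness makes the same N work for all points.
The arguments of these factors are arctangents, hence continuous, and adding them
to an argument of f at the centre yields an argument of f. *)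
Lemma arg_lift_exists (D : topologicalType) (d0 : D) (h : D * I -> D)
    (f : D -> C) : compact [set: D] -> continuous h ->
  (forall d, h (d, zero) = d0) -> (forall d, h (d, one) = d) ->
  continuous f -> (forall d, f d != 0) -> exists phi, is_arg f phi.
Proof.
move=> cD ch h0 h1 cf f0.
pose F (dr : D * R) : C := f (h (dr.1, clamp01 dr.2)).
have cF : continuous F.
  apply: comp_continuous cf _; apply: pair_comp_continuous ch _ _.
    exact: fst_continuous.
  by apply: clamp01_comp_continuous; exact: snd_continuous.
have F0 dr : F dr != 0 by exact: f0.
(* The real part of the factor by which f changes along the contraction of a
   point, from the time r to the time r + s. *)
pose q (drs : (D * R) * R) : R :=
  complex.Re (F (drs.1.1, drs.1.2 + drs.2) / F drs.1).
have cq : continuous q.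
  apply: cRe_continuous; apply: cmul_continuous.
    apply: pair_comp_continuous cF _ _.
      by apply: comp_continuous; exact: fst_continuous.
    move=> drs; apply: cvgD; last exact: snd_continuous.
    by move: drs; apply: comp_continuous; [exact: snd_continuous|exact: fst_continuous].
  apply: cinv_continuous => [|drs]; last exact: F0.
  by apply: comp_continuous cF _; exact: fst_continuous.
have cK : compact ([set: D] `*` `[0 : R, 1]%classic).
  by apply: compact_setX => //; exact: segment_compact.
have near_s : \forall s \near (0 : R),
    [set: D] `*` `[0 : R, 1]%classic `<=` (fun dr => 0 < q (dr, s)).
  apply: (iffLR (compact_near_coveringP _) cK R (nbhs (0 : R))
    (fun s dr => 0 < q (dr, s))) => dr _.
  have q1 : 0 < q (dr, 0).
    by rewrite /q /= addr0 -surjective_pairing divff //= ltr01.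
  have := cvgr_gt _ (cq (dr, 0)) 0 q1.
  case=> -[A B] /= [nA nB] AB; exists (A, B); first by [].
  by move=> [x s] /= ABx; exact: (AB (x, s)).
have [e e0 be] := near_s; rewrite /= in e0.
have [N Ne] : exists N : nat, N.+1%:R^-1 < e.
  exists (Num.truncn e^-1); rewrite invf_plt ?posrE ?ltr0n //.
  by have := truncnS_gt e^-1.
have qpos d k : (k <= N)%N ->
    0 < complex.Re (F (d, k.+1%:R / N.+1%:R) / F (d, k%:R / N.+1%:R)).
  move=> kN; have := be N.+1%:R^-1 _ (d, k%:R / N.+1%:R).
  rewrite /q /= (_ : k%:R / _ + _ = k.+1%:R / N.+1%:R); last first.
    by rewrite -[k.+1%:R]natr1 mulrDl mul1r.
  apply.
    by rewrite sub0r normrN gtr0_norm ?invr_gt0 ?ltr0n.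
  split=> //=; rewrite in_itv /= divr_ge0 ?ler0n //=.
  by rewrite ler_pdivrMr ?ltr0n // mul1r ler_nat ltnW.
have [t0 t0P] := arg_exists (f0 d0).
pose step k d := arg1 (F (d, k.+1%:R / N.+1%:R) / F (d, k%:R / N.+1%:R)).
pose phi n d := t0 + \sum_(k < n) step k d.
have cFk k : continuous (fun d => F (d, k%:R / N.+1%:R)).
  by apply: pair_comp_continuous cF _ _ => d; [exact: cvg_id|exact: cvg_cst].
have phi_continuous n : (n <= N.+1)%N -> continuous (phi n).
  elim: n => [|n IH] nN.
    by rewrite /phi => d; under eq_fun do rewrite big_ord0; exact: cvg_cst.
  have E : phi n.+1 = (fun d => phi n d + step n d).
    by apply/funext => d; rewrite /phi big_ord_recr /= addrA.
  rewrite E => d; apply: cvgD; first by apply: IH; exact: ltnW.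
  move: d; apply: arg1_continuous => [|d]; last exact: qpos.
  apply: cmul_continuous; first exact: cFk.
  by apply: cinv_continuous; [exact: cFk|move=> d; exact: F0].
have phiP n d : (n <= N.+1)%N -> 0 < F (d, n%:R / N.+1%:R) / expi (phi n d).
  elim: n => [|n IH] nN.
    by rewrite /phi big_ord0 addr0 mul0r /F /= clamp01_le0 // h0.
  have := argD (IH (ltnW nN)) (arg1P (qpos d n nN)).
  by rewrite [X in X / expi _]mulrC divfK // /phi big_ord_recr /= addrA.
exists (phi N.+1); split; first exact: phi_continuous.
move=> d; have := phiP N.+1 d (leqnn _).
by rewrite divff ?pnatr_eq0 // /F /= clamp01_ge1 // h1.
Qed.
End ArgumentLifts.

(** * Total variation of the argument *)

Section Turning.
Context {R : realType}.
Local Notation C := (R[i] : numClosedFieldType).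
Local Notation I := (itv01 R).

Lemma itv01_compact : compact [set: I].
Proof.
have -> : [set: I] = @clamp01 R @` `[0, 1]%classic.
  apply/seteqP; split=> // t _; exists (val t); last exact: clamp01K.
  by rewrite /= in_itv /=; exact: itv01_bounds.
apply: continuous_compact; last exact: segment_compact.
exact/continuous_subspaceT/clamp01_continuous.
Qed.

Lemma path_cat_fun_continuous (T : topologicalType) (p q : I -> T) :
  continuous p -> continuous q -> p one = q zero ->
  continuous (path_cat_fun p q).
Proof.
move=> cp cq pq.
pose P : {path I from p zero to q zero in T} := mk_path cp erefl pq.
pose Q : {path I from q zero to q one in T} := mk_path cq erefl erefl.
exact: (@path_cat_continuous _ _ _ _ _ P Q).
Qed.

Lemma path_rev_fun_continuous (T : topologicalType) (p : I -> T) :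
  continuous p -> continuous (path_rev_fun p).
Proof.
move=> cp; pose P : {path I from p zero to p one in T} := mk_path cp erefl erefl.
exact: (@path_rev_continuous _ _ _ _ P).
Qed.

Lemma path_cat_fun0 (T : topologicalType) (p q : I -> T) :
  path_cat_fun p q zero = p zero.
Proof.
by rewrite /path_cat_fun val_zero01 invr_ge0 ler0n mulr0 clamp01_le0.
Qed.

Lemma path_cat_fun1 (T : topologicalType) (p q : I -> T) : path_cat_fun p q one = q one.
Proof.
rewrite /path_cat_fun val_one01 ifF; last by apply/negbTE; rewrite -ltNge; lra.
by rewrite clamp01_ge1 //; lra.
Qed.

Lemma path_rev_fun0 (T : topologicalType) (p : I -> T) : path_rev_fun p zero = p one.
Proof. by rewrite /path_rev_fun val_zero01 subr0 clamp01_ge1. Qed.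

Lemma path_rev_fun1 (T : topologicalType) (p : I -> T) : path_rev_fun p one = p zero.
Proof. by rewrite /path_rev_fun val_one01 subrr clamp01_le0. Qed.

Lemma path_cat_fun_app (S T : topologicalType) (f : S -> T) (p q : I -> S) t :
  f (path_cat_fun p q t) = path_cat_fun (f \o p) (f \o q) t.
Proof. by rewrite /path_cat_fun; case: ifP. Qed.

Definition nonvanishing {X : topologicalType} (f : X -> C) :=
  continuous f /\ forall x, f x != 0.

Lemma nonvanishingM (X : topologicalType) (f g : X -> C) :
  nonvanishing f -> nonvanishing g -> nonvanishing (fun x => f x * g x).
Proof.
by move=> [cf f0] [cg g0]; split=> [|x]; [exact: (cmul_continuous cf cg)|exact: mulf_neq0].
Qed.
Lemma nonvanishingV (X : topologicalType) (f : X -> C) :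
  nonvanishing f -> nonvanishing (fun x => (f x)^-1).
Proof. by move=> [cf f0]; split=> [|x]; [exact: (cinv_continuous cf f0)|exact: invr_neq0]. Qed.
Lemma nonvanishing_cst (X : topologicalType) (c : C) :
  c != 0 -> nonvanishing (fun _ : X => c).
Proof. by move=> c0; split=> // ; exact: cst_continuous. Qed.
Lemma nonvanishing_cat (f g : I -> C) :
  nonvanishing f -> nonvanishing g -> f one = g zero ->
  nonvanishing (path_cat_fun f g).
Proof.
move=> [cf f0] [cg g0] fg; split; first exact: (path_cat_fun_continuous cf cg fg).
by move=> t; rewrite /path_cat_fun; case: ifP => _; [exact: f0|exact: g0].
Qed.
Lemma nonvanishing_rev (f : I -> C) : nonvanishing f -> nonvanishing (path_rev_fun f).
Proof.
by move=> [cf f0]; split; [exact: (path_rev_fun_continuous cf)|move=> t; exact: f0].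
Qed.

Lemma is_arg_exists1 (f : I -> C) : nonvanishing f -> exists phi, is_arg f phi.
Proof.
move=> [cf f0]; pose h (ts : I * I) : I := clamp01 (val ts.2 * val ts.1).
apply: (@arg_lift_exists R I zero h) => // [||d|d].
- exact: itv01_compact.
- apply: clamp01_comp_continuous => ts; apply: cvgM.
    exact: val_snd_continuous.
  exact: val_fst_continuous.
- by rewrite /h; cbn [fst snd]; rewrite val_zero01 mul0r clamp01_le0.
- by rewrite /h; cbn [fst snd]; rewrite val_one01 mul1r clamp01K.
Qed.

Lemma is_arg_exists2 (f : I * I -> C) : nonvanishing f -> exists phi, is_arg f phi.
Proof.
move=> [cf f0].
pose h (ts : (I * I) * I) : I * I :=
  (clamp01 (val ts.2 * val ts.1.1), clamp01 (val ts.2 * val ts.1.2)).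
apply: (@arg_lift_exists R _ (zero, zero) h) => // [||d|d].
- rewrite -setXTT; apply: compact_setX; exact: itv01_compact.
- apply: (@pair_comp_continuous _ _ _ _ id).
  + by move=> x; exact: cvg_id.
  + apply: clamp01_comp_continuous => ts; apply: cvgM.
      by move: ts; apply: comp_continuous; [exact: val01_continuous|exact: snd_continuous].
    by move: ts; apply: (@comp_continuous _ _ _ (fun st : I * I => val st.1) fst);
      [exact: val_fst_continuous|exact: fst_continuous].
  + apply: clamp01_comp_continuous => ts; apply: cvgM.
      by move: ts; apply: comp_continuous; [exact: val01_continuous|exact: snd_continuous].
    by move: ts; apply: (@comp_continuous _ _ _ (fun st : I * I => val st.2) fst);
      [exact: val_snd_continuous|exact: fst_continuous].
- by rewrite /h; cbn [fst snd]; rewrite val_zero01 !mul0r clamp01_le0.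
- rewrite /h; cbn [fst snd]; rewrite val_one01 !mul1r !clamp01K.
  by case: d.
Qed.

(** By the intermediate value theorem, an angle that moves would also take a value
differing from the initial one by less than a full turn. *)
Lemma angle_constant (d : I -> R) : continuous d ->
  (forall t, expi (d t) = 1) -> forall t, d t = d zero.
Proof.
move=> cd d1 t0.
wlog d0 : d cd d1 / d zero < d t0 => [H|].
  case: (ltgtP (d zero) (d t0)) => [/H->//|lt|//].
  apply: oppr_inj; apply: (H (fun t => - d t)) => [t|t|]; last by rewrite ltrN2.
    exact: (cvgN (cd t)).
  by rewrite expiN d1 invr1.
exfalso; pose m := Num.min (d t0) (d zero + pi).
have m0 : d zero < m by rewrite lt_min d0 ltrDl pi_gt0.
have [|||c _ dc] := @IVT R (fun t => d (clamp01 t)) 0 (val t0)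
    ((d zero + m) / 2).
- by have /andP[] := itv01_bounds t0.
- apply: continuous_subspaceT.
  by apply: comp_continuous; [exact: cd|exact: clamp01_continuous].
- rewrite clamp01K clamp01_le0 // min_l ?max_r ?(ltW d0) //.
  have : m <= d t0 by rewrite ge_min lexx.
  by move=> mt; apply/andP; split; lra.
have mp : m <= d zero + pi by rewrite ge_min lexx orbT.
have e : expi ((m - d zero) / 2) = 1 :> C.
  have -> : (m - d zero) / 2 = d (clamp01 c) - d zero by rewrite dc; lra.
  by rewrite expiB !d1 divr1.
have := expi_eq1_small e; have := @pi_gt0 R => p0.
by rewrite ger0_norm; [move=> /(_ _)H; have := H ltac:(lra)|]; lra.
Qed.

Lemma is_arg_unique (f : I -> C) phi psi : is_arg f phi -> is_arg f psi ->
  forall t, phi t - psi t = phi zero - psi zero.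
Proof.
move=> [cf f0] [cg g0]; apply: (angle_constant (d := fun t => phi t - psi t)).
  by move=> t; exact: (cvgB (cf t) (cg t)).
by move=> t; exact: arg_unique (f0 t) (g0 t).
Qed.

(** For a loop this is 2 pi times the winding number around 0.  The default value is
never taken on a nonvanishing path, by [is_arg_exists1]. *)
Definition turn (f : I -> C) : R :=
  xget 0 [set d | exists2 phi, is_arg f phi & d = phi one - phi zero].

Lemma turnE f phi : is_arg f phi -> turn f = phi one - phi zero.
Proof.
move=> fphi; rewrite /turn; case: xgetP => [d _ [psi fpsi ->]|/(_ (phi one - phi zero))[]].
  by have := is_arg_unique fphi fpsi one; lra.
by exists phi.
Qed.

Lemma turnM f g : nonvanishing f -> nonvanishing g ->
  turn (fun t => f t * g t) = turn f + turn g.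
Proof.
move=> /is_arg_exists1[phi fphi] /is_arg_exists1[psi gpsi].
by rewrite (turnE fphi) (turnE gpsi) (turnE (is_argM fphi gpsi)); lra.
Qed.

Lemma turnV f : nonvanishing f -> turn (fun t => (f t)^-1) = - turn f.
Proof.
move=> /is_arg_exists1[phi fphi].
by rewrite (turnE fphi) (turnE (is_argV fphi)); lra.
Qed.

Lemma turn_cst c : c != 0 -> turn (fun=> c) = 0.
Proof.
move=> c0; have [s sP] := arg_exists c0.
have A : is_arg (fun=> c) (fun _ : I => s).
  by split; [exact: cst_continuous|move=> _; exact: sP].
by rewrite (turnE A) subrr.
Qed.

Lemma turnZ c f : c != 0 -> nonvanishing f -> turn (fun t => c * f t) = turn f.
Proof. by move=> c0 nf; rewrite turnM ?turn_cst ?add0r //; exact: nonvanishing_cst. Qed.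

Lemma turnN f : nonvanishing f -> turn (fun t => - f t) = turn f.
Proof.
move=> nf; have N1 : -1 != 0 :> C by rewrite oppr_eq0 oner_eq0.
rewrite -(turnZ N1 nf).
by congr turn; apply/funext => t; rewrite mulN1r.
Qed.

Lemma turn_cat f g : nonvanishing f -> nonvanishing g -> f one = g zero ->
  turn (path_cat_fun f g) = turn f + turn g.
Proof.
move=> /is_arg_exists1[phi [cf f0]] /is_arg_exists1[psi [cg g0]] fg.
pose c := phi one - psi zero.
have c1 : expi c = 1 :> C by apply: (@arg_unique _ (f one)) => //; rewrite fg.
pose psi' t := psi t + c.
have A : is_arg (path_cat_fun f g) (path_cat_fun phi psi').
  split.
    apply: path_cat_fun_continuous => //; last by rewrite /psi' /c addrC subrK.
    by move=> t; exact: (cvgD (cg t) (cvg_cst _)).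
  by move=> t; rewrite /path_cat_fun; case: ifP => _ //; rewrite expiD c1 mulr1.
rewrite (turnE A) (@turnE f phi) // (@turnE g psi) //.
by rewrite path_cat_fun1 path_cat_fun0 /psi' /c; lra.
Qed.

Lemma turn_rev f : nonvanishing f -> turn (path_rev_fun f) = - turn f.
Proof.
move=> /is_arg_exists1[phi [cf f0]].
have A : is_arg (path_rev_fun f) (path_rev_fun phi).
  by split; [exact: (path_rev_fun_continuous cf)|move=> t; exact: f0].
rewrite (turnE A) (@turnE f phi) //.
by rewrite path_rev_fun1 path_rev_fun0; lra.
Qed.

Lemma turn_ends f : nonvanishing f -> 0 < (f one / f zero) / expi (turn f).
Proof.
move=> /is_arg_exists1[phi A]; rewrite (turnE A); case: A => _ f0.
exact: (argD (f0 one) (argV (f0 zero))).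
Qed.

(** As c f stays in the right half-plane, its argument is given throughout by the
arctangent, so the turn only depends on the end points. *)
Lemma turn_half_plane (c : C) (f : I -> C) :
  continuous f -> (forall t, 0 < complex.Re (c * f t)) ->
  turn f = arg1 (c * f one) - arg1 (c * f zero).
Proof.
move=> cf f0.
have nf t : c * f t != 0 by apply: contraTneq (f0 t) => ->; rewrite ltxx.
have c0 : c != 0 by have := nf one; rewrite mulf_eq0 => /norP[].
have nvf : nonvanishing f.
  by split=> // t; have := nf t; rewrite mulf_eq0 => /norP[].
have A : is_arg (fun t => c * f t) (fun t => arg1 (c * f t)).
  have cc : continuous (fun t : I => c * f t : C).
    by apply: cmul_continuous; [exact: cst_continuous|exact: cf].
  split; first by apply: arg1_continuous; [exact: cc|exact: f0].
  by move=> t; exact: arg1P.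
by rewrite -(turnZ c0 nvf) (turnE A).
Qed.

Lemma turn_expi a : turn (fun t => expi (a * val t)) = a.
Proof.
have A : is_arg (fun t : I => expi (a * val t)) (fun t => a * val t).
  split=> [t|t]; last exact: arg_expi.
  exact: (cvgM (cvg_cst a) (@val01_continuous R t)).
by rewrite (turnE A) val_one01 val_zero01; lra.
Qed.

Lemma slice1_continuous (T : topologicalType) (K : I * I -> T) s :
  continuous K -> continuous (fun t => K (s, t)).
Proof.
move=> cK; apply: pair_comp_continuous; [exact: cK|exact: cst_continuous|].
by move=> t; exact: cvg_id.
Qed.

Lemma slice2_continuous (T : topologicalType) (K : I * I -> T) t :
  continuous K -> continuous (fun s => K (s, t)).
Proof.
move=> cK; apply: pair_comp_continuous; [exact: cK| |exact: cst_continuous].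
by move=> s; exact: cvg_id.
Qed.

(** An argument of K on the whole square is constant along the two sides where K
is, and restricts to arguments along the two others. *)
Lemma turn_homotopy (K : I * I -> C) a b : nonvanishing K ->
  (forall s, K (s, zero) = a) -> (forall s, K (s, one) = b) ->
  turn (fun t => K (zero, t)) = turn (fun t => K (one, t)).
Proof.
move=> nK Ka Kb; have [phi [cphi phiP]] := is_arg_exists2 nK.
have edge t c : (forall s, K (s, t) = c) -> phi (one, t) = phi (zero, t).
  move=> Kc; have c0 : c != 0 by rewrite -(Kc zero); case: nK.
  have [u uP] := arg_exists c0.
  have A : is_arg (fun s => K (s, t)) (fun s => phi (s, t)).
    by split=> [|s]; [exact: (slice2_continuous cphi)|exact: phiP].
  have B : is_arg (fun s => K (s, t)) (fun _ => u).
    by split=> [|s]; [exact: cst_continuous|rewrite Kc].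
  by have := is_arg_unique A B one; lra.
have side s : turn (fun t => K (s, t)) = phi (s, one) - phi (s, zero).
  have A : is_arg (fun t => K (s, t)) (fun t => phi (s, t)).
    by split=> [|t]; [exact: (slice1_continuous cphi)|exact: phiP].
  by rewrite (turnE A).
by rewrite !side (edge _ _ Ka) (edge _ _ Kb).
Qed.

End Turning.

(** * Lifting homotopies through n-th roots *)

Section Roots.
Context {R : realType}.
Local Notation C := (R[i] : numClosedFieldType).
Local Notation I := (itv01 R).

(** The root of z whose argument is phi / n.  The argument is a parameter since the
root depends continuously on z only along a continuous choice of it. *)
Definition nroot (n : nat) (z : C) (phi : R) : C :=
  (expR (ln (modulus z) / n%:R))%:C * expi (phi / n%:R).

Lemma polarE (z : C) phi : 0 < z / expi phi -> z = (modulus z)%:C * expi phi.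
Proof.
move=> z0; rewrite modulusE.
have -> : `|z| = z / expi phi.
  by rewrite -(gtr0_norm z0) normrM normfV expi_norm invr1 mulr1.
by rewrite divfK ?expi_neq0.
Qed.

Lemma nrootK n z phi : (0 < n)%N -> 0 < z / expi phi -> nroot n z phi ^+ n = z.
Proof.
move=> n0 zphi; have n1 : n%:R != 0 :> R by rewrite pnatr_eq0 -lt0n.
have nK (x : R) : n%:R * (x / n%:R) = x by rewrite mulrC divfK.
rewrite /nroot exprMn -expiM -[(phi / n%:R) *+ n]mulr_natl nK -rmorphXn /= -expRM_natl nK.
by rewrite lnK ?posrE ?modulus_gt0 ?(arg_neq0 zphi) // -polarE.
Qed.

Lemma nroot_neq0 n z phi : nroot n z phi != 0.
Proof.
rewrite mulf_neq0 ?expi_neq0 // -[0]/(0%:C) (inj_eq (@complexI R)).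
by rewrite gt_eqF // expR_gt0.
Qed.

Lemma nrootD n z phi psi : nroot n z (phi + psi) = expi (psi / n%:R) * nroot n z phi.
Proof. by rewrite /nroot mulrDl expiD; ring. Qed.

Lemma nroot_continuous n (X : topologicalType) (f : X -> C) phi : nonvanishing f ->
  continuous phi -> continuous (fun x => nroot n (f x) (phi x)).
Proof.
move=> [cf f0] cphi; have clnm : continuous (fun x => ln (modulus (f x))).
  move=> x; have cm := modulus_continuous cf; apply: (continuous_comp (cm x)).
  by apply: continuous_ln; rewrite modulus_gt0 f0.
have cdiv (u : X -> R) : continuous u -> continuous (fun x => u x / n%:R).
  by move=> cu x; apply: cvgM; [exact: cu|exact: cvg_cst].
apply: cmul_continuous; last by apply: expi_continuous; exact: cdiv.
apply: creal_continuous => x; have cl := cdiv _ clnm.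
by apply: (continuous_comp (cl x)); exact: continuous_expR.
Qed.

Lemma scale_continuous (X : topologicalType) (a : R) (u : X -> R) :
  continuous u -> continuous (fun x => a * u x).
Proof. by move=> cu x; apply: cvgM; [exact: cvg_cst|exact: cu]. Qed.

(** The quotient of f and g has modulus 1 and its argument, multiplied by n, is
always a full number of turns, so it cannot move. *)
Lemma root_unique n (f g : I -> C) : (0 < n)%N -> nonvanishing f -> nonvanishing g ->
  (forall t, f t ^+ n = g t ^+ n) -> f zero = g zero -> forall t, f t = g t.
Proof.
move=> n0 nf ng fg fg0.
have n1 : n%:R != 0 :> R by rewrite pnatr_eq0 -lt0n.
have [f0 g0] := (nf.2, ng.2).
have [phi [cphi phiP]] := is_arg_exists1 (nonvanishingM nf (nonvanishingV ng)).
have q1 t : (f t / g t) ^+ n = 1 by rewrite expr_div_n fg divff // expf_neq0.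
have e1 t : expi (n%:R * phi t) = 1 :> C.
  have : 0 < (f t / g t / expi (phi t)) ^+ n by apply: exprn_gt0; exact: phiP.
  rewrite expr_div_n q1 div1r invr_gt0 -expiM -[_ *+ n]mulr_natl => ep.
  by rewrite -(gtr0_norm ep) expi_norm.
have cphin : continuous (fun t => n%:R * phi t).
  exact: scale_continuous.
have E t : phi t = phi zero.
  by have := angle_constant cphin e1 t => /(mulfI n1).
have mod1 t : f t / g t = expi (phi t).
  rewrite [LHS](polarE (phiP t)) modulusE.
  suff -> : `|f t / g t| = 1 by rewrite mul1r.
  by apply/eqP; rewrite -(@pexpr_eq1 _ _ n) ?normr_ge0 // -normrX q1 normr1.
move=> t; apply: (divIf (g0 t)); rewrite mod1 E -mod1 fg0 !divff //.
Qed.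

(** A continuous argument of K on the square yields a continuous root of K, and a
constant factor adjusts it at one corner.  By uniqueness of the roots along paths
it then agrees with the given roots, and is constant, on the sides of the square. *)
Lemma root_homotopy n (K : I * I -> C) a b (g0 g1 : I -> C) : (0 < n)%N ->
  nonvanishing K -> (forall s, K (s, zero) = a) -> (forall s, K (s, one) = b) ->
  nonvanishing g0 -> nonvanishing g1 -> (forall t, g0 t ^+ n = K (zero, t)) ->
  (forall t, g1 t ^+ n = K (one, t)) -> g0 zero = g1 zero ->
  exists G : I * I -> C, [/\ nonvanishing G, forall st, G st ^+ n = K st,
    forall t, G (zero, t) = g0 t, forall t, G (one, t) = g1 t &
    (forall s, G (s, zero) = g0 zero) /\ (forall s, G (s, one) = g0 one)].
Proof.
move=> n0 nK Ka Kb ng0 ng1 g0K g1K g01.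
have [phi [cphi phiP]] := is_arg_exists2 nK.
pose G' st := nroot n (K st) (phi st).
have nG' : nonvanishing G'.
  by split=> [|st]; [exact: nroot_continuous|exact: nroot_neq0].
have G'K st : G' st ^+ n = K st by exact: nrootK.
pose c := g0 zero / G' (zero, zero).
have c0 : c != 0 by rewrite mulf_neq0 ?invr_neq0 //; [exact: ng0.2|exact: nG'.2].
have nG : nonvanishing (fun st => c * G' st).
  by apply: nonvanishingM => //; exact: nonvanishing_cst.
have GK st : (c * G' st) ^+ n = K st.
  by rewrite exprMn G'K expr_div_n g0K G'K divff ?mul1r //; exact: nK.2.
have cG := nG.1.
have nS s : nonvanishing (fun t => c * G' (s, t)).
  by split=> [|t]; [exact: (slice1_continuous cG)|exact: nG.2].
have nS2 t : nonvanishing (fun s => c * G' (s, t)).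
  by split=> [|s]; [exact: (slice2_continuous cG)|exact: nG.2].
have G00 : c * G' (zero, zero) = g0 zero by rewrite divfK //; exact: nG'.2.
have side0 t : c * G' (zero, t) = g0 t.
  by apply: (root_unique n0 (nS zero) ng0) => // u; rewrite GK g0K.
have nc t : nonvanishing (fun _ : I => c * G' (zero, t)).
  by apply: nonvanishing_cst; exact: nG.2.
have bottom s : c * G' (s, zero) = g0 zero.
  rewrite -G00; apply: (root_unique n0 (nS2 zero) (nc zero)) => // u.
  by rewrite !GK !Ka.
exists (fun st => c * G' st); split=> //; last split=> //.
  move=> t; apply: (root_unique n0 (nS one) ng1) => [u|]; first by rewrite GK g1K.
  by rewrite bottom g01.
move=> s; rewrite -side0.
apply: (root_unique n0 (nS2 one) (nc one)) => // u.
by rewrite !GK !Kb.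
Qed.

End Roots.

(** * Commuting loops in the plane minus two points *)

Section CommutingLoops.
Context {R : realType}.
Local Notation C := (R[i] : numClosedFieldType).
Local Notation I := (itv01 R).

(** Let y_g and y_h be cube roots of g and h with the same starting point, and w a
primitive cube root of unity.  As g and h turn once around 0, both roots end at w
times their start.  So, starting from [w ^+ m] times the common start, the
homotopy from g h to h g lifts to one from [(w ^+ m * y_g) (w ^+ m.+1 * y_h)] to
[(w ^+ m * y_h) (w ^+ m.+1 * y_g)].  Writing [D y m] for the turn of
[1 - w ^+ m * y], this gives
[D y_g m + D y_h m.+1 = D y_h m + D y_g m.+1], that is, the difference
[D y_g m - D y_h m] does not depend on m.  Its sum over m = 0, 1, 2 is the left-hand
side, because [1 - y ^+ 3] is the product of the [1 - w ^+ m * y]; and each difference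
is a whole number of full turns, because the two paths have the same ends. *)
Lemma commuting_turns (K : I * I -> C) (p : C) (g h : I -> C) :
  nonvanishing K -> (forall st, 1 - K st != 0) ->
  nonvanishing g -> nonvanishing h -> (forall t, 1 - g t != 0) -> (forall t, 1 - h t != 0) ->
  g zero = p -> g one = p -> h zero = p -> h one = p ->
  (forall t, K (zero, t) = path_cat_fun g h t) ->
  (forall t, K (one, t) = path_cat_fun h g t) ->
  (forall s, K (s, zero) = p) -> (forall s, K (s, one) = p) ->
  turn g = 2 * pi -> turn h = 2 * pi ->
  exists k : int,
    turn (fun t => 1 - g t) - turn (fun t => 1 - h t) = 3 * (2 * pi * k%:~R).
Proof.
move=> nK K1 ng nh g_neq1 h_neq1 g0 g1 h0 h1 Kgh Khg Kp0 Kp1 tg th.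
have [phi gphi] := is_arg_exists1 ng; have [psi' [cpsi' psi'P]] := is_arg_exists1 nh.
pose psi t := psi' t + (phi zero - psi' zero).
have hpsi : is_arg h psi.
  have e1 : expi (phi zero - psi' zero) = 1 :> C.
    have A := gphi.2 zero; have B := psi'P zero; rewrite g0 in A; rewrite h0 in B.
    exact: arg_unique A B.
  split=> [t|t]; last by rewrite /psi expiD e1 mulr1.
  exact: (cvgD (cpsi' t) (cvg_cst _)).
have [w [wE w3 w1]] : exists w : C, [/\ w = expi (2 * pi / 3%:R), w ^+ 3 = 1
    & w != 1].
  eexists; split; first by reflexivity.
    by rewrite -expiM -[_ *+ 3]mulr_natl mulrC divfK ?expi_2pi // pnatr_eq0.
  apply/eqP => /expi_eq1_small; have := @pi_gt0 R => p0.
  rewrite ger0_norm; last by lra.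
  by have h3 : 2 * pi / 3%:R < 2 * pi :> R; [lra|move=> /(_ h3)]; lra.
have w_sum : 1 + w + w ^+ 2 = 0.
  have : (w - 1) * (1 + w + w ^+ 2) = 0.
    have -> : (w - 1) * (1 + w + w ^+ 2) = w ^+ 3 - 1 by ring.
    by rewrite w3 subrr.
  by move/eqP; rewrite mulf_eq0 subr_eq0 (negPf w1) => /eqP.
pose yg t := nroot 3 (g t) (phi t); pose yh t := nroot 3 (h t) (psi t).
have cyg : continuous yg by apply: nroot_continuous; [exact: ng|exact: gphi.1].
have cyh : continuous yh by apply: nroot_continuous; [exact: nh|exact: hpsi.1].
have yg3 t : yg t ^+ 3 = g t by apply: nrootK => //; exact: gphi.2.
have yh3 t : yh t ^+ 3 = h t by apply: nrootK => //; exact: hpsi.2.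
have y0 : yg zero = yh zero.
  by rewrite /yg /yh g0 h0 /psi addrC subrK.
have yg1 : yg one = w * yg zero.
  rewrite /yg g1 g0 wE -nrootD; congr nroot.
  by have := turnE gphi; rewrite tg; lra.
have yh1 : yh one = w * yg zero.
  rewrite y0 /yh h1 h0 wE -nrootD; congr nroot.
  by have := turnE hpsi; rewrite th; lra.
have nZ m (y : I -> C) : continuous y -> (forall t, y t != 0) ->
    nonvanishing (fun t => w ^+ m * y t).
  move=> cy y_neq0; split.
    by apply: cmul_continuous; [exact: cst_continuous|exact: cy].
  move=> t; apply: mulf_neq0; last exact: y_neq0.
  by apply: expf_neq0; rewrite wE; exact: expi_neq0.
pose D (y : I -> C) m := turn (fun t => 1 - w ^+ m * y t).
have cube m (y : C) : (w ^+ m * y) ^+ 3 = y ^+ 3.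
  by rewrite exprMn -exprM mulnC exprM w3 expr1n mul1r.
have nD m (y f : I -> C) : continuous y -> (forall t, y t ^+ 3 = f t) ->
    (forall t, 1 - f t != 0) -> nonvanishing (fun t => 1 - w ^+ m * y t).
  move=> cy y3 f1; split.
    apply: csub_continuous; first exact: cst_continuous.
    by apply: cmul_continuous; [exact: cst_continuous|exact: cy].
  move=> t; apply: contraNneq (f1 t) => /eqP; rewrite subr_eq0 => /eqP e.
  by rewrite -y3 -(cube m) -e expr1n subrr.
have nDg m : nonvanishing (fun t => 1 - w ^+ m * yg t) by exact: nD cyg yg3 g_neq1.
have nDh m : nonvanishing (fun t => 1 - w ^+ m * yh t) by exact: nD cyh yh3 h_neq1.
have ygn t : yg t != 0 by exact: nroot_neq0.
have yhn t : yh t != 0 by exact: nroot_neq0.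
(* The lift of the homotopy that starts at w ^+ m * yg zero. *)
have key m : D yg m + D yh m.+1 = D yh m + D yg m.+1.
  have E1 : w ^+ m * yg one = w ^+ m.+1 * yh zero.
    by rewrite yg1 -y0 exprSr mulrA.
  have E2 : w ^+ m * yh one = w ^+ m.+1 * yg zero.
    by rewrite yh1 exprSr mulrA.
  have [|||||G [nG G3 G0 G1 [Ga Gb]]] := @root_homotopy R 3 K p p
      (path_cat_fun (fun t => w ^+ m * yg t) (fun t => w ^+ m.+1 * yh t))
      (path_cat_fun (fun t => w ^+ m * yh t) (fun t => w ^+ m.+1 * yg t)) isT nK Kp0 Kp1.
  - exact: (nonvanishing_cat (nZ m _ cyg ygn) (nZ m.+1 _ cyh yhn) E1).
  - exact: (nonvanishing_cat (nZ m _ cyh yhn) (nZ m.+1 _ cyg ygn) E2).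
  - move=> t; rewrite Kgh /path_cat_fun.
    by case: ifP => _; rewrite cube; [exact: yg3|exact: yh3].
  - move=> t; rewrite Khg /path_cat_fun.
    by case: ifP => _; rewrite cube; [exact: yh3|exact: yg3].
  - by rewrite !path_cat_fun0 y0.
  have nG1 : nonvanishing (fun st => 1 - G st).
    split; first by apply: csub_continuous; [exact: cst_continuous|exact: nG.1].
    move=> st; apply: contraNneq (K1 st) => /eqP; rewrite subr_eq0 => /eqP e.
    by rewrite -G3 -e expr1n subrr.
  have := turn_homotopy nG1 (fun s => congr1 (fun z => 1 - z) (Ga s))
    (fun s => congr1 (fun z => 1 - z) (Gb s)).
  have -> : (fun t => 1 - G (zero, t)) =
      path_cat_fun (fun t => 1 - w ^+ m * yg t) (fun t => 1 - w ^+ m.+1 * yh t).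
    by apply/funext => t; rewrite G0 /path_cat_fun; case: ifP => _; reflexivity.
  have -> : (fun t => 1 - G (one, t)) =
      path_cat_fun (fun t => 1 - w ^+ m * yh t) (fun t => 1 - w ^+ m.+1 * yg t).
    by apply/funext => t; rewrite G1 /path_cat_fun; case: ifP => _; reflexivity.
  rewrite (turn_cat (nDg m) (nDh m.+1)); last by rewrite E1.
  by rewrite (turn_cat (nDh m) (nDg m.+1)) // E2.
have sumD (y f : I -> C) : continuous y -> (forall t, y t ^+ 3 = f t) ->
    (forall t, 1 - f t != 0) -> turn (fun t => 1 - f t) = D y 0 + D y 1 + D y 2.
  move=> cy y3 f1; have n m := nD m _ _ cy y3 f1.
  rewrite /D -(turnM (n 0%N) (n 1%N)) -(turnM (nonvanishingM (n 0%N) (n 1%N)) (n 2%N)).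
  congr turn; apply/funext => t; rewrite -y3.
  have -> : (1 - w ^+ 0 * y t) * (1 - w ^+ 1 * y t) * (1 - w ^+ 2 * y t) =
     1 - w ^+ 3 * y t ^+ 3 - (1 + w + w ^+ 2) * (y t - w * y t ^+ 2) by ring.
  by rewrite w3 w_sum mul0r subr0 mul1r.
have [k kE] : exists k : int, D yg 0 - D yh 0 = 2 * pi * k%:~R.
  apply: expi_eq1; have A := turn_ends (nDh 0%N).
  have := turn_ends (nDg 0%N); rewrite yg1 -yh1 y0 => B.
  exact: (arg_unique B A).
exists k; rewrite (sumD _ _ cyg yg3 g_neq1) (sumD _ _ cyh yh3 h_neq1) -kE.
have := key 0; have := key 1; lra.
Qed.
End CommutingLoops.

(** * The cover by square roots of z3, z3 - z1 and z3 - z2 *)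

Section SquareRootCover.
Context {R : realType}.
Local Notation C := (R[i] : numClosedFieldType).
Local Notation I := (itv01 R).
Local Notation Y := (C * C * C)%type.
Implicit Types y : Y.

Lemma pair_continuous (X U V : topologicalType) (f : X -> U) (g : X -> V) :
  continuous f -> continuous g -> continuous (fun x => (f x, g x)).
Proof. by move=> cf cg x; have := cvg_pair (cf x) (cg x); apply. Qed.

Lemma triple_continuous (X U V W : topologicalType) (f : X -> U) (g : X -> V)
    (h : X -> W) : continuous f -> continuous g -> continuous h ->
  continuous (fun x => (f x, g x, h x)).
Proof.
move=> cf cg ch; have cfg := pair_continuous cf cg.
exact: (pair_continuous cfg ch).
Qed.

(** For signs e, these are the deck transformations of [config]. *)
Definition flip (e : C * C * C) y : Y :=
  (e.1.1 * y.1.1, e.1.2 * y.1.2, e.2 * y.2).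

(** The configuration (z1, z2, z3) for which y consists of square roots of z3,
z3 - z1 and z3 - z2. *)
Definition config y : C * C * C :=
  (y.1.1 ^+ 2 - y.1.2 ^+ 2, y.1.1 ^+ 2 - y.2 ^+ 2, y.1.1 ^+ 2).

(** The points 0, z1, z2, z3 of a configuration. *)
Definition distinct4 (z : C * C * C) : Prop :=
  [/\ z.1.1 != 0, z.1.2 != 0, z.2 != 0 &
   [/\ z.1.1 - z.1.2 != 0, z.2 - z.1.1 != 0 & z.2 - z.1.2 != 0]].

(** These six functions factor the differences that the square roots do not
account for: on [config], z1 = sum12 * diff12, z2 - z1 = sum23 * diff23 and
z2 = sum13 * diff13. *)
Definition sum12 (y : Y) : C := y.1.1 + y.1.2.
Definition sum23 (y : Y) : C := y.1.2 + y.2.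
Definition sum13 (y : Y) : C := y.1.1 + y.2.
Definition diff12 (y : Y) : C := y.1.1 - y.1.2.
Definition diff23 (y : Y) : C := y.1.2 - y.2.
Definition diff13 (y : Y) : C := y.1.1 - y.2.

Lemma sums_neq0 y : distinct4 (config y) ->
  [/\ sum12 y != 0, sum23 y != 0, sum13 y != 0 &
   [/\ diff12 y != 0, diff23 y != 0 & diff13 y != 0]].
Proof.
rewrite /distinct4 /config /sum12 /sum23 /sum13 /diff12 /diff23 /diff13 /=.
move=> -[z1 z2 _ [z12 _ _]].
have E : y.1.1 ^+ 2 - y.1.2 ^+ 2 - (y.1.1 ^+ 2 - y.2 ^+ 2) =
  - (y.1.2 ^+ 2 - y.2 ^+ 2) by ring.
rewrite E oppr_eq0 in z12; move: z1 z2 z12; rewrite !subr_sqr !mulf_eq0.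
by move=> /norP[? ?] /norP[? ?] /norP[? ?]; split.
Qed.

Lemma triple_coords_continuous (X : topologicalType) (L : X -> Y) : continuous L ->
  [/\ continuous (fun x => (L x).1.1), continuous (fun x => (L x).1.2) &
      continuous (fun x => (L x).2)].
Proof.
move=> cL; have c1 : continuous (fun x => (L x).1).
  by apply: comp_continuous; [exact: fst_continuous|exact: cL].
split.
- by apply: (comp_continuous (f := fst)); [exact: fst_continuous|exact: c1].
- by apply: (comp_continuous (f := snd)); [exact: snd_continuous|exact: c1].
- by apply: comp_continuous; [exact: snd_continuous|exact: cL].
Qed.

Definition cover_path (L : I -> Y) :=
  continuous L /\ forall t, distinct4 (config (L t)).

Lemma nonvanishing_sums (X : topologicalType) (L : X -> Y) : continuous L ->
  (forall t, distinct4 (config (L t))) ->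
  [/\ nonvanishing (sum12 \o L), nonvanishing (sum23 \o L), nonvanishing (sum13 \o L) &
   [/\ nonvanishing (diff12 \o L), nonvanishing (diff23 \o L) & nonvanishing (diff13 \o L)]].
Proof.
move=> cL dL; have [c1 c2 c3] := triple_coords_continuous cL.
have uL t := sums_neq0 (dL t).
split; last split.
- by split=> [|t]; [exact: cadd_continuous c1 c2|have [] := uL t].
- by split=> [|t]; [exact: cadd_continuous c2 c3|have [] := uL t].
- by split=> [|t]; [exact: cadd_continuous c1 c3|have [] := uL t].
- by split=> [|t]; [exact: csub_continuous c1 c2|have [_ _ _ []] := uL t].
- by split=> [|t]; [exact: csub_continuous c2 c3|have [_ _ _ []] := uL t].
- by split=> [|t]; [exact: csub_continuous c1 c3|have [_ _ _ []] := uL t].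
Qed.

Lemma cover_path_cat L L' : cover_path L -> cover_path L' -> L one = L' zero ->
  cover_path (path_cat_fun L L').
Proof.
move=> [cL dL] [cL' dL'] LL'; split; first exact: (path_cat_fun_continuous cL cL' LL').
by move=> t; rewrite /path_cat_fun; case: ifP => _; [exact: dL|exact: dL'].
Qed.

Lemma cover_path_rev L : cover_path L -> cover_path (path_rev_fun L).
Proof.
by move=> [cL dL]; split; [exact: (path_rev_fun_continuous cL)|move=> t; exact: dL].
Qed.

Definition signs (e : C * C * C) :=
  [/\ e.1.1 ^+ 2 = 1, e.1.2 ^+ 2 = 1 & e.2 ^+ 2 = 1].

Lemma config_flip e y : signs e -> config (flip e y) = config y.
Proof. by case=> e1 e2 e3; rewrite /config /flip /= !exprMn e1 e2 e3 !mul1r. Qed.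

Lemma cover_path_flip e L : signs e -> cover_path L -> cover_path (flip e \o L).
Proof.
move=> se [cL dL]; split; last by move=> t; rewrite /= config_flip.
have [c1 c2 c3] := triple_coords_continuous cL.
have cz (k : C) (u : I -> C) : continuous u -> continuous (fun t => k * u t : C).
  by move=> cu; apply: cmul_continuous; [exact: cst_continuous|exact: cu].
by apply: triple_continuous; [exact: (cz e.1.1 _ c1)|exact: (cz e.1.2 _ c2)|
  exact: (cz e.2 _ c3)].
Qed.

(** The function rho = sum12 / sum23 on the cover avoids 0 and 1, because
1 - rho = - diff13 / sum23.  Taking square roots of z3, z3 - z1 and z3 - z2 along K
lifts K to the cover, and rho maps the lift to a homotopy to which
[commuting_turns] applies. *)
Lemma commuting_lifts (K : I * I -> C * C * C) (y0 : Y) (Lu Lv : I -> Y) :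
  continuous K -> (forall st, distinct4 (K st)) ->
  cover_path Lu -> cover_path Lv ->
  Lu zero = y0 -> Lu one = y0 -> Lv zero = y0 -> Lv one = y0 ->
  (forall t, K (zero, t) = config (path_cat_fun Lu Lv t)) ->
  (forall t, K (one, t) = config (path_cat_fun Lv Lu t)) ->
  (forall s, K (s, zero) = config y0) -> (forall s, K (s, one) = config y0) ->
  turn (sum12 \o Lu) - turn (sum23 \o Lu) = 2 * pi ->
  turn (sum12 \o Lv) - turn (sum23 \o Lv) = 2 * pi ->
  exists k : int,
    (turn (diff13 \o Lu) - turn (sum23 \o Lu)) - (turn (diff13 \o Lv) - turn (sum23 \o Lv))
    = 3 * (2 * pi * k%:~R).
Proof.
move=> cK dK gu gv u0 u1 v0 v1 Kuv Kvu K0 K1 tu tv.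
have [k1 k2 k3] := triple_coords_continuous cK.
have guv : cover_path (path_cat_fun Lu Lv) by apply: cover_path_cat; rewrite ?u1 ?v0.
have gvu : cover_path (path_cat_fun Lv Lu) by apply: cover_path_cat; rewrite ?v1 ?u0.
have c_uv := triple_coords_continuous guv.1; have c_vu := triple_coords_continuous gvu.1.
have lift (k : C * C * C -> C) (p : Y -> C) :
    nonvanishing (fun st => k (K st)) -> (forall y, p y ^+ 2 = k (config y)) ->
    continuous (fun t => p (path_cat_fun Lu Lv t)) ->
    continuous (fun t => p (path_cat_fun Lv Lu t)) ->
    exists G : I * I -> C, [/\ nonvanishing G, forall st, G st ^+ 2 = k (K st),
      forall t, G (zero, t) = p (path_cat_fun Lu Lv t),
      forall t, G (one, t) = p (path_cat_fun Lv Lu t) &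
      (forall s, G (s, zero) = p y0) /\ (forall s, G (s, one) = p y0)].
  move=> nk pk cp cp'.
  have nz (L : I -> Y) s : (forall t, K (s, t) = config (L t)) -> forall t, p (L t) != 0.
    move=> KL t; rewrite -sqrf_eq0 pk -KL; exact: nk.2.
  have [|||||G [nG G2 G0 G1 [Ga Gb]]] := @root_homotopy R 2 _ (k (config y0))
      (k (config y0)) (fun t => p (path_cat_fun Lu Lv t))
      (fun t => p (path_cat_fun Lv Lu t)) isT nk
      (fun s => congr1 k (K0 s)) (fun s => congr1 k (K1 s)).
  - by split; [exact: cp|exact: (nz _ zero)].
  - by split; [exact: cp'|exact: (nz _ one)].
  - by move=> t; rewrite pk Kuv.
  - by move=> t; rewrite pk Kvu.
  - by rewrite !path_cat_fun0 u0 v0.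
  exists G; split=> //; split=> s; first by rewrite Ga path_cat_fun0 u0.
  by rewrite Gb path_cat_fun1 v1.
have [|||| Ga [na Ga2 Ga0 Ga1 [Gas Gat]]] := lift (fun z => z.2) (fun y => y.1.1).
- by split; [exact: k3|move=> st; have [] := dK st].
- by [].
- by have [c _ _] := c_uv; exact: c.
- by have [c _ _] := c_vu; exact: c.
have [|||| Gb [nb Gb2 Gb0 Gb1 [Gbs Gbt]]] := lift (fun z => z.2 - z.1.1) (fun y => y.1.2).
- by split; [exact: csub_continuous k3 k1|move=> st; have [_ _ _ []] := dK st].
- by move=> y /=; rewrite subKr.
- by have [_ c _] := c_uv; exact: c.
- by have [_ c _] := c_vu; exact: c.
have [|||| Gc [nc Gc2 Gc0 Gc1 [Gcs Gct]]] := lift (fun z => z.2 - z.1.2) (fun y => y.2).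
- by split; [exact: csub_continuous k3 k2|move=> st; have [_ _ _ []] := dK st].
- by move=> y /=; rewrite subKr.
- by have [_ _ c] := c_uv; exact: c.
- by have [_ _ c] := c_vu; exact: c.
pose L st : Y := (Ga st, Gb st, Gc st).
have dL st : distinct4 (config (L st)).
  by rewrite /config /= Ga2 Gb2 Gc2 !subKr; case: (K st) (dK st) => -[].
have cL : continuous L.
  by apply: triple_continuous; [exact: na.1|exact: nb.1|exact: nc.1].
have L0 t : L (zero, t) = path_cat_fun Lu Lv t.
  by rewrite /L Ga0 Gb0 Gc0; case: (path_cat_fun _ _ _) => -[].
have L1 t : L (one, t) = path_cat_fun Lv Lu t.
  by rewrite /L Ga1 Gb1 Gc1; case: (path_cat_fun _ _ _) => -[].
have Ls s : L (s, zero) = y0 by rewrite /L Gas Gbs Gcs; case: (y0) => -[].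
have Lt s : L (s, one) = y0 by rewrite /L Gat Gbt Gct; case: (y0) => -[].
pose rho (y : Y) : C := sum12 y * (sum23 y)^-1.
have rho1 y : distinct4 (config y) -> 1 - rho y = - (diff13 y) * (sum23 y)^-1.
  move=> /sums_neq0[_ sum23_neq0 _ _]; rewrite /rho -{1}(divff sum23_neq0) -mulrBl.
  by congr (_ * _); rewrite /sum12 /sum23 /diff13; ring.
have rho_nonvanishing (X : topologicalType) (M : X -> Y) : continuous M ->
    (forall x, distinct4 (config (M x))) -> nonvanishing (rho \o M).
  move=> cM dM; have [n12 n23 _ _] := nonvanishing_sums cM dM.
  exact: nonvanishingM n12 (nonvanishingV n23).
have rho_neq1 y : distinct4 (config y) -> 1 - rho y != 0.
  move=> dy; rewrite rho1 //; have [_ sum23_neq0 _ [_ _ g0]] := sums_neq0 dy.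
  by rewrite mulf_neq0 ?invr_neq0 ?oppr_eq0.
have turn_rho M : cover_path M -> turn (rho \o M) = turn (sum12 \o M) - turn (sum23 \o M).
  move=> [cM dM]; have [n12 n23 _ _] := nonvanishing_sums cM dM.
  by rewrite -(turnV n23) -(turnM n12 (nonvanishingV n23)).
have turn_rho1 M : cover_path M ->
    turn (fun t => 1 - rho (M t)) = turn (diff13 \o M) - turn (sum23 \o M).
  move=> [cM dM]; have [_ n23 _ [_ _ n13]] := nonvanishing_sums cM dM.
  have -> : (fun t => 1 - rho (M t)) = (fun t => - (diff13 (M t) * (sum23 (M t))^-1)).
    by apply/funext => t; rewrite rho1 // mulNr.
  have nV := nonvanishingV n23.
  by rewrite (turnN (nonvanishingM n13 nV)) (turnM n13 nV) (turnV n23).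
have [||||||||||k kE] := @commuting_turns R (rho \o L) (rho y0) (rho \o Lu) (rho \o Lv)
  (rho_nonvanishing _ _ cL dL) (fun st => rho_neq1 _ (dL st))
  (rho_nonvanishing _ _ gu.1 gu.2)
  (rho_nonvanishing _ _ gv.1 gv.2)
  (fun t => rho_neq1 _ (gu.2 t)) (fun t => rho_neq1 _ (gv.2 t)).
- by rewrite /= u0.
- by rewrite /= u1.
- by rewrite /= v0.
- by rewrite /= v1.
- by move=> t; rewrite /= L0 path_cat_fun_app.
- by move=> t; rewrite /= L1 path_cat_fun_app.
- by move=> s; rewrite /= Ls.
- by move=> s; rewrite /= Lt.
- by rewrite turn_rho.
- by rewrite turn_rho.
exists k; rewrite -kE (turn_rho1 _ gu) (turn_rho1 _ gv) //.
Qed.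
End SquareRootCover.

(** * The principal square root and the circle *)

Section Letters.
Context {R : realType}.
Local Notation C := (R[i] : numClosedFieldType).
Local Notation I := (itv01 R).
Local Notation Y := (C * C * C)%type.

(** The principal square root, on the right half-plane. *)
Definition rsqrt (z : C) : C := nroot 2 z (arg1 z).

Lemma rsqrtK z : 0 < complex.Re z -> rsqrt z ^+ 2 = z.
Proof. by move=> z0; apply: nrootK => //; exact: arg1P. Qed.

Lemma rsqrt_neq0 z : rsqrt z != 0.
Proof. exact: nroot_neq0. Qed.

Lemma Re_rsqrt z : 0 < complex.Re (rsqrt z).
Proof.
have := arg1_bound z; rewrite ltr_norml => /andP[a1 a2].
have c0 : 0 < cos (arg1 z / 2%:R).
  by have := @pi_gt0 R => p0; apply: cos_gt0_pihalf; apply/andP; split; lra.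
by rewrite /rsqrt /nroot /expi /= mul0r subr0 mulr_gt0 // expR_gt0.
Qed.

Lemma rsqrt_real (x : R) : 0 < x -> exists2 r : R, 0 < r & rsqrt x%:C = r%:C.
Proof.
move=> x0; exists (expR (ln (modulus x%:C) / 2%:R)); first exact: expR_gt0.
by rewrite /rsqrt /nroot /arg1 /= mul0r atan0 mul0r expi0 mulr1.
Qed.

Lemma rsqrt1 : rsqrt 1 = 1.
Proof.
rewrite /rsqrt /nroot /arg1 /= mul0r atan0 mul0r expi0 mulr1 /modulus.
by rewrite normr1 /= ln1 mul0r expR0.
Qed.

Lemma rsqrt_continuous (X : topologicalType) (f : X -> C) : continuous f ->
  (forall x, 0 < complex.Re (f x)) -> continuous (fun x => rsqrt (f x)).
Proof.
move=> cf f0; have nf : nonvanishing f.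
  by split=> [|x]; [exact: cf|apply: contraTneq (f0 x) => ->; rewrite ltxx].
rewrite /rsqrt; apply: nroot_continuous; first exact: nf.
by apply: arg1_continuous; [exact: cf|exact: f0].
Qed.

Lemma Re_near1_ge (z : C) (k : R) : `|z - 1| <= k%:C -> 1 - k <= complex.Re z.
Proof.
move=> zk; have := le_trans (normc_ge_Re (z - 1)) zk; rewrite lecR.
rewrite raddfB /= ler_norml => /andP[]; lra.
Qed.

(** The assumption on the squares makes the modulus of b smaller than the real part
of a. *)
Lemma Re_add_gt0 (a b : C) : 0 < complex.Re a ->
  `|b ^+ 2| < (complex.Re (a ^+ 2))%:C -> 0 < complex.Re (a + b).
Proof.
move=> a0; rewrite normrX -add_Re2_Im2 ltcR.
case: a a0 => a a' /= a0; case: b => b b' /=; rewrite !expr2 => ab.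
by nra.
Qed.

Definition circ (t : I) : C := expi (2 * pi * val t).
Definition halfcirc (t : I) : C := expi (pi * val t).

Lemma circ0 : circ zero = 1.
Proof. by rewrite /circ val_zero01 mulr0 expi0. Qed.
Lemma circ1 : circ one = 1.
Proof. by rewrite /circ val_one01 mulr1 expi_2pi. Qed.
Lemma halfcirc0 : halfcirc zero = 1.
Proof. by rewrite /halfcirc val_zero01 mulr0 expi0. Qed.
Lemma halfcirc1 : halfcirc one = -1.
Proof. by rewrite /halfcirc val_one01 mulr1 expi_pi. Qed.
Lemma halfcirc2 t : halfcirc t ^+ 2 = circ t.
Proof. by rewrite /halfcirc /circ -expiM -[_ *+ 2]mulr_natl mulrA. Qed.
Lemma circ_norm t : `|circ t| = 1.
Proof. exact: expi_norm. Qed.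
Lemma circ_neq0 t : circ t != 0.
Proof. exact: expi_neq0. Qed.
Lemma circ_continuous : continuous circ.
Proof. by apply: expi_continuous; apply: scale_continuous; exact: val01_continuous. Qed.
Lemma halfcirc_continuous : continuous halfcirc.
Proof. by apply: expi_continuous; apply: scale_continuous; exact: val01_continuous. Qed.
Lemma circV t : complex.Re (circ t)^-1 = complex.Re (circ t).
Proof. by rewrite /circ -expiN /expi cosN. Qed.
Lemma Re_circ t : -1 <= complex.Re (circ t) <= 1.
Proof. by rewrite /circ /= cos_geN1 cos_le1. Qed.
Lemma Im_halfcirc t : 0 <= complex.Im (halfcirc t).
Proof.
have /andP[t0 t1] := itv01_bounds t; have p0 := @pi_gt0 R.
apply: sin_ge0_pi; apply/andP; split; last by rewrite ler_piMr // ltW.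
by rewrite mulr_ge0 // ltW.
Qed.

Lemma atan_inv (x : R) : 0 < x -> atan x + atan x^-1 = pi / 2.
Proof.
move=> x0; have := atan_gtNpi2 x; have := atan_ltpi2 x => a1 a2.
have ax : 0 < atan x by rewrite -atan0 lt_atan.
have s0 : 0 < sin (atan x).
  by apply: sin_gt0_pi; apply/andP; split=> //; have := @pi_gt0 R; lra.
have c0 : 0 < cos (atan x) by apply: cos_gt0_pihalf; rewrite a1 a2.
suff -> : atan x^-1 = pi / 2 - atan x by lra.
rewrite -[RHS]tanK; last by rewrite in_itv /=; apply/andP; split; lra.
congr atan; rewrite -{1}(atanK x) /tan invf_div; congr (_ / _).
  by rewrite sinB cos_pihalf sin_pihalf; lra.
by rewrite cosB cos_pihalf sin_pihalf; lra.
Qed.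

End Letters.

(** * Lifting the motions of z3 around 0, around z1, around z1 and z2 *)

Section LetterLifts.
Context {R : realType} (e : R) (e_gt0 : 0 < e) (e_small : 5 * e < 1).
Local Notation C := (R[i] : numClosedFieldType).
Local Notation I := (itv01 R).
Local Notation Y := (C * C * C)%type.
Local Notation ec := (e%:C : C).
Local Notation ii := ('i%C : C).

(** While z1 and z2 rest at 1 - e and 1 + e, the point z3 leaves from 1 - 2 e and
goes once around 0 (orbit a), around z1 (orbit b), or around both z1 and z2
(orbit s). *)
Definition pt1 : C := 1 - ec.
Definition pt2 : C := 1 + ec.
Definition orbit_a (t : I) : C := (1 - 2 * e)%:C * circ t.
Definition orbit_b (t : I) : C := 1 - ec - ec * circ t.
Definition orbit_s (t : I) : C := 1 - 2 * ec * circ t.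

Definition base_lift : Y :=
  (rsqrt (1 - 2 * e)%:C, ii * rsqrt ec, ii * rsqrt (3 * e)%:C).
(** Along each orbit, the coordinates z3, z3 - z1, z3 - z2 that turn around 0 are a
constant times the circle times a factor in the right half-plane; the root of the
circle is the half circle, and the other roots are principal.  The numbers
z3 - z1 and z3 - z2 start on the negative axis, whence the imaginary unit. *)
Definition lift_a (t : I) : Y :=
  (rsqrt (1 - 2 * e)%:C * halfcirc t, ii * rsqrt (pt1 - orbit_a t),
   ii * rsqrt (pt2 - orbit_a t)).
Definition lift_b (t : I) : Y :=
  (rsqrt (orbit_b t), ii * rsqrt ec * halfcirc t, ii * rsqrt (pt2 - orbit_b t)).
Definition lift_s (t : I) : Y :=
  (rsqrt (orbit_s t), ii * rsqrt ec * (halfcirc t * rsqrt (2 - (circ t)^-1)),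
   ii * rsqrt (3 * e)%:C * (halfcirc t * rsqrt ((2 + (circ t)^-1) / 3))).

Definition lifts (Z : I -> C) (L : I -> Y) := forall t,
  [/\ (L t).1.1 ^+ 2 = Z t, (L t).1.2 ^+ 2 = Z t - pt1 & (L t).2 ^+ 2 = Z t - pt2].

Lemma lifts_config Z L t : lifts Z L -> config (L t) = (pt1, pt2, Z t).
Proof. by move=> /(_ t)[h1 h2 h3]; rewrite /config h1 h2 h3 !subKr. Qed.

Lemma ReB (z w : C) : complex.Re (z - w) = complex.Re z - complex.Re w.
Proof. by rewrite raddfB. Qed.
Lemma ReD (z w : C) : complex.Re (z + w) = complex.Re z + complex.Re w.
Proof. by rewrite raddfD. Qed.
Lemma ReZ (k : R) (z : C) : complex.Re ((k%:C : C) * z) = k * complex.Re z.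
Proof. by case: z => a b /=; rewrite mul0r subr0. Qed.

Lemma ii2 : ii ^+ 2 = -1.
Proof. exact: sqr_i. Qed.
Lemma ii_neq0 : ii != 0.
Proof. by rewrite -sqrf_eq0 ii2 oppr_eq0 oner_eq0. Qed.

Lemma real_neq0 (k : R) : 0 < k -> k%:C != 0 :> C.
Proof. by move=> k0; rewrite -[0]/(0%:C) (inj_eq (@complexI R)) gt_eqF. Qed.

Lemma natC n : (n%:R : R)%:C = n%:R :> C.
Proof. by rewrite rmorph_nat. Qed.

Lemma Re_circZ (k : R) (t : I) : 0 <= k ->
  - k <= k * complex.Re (circ t) /\ k * complex.Re (circ t) <= k.
Proof.
have /andP[] := Re_circ t; move: (complex.Re (circ t)) => c lo hi k0.
by split; [rewrite -mulrN1 ler_wpM2l|rewrite ler_piMr].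
Qed.

Lemma Re_pt_a1 t : 0 < complex.Re (pt1 - orbit_a t).
Proof.
have [e0 e5] := (e_gt0, e_small).
rewrite ReB /orbit_a /pt1 /pt2 ReZ; have [|+ +] := @Re_circZ (1 - 2 * e) t; first by lra.
by move: (complex.Re (circ t)) => c /= lo hi; lra.
Qed.

Lemma Re_pt_a2 t : 0 < complex.Re (pt2 - orbit_a t).
Proof.
have [e0 e5] := (e_gt0, e_small).
rewrite ReB /orbit_a /pt1 /pt2 ReZ; have [|+ +] := @Re_circZ (1 - 2 * e) t; first by lra.
by move: (complex.Re (circ t)) => c /= lo hi; lra.
Qed.

Lemma Re_orbit_b t : 1 - 2 * e <= complex.Re (orbit_b t).
Proof.
have [e0 e5] := (e_gt0, e_small).
rewrite /orbit_b ReB ReZ; have [|+ +] := @Re_circZ e t; first by lra.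
by move: (complex.Re (circ t)) => c /= lo hi; lra.
Qed.

Lemma Re_pt_b2 t : 0 < complex.Re (pt2 - orbit_b t).
Proof.
have [e0 e5] := (e_gt0, e_small).
have -> : pt2 - orbit_b t = (2 * e)%:C + ec * circ t.
  by rewrite /pt2 /orbit_b rmorphM /= natC; ring.
rewrite ReD ReZ; have [|+ +] := @Re_circZ e t; first by lra.
by move: (complex.Re (circ t)) => c /= lo hi; lra.
Qed.

Lemma Re_orbit_s t : 1 - 2 * e <= complex.Re (orbit_s t).
Proof.
have [e0 e5] := (e_gt0, e_small).
have E : 2 * ec = (2 * e)%:C by rewrite rmorphM /= natC.
rewrite /orbit_s E ReB ReZ; have [|+ +] := @Re_circZ (2 * e) t; first by lra.
by move: (complex.Re (circ t)) => c /= lo hi; lra.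
Qed.

Lemma Re_2B (t : I) : 0 < complex.Re (2 - (circ t)^-1).
Proof.
rewrite ReB circV -(natC 2); have [|+ +] := @Re_circZ 1 t; first by lra.
by move: (complex.Re (circ t)) => c /= lo hi; lra.
Qed.

Lemma Re_2D3 (t : I) : 0 < complex.Re ((2 + (circ t)^-1) / 3).
Proof.
have -> : (2 + (circ t)^-1) / 3 = (3^-1 : R)%:C * (2 + (circ t)^-1).
  by rewrite fmorphV /= natC mulrC.
rewrite ReZ ReD circV -(natC 2); have [|+ +] := @Re_circZ 1 t; first by lra.
by move: (complex.Re (circ t)) => c /= lo hi; lra.
Qed.

Lemma sqr3 (x y z : C) : (x * y * z) ^+ 2 = x ^+ 2 * y ^+ 2 * z ^+ 2.
Proof. by rewrite !exprMn. Qed.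
Lemma sqr4 (x y z t : C) :
  (x * y * (z * t)) ^+ 2 = x ^+ 2 * y ^+ 2 * (z ^+ 2 * t ^+ 2).
Proof. by rewrite !exprMn. Qed.

Lemma lifts_a : lifts orbit_a lift_a.
Proof.
have [e0 e5] := (e_gt0, e_small).
move=> t; split; rewrite /= exprMn.
- by rewrite halfcirc2 rsqrtK //=; lra.
- by rewrite ii2 rsqrtK ?Re_pt_a1 // mulN1r opprB.
- by rewrite ii2 rsqrtK ?Re_pt_a2 // mulN1r opprB.
Qed.

Lemma lifts_b : lifts orbit_b lift_b.
Proof.
have [e0 e5] := (e_gt0, e_small).
move=> t; split; rewrite /=.
- by rewrite rsqrtK //; have := Re_orbit_b t; lra.
- by rewrite sqr3 ii2 halfcirc2 rsqrtK //= /orbit_b /pt1; ring.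
- by rewrite exprMn ii2 rsqrtK ?Re_pt_b2 // mulN1r opprB.
Qed.

Lemma lifts_s : lifts orbit_s lift_s.
Proof.
have [e0 e5] := (e_gt0, e_small).
move=> t; have c0 := circ_neq0 t; split; rewrite /=.
- by rewrite rsqrtK //; have := Re_orbit_s t; lra.
- rewrite sqr4 ii2 halfcirc2 rsqrtK //= rsqrtK ?Re_2B // mulrBr divff //.
  by rewrite /orbit_s /pt1; ring.
- rewrite sqr4 ii2 halfcirc2 rsqrtK /=; last by rewrite mulr_gt0.
  rewrite rsqrtK ?Re_2D3 // rmorphM /= natC.
  by rewrite /orbit_s /pt2; field.
Qed.

Lemma rsqrt_halfcirc_continuous (f : I -> C) : continuous f ->
  (forall t, 0 < complex.Re (f t)) ->
  continuous (fun t => halfcirc t * rsqrt (f t) : C).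
Proof.
move=> cf f0; apply: cmul_continuous; first exact: halfcirc_continuous.
by apply: rsqrt_continuous; [exact: cf|exact: f0].
Qed.

Lemma constM_continuous (k : C) (f : I -> C) : continuous f ->
  continuous (fun t => k * f t : C).
Proof. by move=> cf; apply: cmul_continuous; [exact: cst_continuous|exact: cf]. Qed.

Lemma cover_path_lift Z L : lifts Z L -> continuous L ->
  (forall t, [/\ (L t).1.1 != 0, (L t).1.2 != 0 & (L t).2 != 0]) -> cover_path L.
Proof.
have [e0 e5] := (e_gt0, e_small).
move=> lZ cL L0; split=> [|t]; first exact: cL.
have [h1 h2 h3] := lZ t; have [n1 n2 n3] := L0 t.
rewrite (lifts_config t lZ); split=> /=.
- by rewrite /pt1 -[1]/((1 : R)%:C) -rmorphB real_neq0 //; lra.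
- by rewrite /pt2 -[1]/((1 : R)%:C) -rmorphD real_neq0 //; lra.
- by rewrite -h1 expf_neq0.
split.
- have -> : pt1 - pt2 = - (2 * e)%:C by rewrite /pt1 /pt2 rmorphM /= natC; ring.
  by rewrite oppr_eq0 real_neq0 // mulr_gt0.
- by rewrite -h2 expf_neq0.
- by rewrite -h3 expf_neq0.
Qed.

Lemma orbit_a_continuous : continuous orbit_a.
Proof. by apply: constM_continuous; exact: circ_continuous. Qed.

Lemma orbit_b_continuous : continuous orbit_b.
Proof.
apply: csub_continuous; first exact: cst_continuous.
by apply: constM_continuous; exact: circ_continuous.
Qed.

Lemma orbit_s_continuous : continuous orbit_s.
Proof.
apply: csub_continuous; first exact: cst_continuous.
by apply: constM_continuous; exact: circ_continuous.
Qed.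

Lemma cst_sub_continuous (k : C) (f : I -> C) : continuous f ->
  continuous (fun t => k - f t : C).
Proof. by move=> cf; apply: csub_continuous; [exact: cst_continuous|exact: cf]. Qed.

Lemma iroot_neq0 z : ii * rsqrt z != 0.
Proof. by rewrite mulf_eq0 negb_or ii_neq0 rsqrt_neq0. Qed.

Lemma halfcirc_neq0 (t : I) : halfcirc t != 0.
Proof. exact: expi_neq0. Qed.

Lemma cover_path_a : cover_path lift_a.
Proof.
apply: (cover_path_lift lifts_a).
  apply: triple_continuous.
  - by apply: constM_continuous; exact: halfcirc_continuous.
  - apply: constM_continuous; apply: rsqrt_continuous; last exact: Re_pt_a1.
    by apply: cst_sub_continuous; exact: orbit_a_continuous.
  - apply: constM_continuous; apply: rsqrt_continuous; last exact: Re_pt_a2.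
    by apply: cst_sub_continuous; exact: orbit_a_continuous.
move=> t; split; rewrite /= ?iroot_neq0 //.
exact: (mulf_neq0 (rsqrt_neq0 _) (halfcirc_neq0 t)).
Qed.

Lemma cover_path_b : cover_path lift_b.
Proof.
have [e0 e5] := (e_gt0, e_small).
apply: (cover_path_lift lifts_b).
  apply: triple_continuous.
  - apply: rsqrt_continuous; first exact: orbit_b_continuous.
    by move=> t; have := Re_orbit_b t; lra.
  - by apply: constM_continuous; exact: halfcirc_continuous.
  - apply: constM_continuous; apply: rsqrt_continuous; last exact: Re_pt_b2.
    by apply: cst_sub_continuous; exact: orbit_b_continuous.
move=> t; split; rewrite /= ?iroot_neq0 ?rsqrt_neq0 //.
exact: (mulf_neq0 (iroot_neq0 _) (halfcirc_neq0 t)).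
Qed.

Lemma circV_continuous : continuous (fun t : I => (circ t)^-1).
Proof. by apply: cinv_continuous; [exact: circ_continuous|exact: circ_neq0]. Qed.

Lemma cover_path_s : cover_path lift_s.
Proof.
have [e0 e5] := (e_gt0, e_small).
apply: (cover_path_lift lifts_s).
  apply: triple_continuous.
  - apply: rsqrt_continuous; first exact: orbit_s_continuous.
    by move=> t; have := Re_orbit_s t; lra.
  - apply: constM_continuous; apply: rsqrt_halfcirc_continuous; last exact: Re_2B.
    by apply: cst_sub_continuous; exact: circV_continuous.
  - apply: constM_continuous; apply: rsqrt_halfcirc_continuous; last exact: Re_2D3.
    apply: cmul_continuous; last exact: cst_continuous.
    by apply: cadd_continuous; [exact: cst_continuous|exact: circV_continuous].
move=> t; split; rewrite /= ?rsqrt_neq0 //;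
  exact: (mulf_neq0 (iroot_neq0 _) (mulf_neq0 (halfcirc_neq0 t) (rsqrt_neq0 _))).
Qed.

Lemma pt1B_a (u : I) : circ u = 1 -> pt1 - orbit_a u = ec.
Proof.
move=> cu; rewrite /pt1 /orbit_a cu mulr1 rmorphB rmorphM /= natC rmorph1; ring.
Qed.
Lemma pt2B_a (u : I) : circ u = 1 -> pt2 - orbit_a u = (3 * e)%:C.
Proof.
move=> cu; rewrite /pt2 /orbit_a cu mulr1 rmorphB !rmorphM /= !natC rmorph1; ring.
Qed.
Lemma orbit_b_end (u : I) : circ u = 1 -> orbit_b u = (1 - 2 * e)%:C.
Proof.
move=> cu; rewrite /orbit_b cu mulr1 rmorphB !rmorphM /= !natC rmorph1; ring.
Qed.
Lemma pt2B_b (u : I) : circ u = 1 -> pt2 - orbit_b u = (3 * e)%:C.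
Proof.
by move=> cu; rewrite /pt2 /orbit_b cu mulr1 !rmorphM /= !natC; ring.
Qed.
Lemma orbit_s_end (u : I) : circ u = 1 -> orbit_s u = (1 - 2 * e)%:C.
Proof.
move=> cu; rewrite /orbit_s cu mulr1 rmorphB !rmorphM /= !natC rmorph1; ring.
Qed.

Lemma lift_a0 : lift_a zero = base_lift.
Proof. by rewrite /lift_a pt1B_a ?pt2B_a ?circ0 // halfcirc0 mulr1. Qed.
Lemma lift_a1 : lift_a one = flip (-1, 1, 1) base_lift.
Proof.
by rewrite /lift_a /flip pt1B_a ?pt2B_a ?circ1 // halfcirc1 /= !mul1r mulrN1 mulN1r.
Qed.
Lemma lift_b0 : lift_b zero = base_lift.
Proof. by rewrite /lift_b pt2B_b ?orbit_b_end ?circ0 // halfcirc0 mulr1. Qed.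
Lemma lift_b1 : lift_b one = flip (1, -1, 1) base_lift.
Proof.
by rewrite /lift_b /flip pt2B_b ?orbit_b_end ?circ1 // halfcirc1 /= !mul1r mulrN1 mulN1r.
Qed.
Lemma lift_s_end (u : I) : circ u = 1 -> lift_s u =
  (rsqrt (1 - 2 * e)%:C, ii * rsqrt ec * halfcirc u,
   ii * rsqrt (3 * e)%:C * halfcirc u).
Proof.
move=> cu; rewrite /lift_s orbit_s_end // cu invr1.
have -> : 2 - 1 = 1 :> C by ring.
have -> : (2 + 1) / 3 = 1 :> C by field.
by rewrite rsqrt1 !mulr1.
Qed.
Lemma lift_s0 : lift_s zero = base_lift.
Proof. by rewrite lift_s_end ?circ0 // halfcirc0 !mulr1. Qed.
Lemma lift_s1 : lift_s one = flip (1, -1, -1) base_lift.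
Proof.
rewrite lift_s_end ?circ1 // halfcirc1 /flip /= mul1r.
by rewrite !mulrN1 !mulN1r.
Qed.
End LetterLifts.

(** * Turns along the lifted motions *)

Section LetterTurns.
Context {R : realType} (e : R) (e_gt0 : 0 < e) (e_small : 5 * e < 1).
Local Notation C := (R[i] : numClosedFieldType).
Local Notation I := (itv01 R).
Local Notation Y := (C * C * C)%type.
Local Notation ii := ('i%C : C).
Local Notation La := (@lift_a R e).
Local Notation Lb := (@lift_b R e).
Local Notation Ls := (@lift_s R e).
Local Notation y0 := (@base_lift R e).

Lemma turn_inverse (f g : I -> C) (c : C) : nonvanishing f -> nonvanishing g ->
  (forall t, f t * g t = c) -> turn g = - turn f.
Proof.
move=> nf ng fg; have c0 : c != 0.
  by rewrite -(fg zero); exact: (mulf_neq0 (nf.2 zero) (ng.2 zero)).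
have := turnM nf ng; have -> : (fun t => f t * g t) = (fun=> c).
  by apply/funext => t; exact: fg.
by rewrite turn_cst //; lra.
Qed.

(** Each sum times the matching difference is one of z1, z2 - z1 and z2, which are
at rest. *)
Lemma turn_diffs (Z : I -> C) (L : I -> Y) : lifts e Z L -> cover_path L ->
  [/\ turn (diff12 \o L) = - turn (sum12 \o L), turn (diff23 \o L) = - turn (sum23 \o L)
    & turn (diff13 \o L) = - turn (sum13 \o L)].
Proof.
move=> lZ [cL dL]; have [n12 n23 n13 [m12 m23 m13]] := nonvanishing_sums cL dL.
split; [apply: (turn_inverse (c := pt1 e) n12 m12)
  |apply: (turn_inverse (c := pt2 e - pt1 e) n23 m23)
  |apply: (turn_inverse (c := pt2 e) n13 m13)] => t;
have [h1 h2 h3] := lZ t.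
- have -> : pt1 e = (L t).1.1 ^+ 2 - (L t).1.2 ^+ 2 by rewrite h1 h2 subKr.
  by rewrite /sum12 /diff12 /=; ring.
- have -> : pt2 e - pt1 e = (L t).1.2 ^+ 2 - (L t).2 ^+ 2 by rewrite h2 h3; ring.
  by rewrite /sum23 /diff23 /=; ring.
- have -> : pt2 e = (L t).1.1 ^+ 2 - (L t).2 ^+ 2 by rewrite h1 h3 subKr.
  by rewrite /sum13 /diff13 /=; ring.
Qed.

Lemma Re_halfcirc_gt0 (r : R) (w : C) (t : I) : 0 < r -> 0 < complex.Re w ->
  0 < complex.Re (- ii * (r%:C * halfcirc t + ii * w)).
Proof.
move=> r0 w0; have := Im_halfcirc t; move: (halfcirc t) => h.
case: h => x y; case: w w0 => a b /= a0 y0'.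
have := mulr_ge0 (ltW r0) y0'; lra.
Qed.

(** The arguments involved are arctangents of two inverse slopes, which add up to a
right angle. *)
Lemma half_turn (r q : R) : 0 < r -> 0 < q ->
  (arg1 (- ii * (- r%:C + ii * q%:C)) - arg1 (- ii * (r%:C + ii * q%:C))) -
  (arg1 (r%:C - ii * q%:C) - arg1 (r%:C + ii * q%:C)) = pi.
Proof.
move=> r0 q0.
have -> : arg1 (- ii * (- r%:C + ii * q%:C)) = atan (r / q).
  by rewrite /arg1 /=; congr (atan (_ / _)); ring.
have -> : arg1 (- ii * (r%:C + ii * q%:C)) = - atan (r / q).
  by rewrite /arg1 -atanN -mulNr /=; congr (atan (_ / _)); ring.
have -> : arg1 (r%:C - ii * q%:C) = - atan (q / r).
  by rewrite -[RHS]atanN -[- (q / r)]mulNr /arg1 /=; congr (atan (_ / _)); ring.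
have -> : arg1 (r%:C + ii * q%:C) = atan (q / r).
  by rewrite /arg1 /=; congr (atan (_ / _)); ring.
have := @atan_inv R (r / q) (divr_gt0 r0 q0); rewrite invf_div; lra.
Qed.

Lemma Re_sum_gt0 (Z w a b : C) : `|Z - 1| <= (2 * e)%:C -> `|w - 1| <= e%:C ->
  a ^+ 2 = Z -> b ^+ 2 = Z - w -> 0 < complex.Re a -> 0 < complex.Re (1 * (a + b)).
Proof.
have [e0 e5] := (e_gt0, e_small).
move=> Z1 w1 aZ bZ a0; rewrite mul1r; apply: Re_add_gt0 => //.
rewrite aZ bZ; have := Re_near1_ge Z1 => ReZ1.
apply: (@le_lt_trans _ _ ((2 * e)%:C + e%:C)); last by rewrite -rmorphD ltcR /=; lra.
have -> : Z - w = (Z - 1) - (w - 1) by ring.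
by apply: (le_trans (ler_normB _ _)); rewrite lerD.
Qed.

Lemma norm_real (k : R) : 0 <= k -> `|k%:C : C| = k%:C.
Proof. by move=> k0; rewrite ger0_norm // lecR. Qed.

Lemma pt1_near : `|pt1 e - 1| <= e%:C.
Proof.
have e0 := ltW e_gt0; have -> : pt1 e - 1 = - e%:C by rewrite /pt1; ring.
by rewrite normrN norm_real.
Qed.
Lemma pt2_near : `|pt2 e - 1| <= e%:C.
Proof.
have e0 := ltW e_gt0; have -> : pt2 e - 1 = e%:C by rewrite /pt2; ring.
by rewrite norm_real.
Qed.
Lemma orbit_b_near t : `|orbit_b e t - 1| <= (2 * e)%:C.
Proof.
have e0 := ltW e_gt0.
have -> : orbit_b e t - 1 = - e%:C - e%:C * circ t by rewrite /orbit_b; ring.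
apply: (le_trans (ler_normB _ _)); rewrite normrN normrM circ_norm mulr1.
by rewrite norm_real // -rmorphD lecR /=; lra.
Qed.
Lemma orbit_s_near t : `|orbit_s e t - 1| <= (2 * e)%:C.
Proof.
have e0 : 0 <= 2 * e by rewrite mulr_ge0 ?ltW.
have -> : orbit_s e t - 1 = - ((2 * e)%:C * circ t).
  by rewrite /orbit_s rmorphM /= natC; ring.
by rewrite normrN normrM circ_norm mulr1 norm_real.
Qed.

Lemma base_real : exists r q q' : R, [/\ 0 < r, 0 < q, 0 < q' &
  y0 = (r%:C, ii * q%:C, ii * q'%:C)].
Proof.
have [e0 e5] := (e_gt0, e_small).
have [|r r0 rE] := @rsqrt_real R (1 - 2 * e); first by lra.
have [|q q0 qE] := @rsqrt_real R e; first by [].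
have [|q' q0' qE'] := @rsqrt_real R (3 * e); first by lra.
by exists r, q, q'; split=> //; rewrite /base_lift rE qE qE'.
Qed.

(** With r, q > 0, the sum leads from r + i q to - r + i q in the upper half-plane
along [lift_a], and from r + i q to r - i q in the right half-plane along [lift_s]:
together, the first path and the reverse of the second make half a turn. *)
Lemma turn_sum12_a : turn (sum12 \o La) - turn (sum12 \o Ls) = pi.
Proof.
have ga := cover_path_a e_gt0 e_small; have gs := cover_path_s e_gt0 e_small.
have [ca _ _ _] := nonvanishing_sums ga.1 ga.2.
have [cs _ _ _] := nonvanishing_sums gs.1 gs.2.
rewrite (turn_half_plane (c := - ii) ca.1) => [|t]; last first.
  have [|r r0 E] := @rsqrt_real R (1 - 2 * e); first by move: e_small e_gt0; lra.
  rewrite /comp /sum12 /lift_a; cbn [fst snd]; rewrite E.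
  by apply: Re_halfcirc_gt0 => //; exact: Re_rsqrt.
rewrite (turn_half_plane (c := 1) cs.1) => [|t]; last first.
  have [h1 h2 _] := lifts_s e_gt0 e_small t.
  exact: (Re_sum_gt0 (orbit_s_near t) pt1_near h1 h2 (Re_rsqrt _)).
rewrite /= lift_a0 lift_a1 lift_s0 lift_s1.
have [r [q [q' [r0 q0 _ ->]]]] := base_real; rewrite /sum12 /flip /= !mul1r !mulN1r.
exact: half_turn.
Qed.

Lemma turn_sum13_a : turn (sum13 \o La) - turn (sum13 \o Ls) = pi.
Proof.
have ga := cover_path_a e_gt0 e_small; have gs := cover_path_s e_gt0 e_small.
have [_ _ ca _] := nonvanishing_sums ga.1 ga.2.
have [_ _ cs _] := nonvanishing_sums gs.1 gs.2.
rewrite (turn_half_plane (c := - ii) ca.1) => [|t]; last first.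
  have [|r r0 E] := @rsqrt_real R (1 - 2 * e); first by move: e_small e_gt0; lra.
  rewrite /comp /sum13 /lift_a; cbn [fst snd]; rewrite E.
  by apply: Re_halfcirc_gt0 => //; exact: Re_rsqrt.
rewrite (turn_half_plane (c := 1) cs.1) => [|t]; last first.
  have [h1 _ h2] := lifts_s e_gt0 e_small t.
  exact: (Re_sum_gt0 (orbit_s_near t) pt2_near h1 h2 (Re_rsqrt _)).
rewrite /= lift_a0 lift_a1 lift_s0 lift_s1.
have [r [q [q' [r0 _ q0 ->]]]] := base_real; rewrite /sum13 /flip /= !mul1r !mulN1r.
exact: half_turn.
Qed.

Lemma turn_sum12_b : turn (sum12 \o Lb) = turn (sum12 \o Ls).
Proof.
have gb := cover_path_b e_gt0 e_small; have gs := cover_path_s e_gt0 e_small.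
have [cb _ _ _] := nonvanishing_sums gb.1 gb.2.
have [cs _ _ _] := nonvanishing_sums gs.1 gs.2.
rewrite (turn_half_plane (c := 1) cb.1) => [|t]; last first.
  have [h1 h2 _] := lifts_b e_gt0 e_small t.
  exact: (Re_sum_gt0 (orbit_b_near t) pt1_near h1 h2 (Re_rsqrt _)).
rewrite (turn_half_plane (c := 1) cs.1) => [|t]; last first.
  have [h1 h2 _] := lifts_s e_gt0 e_small t.
  exact: (Re_sum_gt0 (orbit_s_near t) pt1_near h1 h2 (Re_rsqrt _)).
by rewrite /= lift_b0 lift_b1 lift_s0 lift_s1.
Qed.

Lemma turn_sum13_b : turn (sum13 \o Lb) = 0.
Proof.
have gb := cover_path_b e_gt0 e_small; have [_ _ cb _] := nonvanishing_sums gb.1 gb.2.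
rewrite (turn_half_plane (c := 1) cb.1) => [|t]; last first.
  have [h1 _ h2] := lifts_b e_gt0 e_small t.
  exact: (Re_sum_gt0 (orbit_b_near t) pt2_near h1 h2 (Re_rsqrt _)).
by rewrite /= lift_b0 lift_b1 /sum13 /flip /= !mul1r subrr.
Qed.

(** The half circle is a common factor, and the remaining factor is a closed path
in the right half-plane. *)
Lemma turn_sum23_s : turn (sum23 \o Ls) = pi.
Proof.
have [e0 e5] := (e_gt0, e_small).
have [q q0 qE] := @rsqrt_real R e e0.
have [|q' q0' qE'] := @rsqrt_real R (3 * e); first by lra.
pose w (t : I) : C := q%:C * rsqrt (2 - (circ t)^-1) +
  q'%:C * rsqrt ((2 + (circ t)^-1) / 3).
have Rw t : 0 < complex.Re (1 * w t).
  by rewrite mul1r ReD (ReZ q) (ReZ q') addr_gt0 // mulr_gt0 // Re_rsqrt.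
have cw : continuous w.
  apply: cadd_continuous; apply: constM_continuous; apply: rsqrt_continuous.
  - by apply: cst_sub_continuous; exact: circV_continuous.
  - exact: Re_2B.
  - apply: cmul_continuous; last exact: cst_continuous.
    by apply: cadd_continuous; [exact: cst_continuous|exact: circV_continuous].
  - exact: Re_2D3.
have nw : nonvanishing w.
  split=> [|t]; first exact: cw.
  by apply: contraTneq (Rw t) => ->; rewrite mulr0 ltxx.
have nh : nonvanishing (fun t : I => halfcirc t).
  by split=> [|t]; [exact: halfcirc_continuous|exact: halfcirc_neq0].
have -> : sum23 \o Ls = (fun t => ii * (halfcirc t * w t)).
  by apply/funext => t; rewrite /sum23 /= qE qE' /w; ring.
rewrite (turnZ ii_neq0 (nonvanishingM nh nw)) (turnM nh nw) (turn_half_plane cw Rw).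
have -> : w one = w zero by rewrite /w circ0 circ1.
by rewrite subrr addr0; exact: turn_expi.
Qed.

End LetterTurns.

(** * Two loops that do not commute *)

Section NoHomotopy.
Context {R : realType} (e : R) (e_gt0 : 0 < e) (e_small : 5 * e < 1).
Local Notation C := (R[i] : numClosedFieldType).
Local Notation I := (itv01 R).
Local Notation Y := (C * C * C)%type.
Local Notation La := (@lift_a R e).
Local Notation Lb := (@lift_b R e).
Local Notation Ls := (@lift_s R e).
Local Notation y0 := (@base_lift R e).

(** The word [p q (p' q')^-1]. *)
Definition quotient_word (T : topologicalType) (p q p' q' : I -> T) : I -> T :=
  path_cat_fun (path_cat_fun p q) (path_rev_fun (path_cat_fun p' q')).

Lemma quotient_word_app (S T : topologicalType) (f : S -> T) (p q p' q' : I -> S) t :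
  f (quotient_word p q p' q' t) =
  quotient_word (f \o p) (f \o q) (f \o p') (f \o q') t.
Proof.
rewrite /quotient_word /path_rev_fun /path_cat_fun /comp.
by case: ifP => _; case: ifP.
Qed.

Lemma turn_quotient_word (p q p' q' : I -> C) :
  nonvanishing p -> nonvanishing q -> nonvanishing p' -> nonvanishing q' ->
  p one = q zero -> p' one = q' zero ->
  q one = q' one ->
  turn (quotient_word p q p' q') = turn p + turn q - (turn p' + turn q').
Proof.
move=> np nq np' nq' pq pq' qq'.
rewrite (turn_cat (nonvanishing_cat np nq pq)).
- rewrite (turn_cat np nq pq) (turn_rev (nonvanishing_cat np' nq' pq')).
  by rewrite (turn_cat np' nq' pq').
- exact: nonvanishing_rev (nonvanishing_cat np' nq' pq').
- by rewrite path_cat_fun1 path_rev_fun0 path_cat_fun1.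
Qed.

Lemma cover_path_quotient_word (p q p' q' : I -> Y) :
  cover_path p -> cover_path q -> cover_path p' -> cover_path q' ->
  p one = q zero -> p' one = q' zero -> q one = q' one ->
  cover_path (quotient_word p q p' q').
Proof.
move=> gp gq gp' gq' pq pq' qq'; apply: cover_path_cat.
- exact: cover_path_cat.
- by apply: cover_path_rev; exact: cover_path_cat.
- by rewrite path_cat_fun1 path_rev_fun0 path_cat_fun1.
Qed.

Lemma quotient_word0 (T : topologicalType) (p q p' q' : I -> T) :
  quotient_word p q p' q' zero = p zero.
Proof. by rewrite /quotient_word !path_cat_fun0. Qed.
Lemma quotient_word1 (T : topologicalType) (p q p' q' : I -> T) :
  quotient_word p q p' q' one = p' zero.
Proof. by rewrite /quotient_word path_cat_fun1 path_rev_fun1 path_cat_fun0. Qed.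

(** The deck transformation from the start to the end of [lift_a]; likewise for b
and s. *)
Definition sign_a : C * C * C := (-1, 1, 1).
Definition sign_b : C * C * C := (1, -1, 1).
Definition sign_s : C * C * C := (1, -1, -1).

Lemma signs_abs : [/\ signs sign_a, signs sign_b & signs sign_s].
Proof. by split; split; rewrite /= ?sqrrN ?expr1n. Qed.

Lemma flipM (s s' y : Y) :
  flip s (flip s' y) = flip (flip s s') y.
Proof. by rewrite /flip /= !mulrA. Qed.

Definition orbit_config (Z : I -> C) (t : I) : C * C * C := (pt1 e, pt2 e, Z t).

(** The lifts of [b s (s b)^-1] and [a s (s a)^-1]: the lift of a letter that comes
after another one has to start where the latter ends, so it is moved by the deck
transformation of the latter. *)
Definition lift_u := quotient_word Lb (flip sign_b \o Ls) Ls (flip sign_s \o Lb).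
Definition lift_v := quotient_word La (flip sign_a \o Ls) Ls (flip sign_s \o La).
Definition word_u := quotient_word (orbit_config (orbit_b e)) (orbit_config (orbit_s e))
  (orbit_config (orbit_s e)) (orbit_config (orbit_b e)).
Definition word_v := quotient_word (orbit_config (orbit_a e)) (orbit_config (orbit_s e))
  (orbit_config (orbit_s e)) (orbit_config (orbit_a e)).

Lemma config_lift Z L s : lifts e Z L -> signs s ->
  config \o L = orbit_config Z /\ config \o (flip s \o L) = orbit_config Z.
Proof.
move=> lZ ss; split; apply/funext => t /=; first exact: lifts_config.
by rewrite config_flip //; exact: lifts_config.
Qed.

(** Along [lift_u] both rho and 1 - rho turn once, and along [lift_v] rho turns once
and 1 - rho minus once, so [commuting_lifts] would make 3 divide 2.  The turns are
obtained letter by letter: a deck transformation only permutes the sums and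
differences, up to a sign, and the turn of a difference is opposite to that of the
matching sum. *)
Lemma no_commuting_homotopy (K : I * I -> C * C * C) :
  continuous K -> (forall st, distinct4 (K st)) ->
  (forall t, K (zero, t) = path_cat_fun word_u word_v t) ->
  (forall t, K (one, t) = path_cat_fun word_v word_u t) ->
  (forall s, K (s, zero) = config y0) -> (forall s, K (s, one) = config y0) ->
  False.
Proof.
move=> cK dK Kuv Kvu K0 K1.
have [ga gb gs] := And3 (cover_path_a e_gt0 e_small) (cover_path_b e_gt0 e_small)
  (cover_path_s e_gt0 e_small).
have [la lb ls] := And3 (lifts_a e_gt0 e_small) (lifts_b e_gt0 e_small)
  (lifts_s e_gt0 e_small).
have [sa sb ss] := signs_abs.
have [ca cb cs] := And3 (config_lift la ss) (config_lift lb ss) (config_lift ls sb).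
have cs' := config_lift ls sa.
have [gsa gsb gas gbs] := And4 (cover_path_flip sa gs) (cover_path_flip sb gs)
  (cover_path_flip ss ga) (cover_path_flip ss gb).
have e1 : Lb one = (flip sign_b \o Ls) zero by rewrite /= lift_b1 lift_s0.
have e2 : Ls one = (flip sign_s \o Lb) zero by rewrite /= lift_s1 lift_b0.
have e3 : (flip sign_b \o Ls) one = (flip sign_s \o Lb) one.
  by rewrite /= lift_b1 lift_s1 !flipM /flip /= !mulr1 !mul1r.
have e4 : La one = (flip sign_a \o Ls) zero by rewrite /= lift_a1 lift_s0.
have e5 : Ls one = (flip sign_s \o La) zero by rewrite /= lift_s1 lift_a0.
have e6 : (flip sign_a \o Ls) one = (flip sign_s \o La) one.
  by rewrite /= lift_a1 lift_s1 !flipM /flip /= !mulr1 !mul1r.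
have gu : cover_path lift_u by exact: cover_path_quotient_word.
have gv : cover_path lift_v by exact: cover_path_quotient_word.
have turns (f : Y -> C) :
    nonvanishing (f \o La) -> nonvanishing (f \o Lb) -> nonvanishing (f \o Ls) ->
    nonvanishing (f \o (flip sign_a \o Ls)) -> nonvanishing (f \o (flip sign_b \o Ls)) ->
    nonvanishing (f \o (flip sign_s \o La)) -> nonvanishing (f \o (flip sign_s \o Lb)) ->
    turn (f \o lift_u) = turn (f \o Lb) + turn (f \o (flip sign_b \o Ls)) -
      (turn (f \o Ls) + turn (f \o (flip sign_s \o Lb))) /\
    turn (f \o lift_v) = turn (f \o La) + turn (f \o (flip sign_a \o Ls)) -
      (turn (f \o Ls) + turn (f \o (flip sign_s \o La))).
  move=> fa fb fs fsa fsb fas fbs; split.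
    rewrite -turn_quotient_word //.
    - by congr turn; apply/funext => t; exact: quotient_word_app.
    - exact: (congr1 f e1).
    - exact: (congr1 f e2).
    - exact: (congr1 f e3).
  rewrite -turn_quotient_word //.
  - by congr turn; apply/funext => t; exact: quotient_word_app.
  - exact: (congr1 f e4).
  - exact: (congr1 f e5).
  - exact: (congr1 f e6).
have [a12 a23 a13 [ag12 ag23 ag13]] := nonvanishing_sums ga.1 ga.2.
have [b12 b23 b13 [bg12 bg23 bg13]] := nonvanishing_sums gb.1 gb.2.
have [s12 s23 s13 [sg12 sg23 sg13]] := nonvanishing_sums gs.1 gs.2.
have [sa12 sa23 _ [_ _ sa13]] := nonvanishing_sums gsa.1 gsa.2.
have [sb12 sb23 _ [_ _ sb13]] := nonvanishing_sums gsb.1 gsb.2.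
have [as12 as23 _ [_ _ as13]] := nonvanishing_sums gas.1 gas.2.
have [bs12 bs23 _ [_ _ bs13]] := nonvanishing_sums gbs.1 gbs.2.
have [u12 v12] := turns _ a12 b12 s12 sa12 sb12 as12 bs12.
have [u23 v23] := turns _ a23 b23 s23 sa23 sb23 as23 bs23.
have [u13 v13] := turns _ ag13 bg13 sg13 sa13 sb13 as13 bs13.
have [ta12 ta23 ta13] := turn_diffs la ga.
have [tb12 tb23 tb13] := turn_diffs lb gb.
have [ts12 ts23 ts13] := turn_diffs ls gs.
have F12b : turn (sum12 \o (flip sign_b \o Ls)) = turn (diff12 \o Ls).
  by congr turn; apply/funext => t; rewrite /sum12 /diff12 /flip /=; ring.
have F12sa : turn (sum12 \o (flip sign_s \o La)) = turn (diff12 \o La).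
  by congr turn; apply/funext => t; rewrite /sum12 /diff12 /flip /=; ring.
have F12sb : turn (sum12 \o (flip sign_s \o Lb)) = turn (diff12 \o Lb).
  by congr turn; apply/funext => t; rewrite /sum12 /diff12 /flip /=; ring.
have F12a : turn (sum12 \o (flip sign_a \o Ls)) = turn (diff12 \o Ls).
  rewrite -(turnN sg12); congr turn.
  by apply/funext => t; rewrite /sum12 /diff12 /flip /=; ring.
have F23b : turn (sum23 \o (flip sign_b \o Ls)) = turn (diff23 \o Ls).
  rewrite -(turnN sg23); congr turn.
  by apply/funext => t; rewrite /sum23 /diff23 /flip /=; ring.
have F23a : turn (sum23 \o (flip sign_a \o Ls)) = turn (sum23 \o Ls).
  by congr turn; apply/funext => t; rewrite /sum23 /flip /=; ring.
have F23sa : turn (sum23 \o (flip sign_s \o La)) = turn (sum23 \o La).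
  rewrite -(turnN a23); congr turn.
  by apply/funext => t; rewrite /sum23 /flip /=; ring.
have F23sb : turn (sum23 \o (flip sign_s \o Lb)) = turn (sum23 \o Lb).
  rewrite -(turnN b23); congr turn.
  by apply/funext => t; rewrite /sum23 /flip /=; ring.
have F13b : turn (diff13 \o (flip sign_b \o Ls)) = turn (diff13 \o Ls).
  by congr turn; apply/funext => t; rewrite /diff13 /flip /=; ring.
have F13a : turn (diff13 \o (flip sign_a \o Ls)) = turn (sum13 \o Ls).
  rewrite -(turnN s13); congr turn.
  by apply/funext => t; rewrite /sum13 /diff13 /flip /=; ring.
have F13sa : turn (diff13 \o (flip sign_s \o La)) = turn (sum13 \o La).
  by congr turn; apply/funext => t; rewrite /sum13 /diff13 /flip /=; ring.
have F13sb : turn (diff13 \o (flip sign_s \o Lb)) = turn (sum13 \o Lb).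
  by congr turn; apply/funext => t; rewrite /sum13 /diff13 /flip /=; ring.
have T1 := canRL (subrK _) (turn_sum12_a e_gt0 e_small).
have T2 := turn_sum12_b e_gt0 e_small.
have T3 := canRL (subrK _) (turn_sum13_a e_gt0 e_small).
have T4 := turn_sum13_b e_gt0 e_small.
have T5 := turn_sum23_s e_gt0 e_small.
have W1 : word_u = config \o lift_u.
  apply/funext => t; rewrite /= quotient_word_app -/(config \o _).
  by rewrite cb.1 cb.2 cs.1 cs.2.
have W2 : word_v = config \o lift_v.
  apply/funext => t; rewrite /= quotient_word_app -/(config \o _).
  by rewrite ca.1 ca.2 cs.1 cs'.2.
have [||||||||||k] := @commuting_lifts R K y0 lift_u lift_v cK dK gu gv.
- by rewrite /lift_u quotient_word0 lift_b0.
- by rewrite /lift_u quotient_word1 lift_s0.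
- by rewrite /lift_v quotient_word0 lift_a0.
- by rewrite /lift_v quotient_word1 lift_s0.
- by move=> t; rewrite Kuv W1 W2 path_cat_fun_app.
- by move=> t; rewrite Kvu W1 W2 path_cat_fun_app.
- by [].
- by [].
- by rewrite u12 u23 F12b F12sb F23b F23sb tb12 ts12 ts23 T2 T5; ring.
- by rewrite v12 v23 F12a F12sa F23a F23sa ta12 ts12 T1; ring.
rewrite u13 u23 v13 v23 F13b F13sb F23b F23sb F13a F13sa F23a F23sa.
rewrite tb13 ta13 ts13 ts23 T3 T4 T5 => E.
have {}E : 2 * (2 * pi) = 3 * k%:~R * (2 * pi) :> R.
  by rewrite -mulrA [k%:~R * _]mulrC -E; ring.
have {}E : 2 = 3 * k%:~R :> R.
  by apply: (mulIf _ E); rewrite mulf_neq0 ?pnatr_eq0 // gt_eqF // pi_gt0.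
have {}E : (2 : int) = 3 * k.
  by apply: (@intr_inj R); rewrite rmorphM.
case: (leP k 0) => [k0|k0]; first by lia.
by lia.
Qed.
End NoHomotopy.

(** * Commutation relations and residual freeness *)

Section ResidualFreeness.
Local Open Scope group_scope.

(** A morphism f to a free group with f (A s) = 1 makes f s the inverse of f A,
which commutes with f a, so that f v = 1.  Otherwise f (A s) is a nontrivial element
commuting with f s and with f b, so that these commute and f u = 1.  In both cases
the commutator of u and v is lost. *)
Lemma not_residually_free_of (G : groupType) (A a b s : G) :
  A * s = s * A -> A * a = a * A -> A * s * b = b * (A * s) ->
  let u := b * s / (s * b) in let v := a * s / (s * a) in
  u * v <> v * u -> ~ residually_free G.
Proof.
move=> As Aa Asb u v uv resG.
have [|F [f [freeF f1]]] := resG (u * v / (v * u)); first by move/divg1_eq.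
have fM y z : f (y * z) = f y * f z by exact: gmulfM.
apply: f1; rewrite (fM (u * v)) morphV; suff -> : f (u * v) = f (v * u) by rewrite mulgV.
rewrite (fM u v) (fM v u); suff [->|->] : f u = 1 \/ f v = 1; rewrite ?mulg1 ?mul1g //.
have comm x y : f x * f y = f y * f x -> f (x * y / (y * x)) = 1.
  by move=> xy; rewrite !gmulfM morphV !gmulfM xy mulgV.
have [T1|T1] := eqVneq (f (A * s)) 1; [right|left]; apply: comm.
  have -> : f s = (f A)^-1 by move: T1; rewrite gmulfM => /mulg1_eq.
  by apply/commuteV; rewrite /commute -!gmulfM Aa.
apply: (free_commute_trans freeF (b := f (A * s))) => //; first exact/eqP.
  by rewrite -!gmulfM Asb.
by rewrite -!gmulfM (mulgA s) -As.
Qed.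

Lemma residually_free_inj (G H : groupType) (f : {multiplicative G -> H}) :
  injective f -> residually_free H -> residually_free G.
Proof.
move=> f_inj resH x x1; have [|F [g [freeF gx]]] := resH (f x).
  by rewrite -(morph1 f) => /f_inj.
have m : {morph (fun y => g (f y)) : y z / y * z} by move=> y z; rewrite !gmulfM.
pose gf : {multiplicative G -> F} := HB.pack (fun y => g (f y))
  (isMultiplicative.Build _ _ _ m).
by exists F, gf.
Qed.
End ResidualFreeness.

(** * Commuting loops on a torus *)

Section Homotopies.
Context {R : realType} {T : topologicalType}.
Local Notation I := (itv01 R).

(** The parameters move along straight segments of the plane. *)
Lemma plane_homotopic (Phi : R * R -> T) (g h : I -> R * R) (x y : T)
    (p q : {path I from x to y in T}) :
  continuous Phi -> continuous g -> continuous h ->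
  g zero = h zero -> g one = h one ->
  (forall t, p t = Phi (g t)) -> (forall t, q t = Phi (h t)) ->
  path_homotopic p q.
Proof.
move=> cPhi cg ch g0 g1 pE qE.
pose mix (u v : R) (s : R) := u + s * (v - u).
exists (fun st => Phi (mix (g st.2).1 (h st.2).1 (val st.1),
                       mix (g st.2).2 (h st.2).2 (val st.1))); split.
- have cmix (k l : R * R -> R) : continuous (fun t => k (g t)) ->
    continuous (fun t => l (h t)) ->
    continuous (fun st : I * I => mix (k (g st.2)) (l (h st.2)) (val st.1)).
    move=> ck cl.
    have ck2 : continuous (fun st : I * I => k (g st.2)).
      by apply: (@comp_continuous _ _ _ (fun t => k (g t)) snd);
        [exact: ck|exact: snd_continuous].
    have cl2 : continuous (fun st : I * I => l (h st.2)).
      by apply: (@comp_continuous _ _ _ (fun t => l (h t)) snd);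
        [exact: cl|exact: snd_continuous].
    move=> st; apply: cvgD; first exact: ck2.
    apply: cvgM; first exact: val_fst_continuous.
    by apply: cvgB; [exact: cl2|exact: ck2].
  have c1 (k : I -> R * R) : continuous k -> continuous (fun t => (k t).1).
    by move=> ck; apply: comp_continuous; [exact: fst_continuous|exact: ck].
  have c2 (k : I -> R * R) : continuous k -> continuous (fun t => (k t).2).
    by move=> ck; apply: comp_continuous; [exact: snd_continuous|exact: ck].
  apply: pair_comp_continuous; first exact: cPhi.
    by apply: (cmix fst fst); exact: c1.
  by apply: (cmix snd snd); exact: c2.
- move=> t; cbn [fst snd]; rewrite val_zero01 /mix !mul0r !addr0 pE.
  by case: (g t).
- move=> t; cbn [fst snd]; rewrite val_one01 /mix !mul1r ![_ + (_ - _)]addrC !subrK qE.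
  by case: (h t).
- move=> s; cbn [fst snd]; rewrite /mix -g0 !subrr !mulr0 !addr0.
  by case E : (g zero) => [u v]; rewrite -E -pE [LHS]path_zero.
- move=> s; cbn [fst snd]; rewrite /mix -g1 !subrr !mulr0 !addr0.
  by case E : (g one) => [u v]; rewrite -E -pE [LHS]path_one.
Qed.

Section Torus.
Context (x : T) (Phi : R * R -> T) (p q : {path I from x to x in T}).
Hypothesis cPhi : continuous Phi.
Hypothesis pE : forall t, p t = Phi (val t, 0).
Hypothesis qE : forall t, q t = Phi (0, val t).
Hypothesis Phi1 : forall t, Phi (1, t) = Phi (0, t).
Hypothesis Phi2 : forall s, Phi (s, 1) = Phi (s, 0).

(* On the first half of the time, first runs from 0 to 1 while second rests at 0;
   on the second half, first rests at 1 while second runs from 0 to 1. *)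
Let first (t : I) : R := Num.min 1 (2 * val t).
Let second (t : I) : R := Num.max 0 (2 * val t - 1).

Lemma first_continuous : continuous first.
Proof.
apply: Defs.min_continuous; first exact: cst_continuous.
by apply: scale_continuous; exact: val01_continuous.
Qed.
Lemma second_continuous : continuous second.
Proof.
by apply: Defs.max_continuous; [exact: cst_continuous|exact: affine01_continuous].
Qed.

Lemma path_cat_pq t : path_cat p q t = Phi (first t, second t).
Proof.
have /andP[t0 t1] := itv01_bounds t.
rewrite -[LHS]/(path_cat_fun p q t) /path_cat_fun /first /second; case: ifP => th.
  rewrite pE val_clamp01; last by apply/andP; split; lra.
  by rewrite min_r ?max_l //; lra.
move/negbT: th; rewrite -ltNge => th.
rewrite qE val_clamp01; last by apply/andP; split; lra.
by rewrite min_l ?max_r ?Phi1 //; lra.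
Qed.

Lemma path_cat_qp t : path_cat q p t = Phi (second t, first t).
Proof.
have /andP[t0 t1] := itv01_bounds t.
rewrite -[LHS]/(path_cat_fun q p t) /path_cat_fun /first /second; case: ifP => th.
  rewrite qE val_clamp01; last by apply/andP; split; lra.
  by rewrite min_r ?max_l //; lra.
move/negbT: th; rewrite -ltNge => th.
rewrite pE val_clamp01; last by apply/andP; split; lra.
by rewrite min_l ?max_r ?Phi2 //; lra.
Qed.

Let first0 : first zero = 0.
Proof. by rewrite /first val_zero01 mulr0 min_r. Qed.
Let first1 : first one = 1.
Proof. by rewrite /first val_one01 min_l //; lra. Qed.
Let second0 : second zero = 0.
Proof. by rewrite /second val_zero01 max_l //; lra. Qed.
Let second1 : second one = 1.
Proof. by rewrite /second val_one01 max_r; lra. Qed.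

(** Both products follow sides of the unit square of parameters, from one corner to
the opposite one. *)
Lemma torus_commute : path_homotopic (path_cat p q) (path_cat q p).
Proof.
apply: (plane_homotopic (g := fun t => (first t, second t))
  (h := fun t => (second t, first t)) cPhi).
- exact: pair_continuous first_continuous second_continuous.
- exact: pair_continuous second_continuous first_continuous.
- by rewrite first0 second0.
- by rewrite first1 second1.
- exact: path_cat_pq.
- exact: path_cat_qp.
Qed.

Lemma torus_diagonal (d : {path I from x to x in T}) :
  (forall t, d t = Phi (val t, val t)) -> path_homotopic (path_cat p q) d.
Proof.
move=> dE; apply: (plane_homotopic (g := fun t => (first t, second t))
  (h := fun t => (val t, val t)) cPhi).
- exact: pair_continuous first_continuous second_continuous.
- exact: pair_continuous (@val01_continuous R) (@val01_continuous R).
- by rewrite first0 second0 val_zero01.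
- by rewrite first1 second1 val_one01.
- exact: path_cat_pq.
- exact: dE.
Qed.
End Torus.

End Homotopies.

(** * Change of base point *)

Section BasePointChange.
Context {R : realType} {T : topologicalType}.
Local Notation I := (itv01 R).
Local Notation "p ~~ q" := (path_homotopic p q) (at level 70).
Local Notation "p ** q" := (path_cat p q) (at level 40, left associativity).

Local Instance path_homotopic_equivalence x y :
  RelationClasses.Equivalence (@path_homotopic R T x y).
Proof.
split=> [p|p q|p q r]; [exact: path_homotopic_refl|exact: path_homotopic_sym|].
exact: path_homotopic_trans.
Qed.

Local Instance path_cat_proper x y z : Morphisms.Proper
  (Morphisms.respectful (@path_homotopic R T x y)
    (Morphisms.respectful (@path_homotopic R T y z) (@path_homotopic R T x z)))
  (@path_cat R T x y z).
Proof. by move=> p p' pp' q q' qq'; exact: path_homotopic_cat. Qed.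

Lemma path_catKV x y z (g : {path I from x to y in T})
    (p : {path I from y to z in T}) : path_rev g ** (g ** p) ~~ p.
Proof. by rewrite path_catA path_cat_revl path_cat1p; reflexivity. Qed.

Context (x y : T) (g : {path I from x to y in T}).

Definition conj_path (p : {path I from y to y in T}) : {path I from x to x in T} :=
  g ** (p ** path_rev g).

Lemma conj_pathM p q : conj_path (p ** q) ~~ conj_path p ** conj_path q.
Proof.
rewrite /conj_path -!path_catA path_catKV.
reflexivity.
Qed.

(** Conjugation by the reverse path undoes conjugation by g. *)
Lemma conj_path_inj p q : conj_path p ~~ conj_path q -> p ~~ q.
Proof.
have K u : path_rev g ** (conj_path u ** g) ~~ u.
  rewrite /conj_path -!path_catA path_catKV path_cat_revl path_catp1.
  reflexivity.
by move=> pq; rewrite -(K p) -(K q) pq; reflexivity.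
Qed.

Definition change_base (a : pi1 R y) : pi1 R x := pi1_class (conj_path (repr a)).

Lemma change_baseM : {morph change_base : a b / (a * b)%g >-> (a * b)%g}.
Proof.
move=> a b; rewrite /change_base [RHS]pi1_mul_class; apply/pi1_classP.
rewrite -conj_pathM /conj_path; apply: path_homotopic_cat; first reflexivity.
by apply: path_homotopic_cat; [exact: pi1_repr_class|reflexivity].
Qed.

Lemma change_base_inj : injective change_base.
Proof.
move=> a b /pi1_classP/conj_path_inj/pi1_classP.
by rewrite !pi1_class_repr.
Qed.

Lemma residually_free_change_base :
  residually_free (pi1 R x) -> residually_free (pi1 R y).
Proof.
pose f : {multiplicative pi1 R y -> pi1 R x} := HB.pack change_base
  (isMultiplicative.Build _ _ _ change_baseM).
exact: (residually_free_inj (f := f) change_base_inj).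
Qed.
End BasePointChange.

(** * Path connectedness of the complement *)

Section Complement.
Context {R : realType} (r n : nat).
Local Notation C := (R[i] : numClosedFieldType).
Local Notation I := (itv01 R).
Local Notation M := (monomial_complement R r n).

Lemma row_continuous (X : topologicalType) (m : nat) (f : X -> 'I_m -> C) :
  (forall j, continuous (fun x => f x j)) ->
  continuous (fun x => \row_j f x j : 'rV[C]_m).
Proof.
move=> cf x A [P nP PA].
have : \forall u \near x, forall j, P ord0 j (f u j).
  apply: filter_forall => j; apply: (cf j x); have := nP ord0 j.
  by rewrite mxE.
apply: filterS => u Pu; apply: PA => i j; rewrite mxE ord1; exact: Pu.
Qed.

Lemma complement_continuous (X : topologicalType) (f : X -> M) :
  continuous (fun x => val (f x) : 'rV[C]_n) -> continuous f.
Proof. by move=> cf; exact: continuous_comp_initial. Qed.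

Lemma val_complement_continuous : continuous (fun x : M => val x : 'rV[C]_n).
Proof. exact: initial_continuous. Qed.

Lemma complementP (v : 'rV[C]_n) : monomial_Q r v != 0 -> v \in monomial_complement R r n.
Proof. by move=> v0; rewrite inE; exact/eqP. Qed.

Lemma complement_neq0 (x : M) : monomial_Q r (val x) != 0.
Proof. by case: x => v /=; rewrite inE => /eqP. Qed.

Lemma complement_entry (x : M) i : (val x : 'rV[C]_n) ord0 i != 0.
Proof.
have := complement_neq0 x; rewrite /monomial_Q mulf_eq0 negb_or => /andP[+ _].
by move/prodf_neq0 => /(_ i isT).
Qed.

Lemma complement_pow (x : M) (i j : 'I_n) : (i < j)%N ->
  (val x : 'rV[C]_n) ord0 i ^+ r != (val x : 'rV[C]_n) ord0 j ^+ r.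
Proof.
move=> ij; have := complement_neq0 x; rewrite /monomial_Q mulf_eq0 negb_or.
move=> /andP[_ /prodf_neq0 /(_ i isT) /prodf_neq0 /(_ j ij)].
by rewrite subr_eq0.
Qed.

Lemma complement_distinct (x : M) (i j : 'I_n) : (i < j)%N ->
  (val x : 'rV[C]_n) ord0 i != (val x : 'rV[C]_n) ord0 j.
Proof. by move=> /(complement_pow x); apply: contraNneq => ->. Qed.

Lemma logistic_continuous (X : topologicalType) (u : X -> R) :
  continuous u -> continuous (fun x => u x * (1 - u x)).
Proof.
move=> cu x; apply: cvgM; first exact: cu.
by apply: cvgB; [exact: cvg_cst|exact: cu].
Qed.

(** The line through x and y meets the arrangement at the zeros of a nonzero
polynomial in the parameter t of the line.  The curves [t + i s t (1 - t)], for real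
s, join 0 to 1 and share no other points, so all but finitely many of them avoid
these zeros. *)
Lemma complement_path (x y : M) : inhabited {path I from x to y in M}.
Proof.
pose d (j : 'I_n) : C := (val y : 'rV[C]_n) ord0 j - (val x : 'rV[C]_n) ord0 j.
pose l (t : C) : 'rV[C]_n := \row_j ((val x : 'rV[C]_n) ord0 j + t * d j).
pose L (j : 'I_n) : {poly C} := ((val x : 'rV[C]_n) ord0 j)%:P + (d j)%:P * 'X.
have LE j t : (L j).[t] = l t ord0 j by rewrite /L !hornerE mxE mulrC.
pose q : {poly C} := (\prod_(i < n) L i) *
  \prod_(i < n) \prod_(j < n | (i < j)%N) (L i ^+ r - L j ^+ r).
have qE t : q.[t] = monomial_Q r (l t).
  rewrite /q hornerM !horner_prod /monomial_Q; congr (_ * _).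
    by apply: eq_bigr => i _; exact: LE.
  apply: eq_bigr => i _; rewrite horner_prod; apply: eq_bigr => j _.
  by rewrite hornerD hornerN !horner_exp !LE.
have l0 : l 0 = val x by apply/rowP => j; rewrite mxE mul0r addr0.
have l1 : l 1 = val y.
  by apply/rowP => j; rewrite mxE mul1r /d addrC subrK.
have q0 : q != 0.
  by apply: contraNneq (complement_neq0 x) => q0; rewrite -l0 -qE q0 horner0.
have [zs zsE] := closed_field_poly_normal q.
pose slope (z : C) : R := `|complex.Im z / (complex.Re z * (1 - complex.Re z))|.
(* The curve through z has parameter slope z up to sign, and s exceeds all of
   these. *)
pose s : R := 1 + \sum_(z <- zs) slope z.
pose tau (t : I) : C := val t +i* (s * (val t * (1 - val t))).
have avoid t : monomial_Q r (l (tau t)) != 0.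
  have /andP[t0 t1] := itv01_bounds t.
  have [tz|t_gt0] := eqVneq (val t) 0.
    have -> : tau t = 0 by rewrite /tau tz mul0r mulr0.
    by rewrite l0; exact: complement_neq0.
  have [tE|t_lt1] := eqVneq (val t) 1.
    have -> : tau t = 1 by rewrite /tau tE subrr !mulr0.
    by rewrite l1; exact: complement_neq0.
  rewrite -qE; apply/negP => /eqP qt.
  have tz : tau t \in zs.
    have : root q (tau t) by rewrite /root qt.
    by rewrite zsE rootZ ?lead_coef_eq0 // root_prod_XsubC.
  have : slope (tau t) <= \sum_(z <- zs) slope z.
    rewrite (big_rem _ tz) /= lerDl; apply: sumr_ge0 => z _; exact: normr_ge0.
  have -> : slope (tau t) = `|s|.
    rewrite /slope /= mulfK // mulf_neq0 //.
    by rewrite subr_eq0 eq_sym.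
  have s_gt : \sum_(z <- zs) slope z < `|s|.
    by apply: (lt_le_trans _ (ler_norm s)); rewrite /s ltrDr ltr01.
  by move=> /(lt_le_trans s_gt); rewrite ltxx.
pose p t : M := exist _ (l (tau t)) (complementP (avoid t)).
have ctau : continuous tau.
  have -> : tau = (fun t => (val t)%:C + 'i%C * (s * (val t * (1 - val t)))%:C).
    by apply/funext => t; rewrite [LHS]complexE.
  have c1 := @val01_continuous R.
  apply: cadd_continuous; first exact: creal_continuous.
  apply: constM_continuous; apply: creal_continuous; apply: scale_continuous.
  by apply: logistic_continuous; exact: c1.
have cp : continuous p.
  apply: complement_continuous; apply: row_continuous => j.
  apply: cadd_continuous; first exact: cst_continuous.
  by apply: cmul_continuous; [exact: ctau|exact: cst_continuous].
have p0 : p zero = x.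
  apply/val_inj; rewrite -l0 /=; congr l; rewrite /tau val_zero01.
  by rewrite mul0r mulr0.
have p1 : p one = y.
  apply/val_inj; rewrite -l1 /=; congr l; rewrite /tau val_one01.
  by rewrite subrr !mulr0.
by constructor; exact: (mk_path cp p0 p1).
Qed.

End Complement.

(** * Powers of points close to 1 *)

Section RootsOfUnity.
Context {R : realType}.
Local Notation C := (R[i] : numClosedFieldType).

(** If q is not 1, its powers below r add up to 0, so that the r numbers
[1 - q ^+ i] add up to r, although each has modulus at most [r * `|q - 1|], which is
smaller than 1. *)
Lemma root_unity_near1 (r : nat) (q : C) : (0 < r)%N -> q ^+ r = 1 ->
  r%:R * `|q - 1| < 1 -> q = 1.
Proof.
move=> r0 qr small; apply/eqP; rewrite -subr_eq0; apply: contraTT small => q1.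
have norm_q : `|q| = 1.
  by apply/eqP; rewrite -(@pexpr_eq1 _ _ r) ?normr_ge0 // -normrX qr normr1.
have : (q - 1) * (\sum_(i < r) q ^+ i) = 0 by rewrite -subrX1 qr subrr.
move/eqP; rewrite mulf_eq0 (negPf q1) /= => /eqP sum0.
have pow_near k : `|1 - q ^+ k| <= k%:R * `|q - 1|.
  elim: k => [|k IH]; first by rewrite expr0 subrr normr0 mul0r.
  have -> : 1 - q ^+ k.+1 = (1 - q) + q * (1 - q ^+ k) by rewrite exprS; ring.
  apply: (le_trans (ler_normD _ _)); rewrite normrM norm_q mul1r distrC.
  by rewrite -natr1 mulrDl mul1r addrC lerD2r.
have : `|\sum_(i < r) (1 - q ^+ i)| = r%:R.
  by rewrite big_split /= sumrN sum0 subr0 sumr_const card_ord normr_nat.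
have : `|\sum_(i < r) (1 - q ^+ i)| <= r%:R * (r%:R * `|q - 1|).
  apply: (le_trans (ler_norm_sum _ _ _)).
  have -> : r%:R * (r%:R * `|q - 1|) = \sum_(i < r) (r%:R * `|q - 1|).
    by rewrite sumr_const card_ord [LHS]mulr_natl.
  apply: ler_sum => i _.
  apply: (le_trans (pow_near i)); rewrite ler_wpM2r ?normr_ge0 // ler_nat.
  exact: ltnW.
move=> + E; rewrite {}E -{1}[r%:R]mulr1 ler_pM2l ?ltr0n // => h.
by apply/negP => /(le_lt_trans h); rewrite ltxx.
Qed.

(** If the powers agreed, z / w would be a root of unity close to 1. *)
Lemma near1_pow_neq (r : nat) (k : R) (z w : C) : (0 < r)%N ->
  r%:R * (2 * k) + k < 1 -> `|z - 1| <= k%:C -> `|w - 1| <= k%:C ->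
  z != w -> z ^+ r != w ^+ r.
Proof.
move=> r0 small zk wk zw; have k0 : 0 <= k.
  by rewrite -lecR; exact: le_trans (normr_ge0 _) zk.
have w1 : (1 - k)%:C <= `|w|.
  rewrite rmorphB rmorph1 lerBlDr; apply: (le_trans _ (_ : `|w| + `|1 - w| <= _)).
    by apply: le_trans (ler_normD _ _); rewrite addrC subrK normr1.
  by rewrite lerD2l distrC.
have r1 : 0 <= r%:R * (2 * k) by rewrite mulr_ge0 ?ler0n // mulr_ge0.
have w0 : w != 0.
  rewrite -normr_gt0; apply: lt_le_trans w1; rewrite ltcR; lra.
apply: contraNneq zw => zwr; rewrite -[z](divfK w0).
rewrite (@root_unity_near1 r (z / w)) ?mul1r //.
  by rewrite expr_div_n zwr divff // expf_neq0.
have -> : z / w - 1 = (z - w) / w by rewrite mulrBl divff.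
rewrite normrM normfV mulrA ltr_pdivrMr ?normr_gt0 // mul1r.
apply: lt_le_trans w1; apply: (@le_lt_trans _ _ (r%:R * (2 * k))%:C).
  rewrite rmorphM rmorph_nat ler_wpM2l ?ler0n //.
  have -> : z - w = (z - 1) - (w - 1) by ring.
  apply: (le_trans (ler_normB _ _)); rewrite mulr_natl mulr2n rmorphD.
  exact: lerD.
rewrite ltcR; lra.
Qed.

End RootsOfUnity.

(** * Tori in the complement of the arrangement *)

Section Loops.
Context {R : realType} (r n : nat) (r_gt0 : (1 <= r)%N) (n_ge3 : (3 <= n)%N).
Local Notation C := (R[i] : numClosedFieldType).
Local Notation I := (itv01 R).
Local Notation M := (monomial_complement R r n).
Local Notation C3 := (C * C * C)%type.

(** This size makes [near1_pow_neq] available on the disc of radius 2 eps around 1,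
since r (4 eps) + 2 eps is at most 6 / 10. *)
Definition eps : R := (10 * r%:R)^-1.

Lemma eps_r : 10 * (r%:R * eps) = 1.
Proof.
by rewrite mulrA /eps divff // mulf_neq0 ?pnatr_eq0 // -lt0n.
Qed.

Lemma eps_gt0 : 0 < eps.
Proof. by rewrite invr_gt0 mulr_gt0 // ltr0n. Qed.

Lemma eps_small : 5 * eps < 1.
Proof.
have e0 := eps_gt0; have r1 : 1 <= r%:R :> R by rewrite ler1n.
have e1 := eps_r; have : 0 <= eps * (r%:R - 1) by rewrite mulr_ge0 ?subr_ge0 // ltW.
lra.
Qed.

(** The other coordinates rest at the integers 3, 4, and so on, out of reach of the
first three, whose moduli stay below 3. *)
Definition extend (z : C3) : 'rV[C]_n :=
  \row_j (if val j == 0%N then z.1.1 else if val j == 1%N then z.1.2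
          else if val j == 2%N then z.2 else (val j)%:R).

Definition admissible (z : C3) : Prop :=
  [/\ z.1.1 != 0, z.1.2 != 0 & z.2 != 0] /\
  [/\ z.1.1 ^+ r != z.1.2 ^+ r, z.1.1 ^+ r != z.2 ^+ r & z.1.2 ^+ r != z.2 ^+ r] /\
  [/\ `|z.1.1| < 3, `|z.1.2| < 3 & `|z.2| < 3].

Lemma extend_complement z : admissible z -> monomial_Q r (extend z) != 0.
Proof.
move=> [[z1 z2 z3] [[z12 z13 z23] [n1 n2 n3]]].
have big (w : C) (j : nat) : `|w| < 3 -> (3 <= j)%N -> w ^+ r != j%:R ^+ r.
  move=> w3 j3; apply/eqP => /(congr1 Num.norm); rewrite !normrX normr_nat => /eqP.
  rewrite eqrXn2 ?normr_ge0 ?ler0n // lt_eqF //.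
  by apply: (lt_le_trans w3); rewrite ler_nat.
have large (i : 'I_n) : (3 <= i)%N -> extend z ord0 i = (val i)%:R.
  by move=> i3; rewrite mxE; case: i i3 => -[|[|[|i]]].
have small (i : 'I_n) : (i < 3)%N -> [\/ val i = 0%N /\ extend z ord0 i = z.1.1,
    val i = 1%N /\ extend z ord0 i = z.1.2 | val i = 2%N /\ extend z ord0 i = z.2].
  move=> i3; rewrite mxE.
  by case: i i3 => -[|[|[|i]]] //= _ _;
    [constructor 1|constructor 2|constructor 3].
rewrite mulf_neq0 //; apply/prodf_neq0 => i _.
  case: (ltnP i 3) => [/small[] [_ ->] //|i3].
  by rewrite large // pnatr_eq0 -lt0n (leq_trans _ i3).
apply/prodf_neq0 => j ij; rewrite subr_eq0.
case: (ltnP j 3) => [j3|j3]; last first.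
  rewrite (large j) //; case: (ltnP i 3) => [/small[] [_ ->]|i3]; try exact: big.
  by rewrite large // eqrXn2 ?ler0n // eqr_nat ltn_eqF.
have si := small i (ltn_trans ij j3).
by case: (small j j3) => -[jE ->]; case: si => -[iE ->]; rewrite iE jE in ij;
  try discriminate ij; [exact: z12|exact: z13|exact: z23].
Qed.

Definition base_triple : C3 := (pt1 eps, pt2 eps, (1 - 2 * eps)%:C).

Definition rot (x : R) : C := expi (2 * pi * x).

(** The first parameter makes z1 and z2 rotate around their midpoint 1, which is the
loop A, and the second one moves z3 along the orbit s, a or b.  In [torus_Tb] the
point z3 takes part in the rotation, so that the first parameter describes the
rigid rotation of all three points, which is the diagonal of [torus_As]. *)
Definition torus_As (st : R * R) : C3 :=
  (1 - eps%:C * rot st.1, 1 + eps%:C * rot st.1, 1 - (2 * eps)%:C * rot st.2).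
Definition torus_Aa (st : R * R) : C3 :=
  (1 - eps%:C * rot st.1, 1 + eps%:C * rot st.1, (1 - 2 * eps)%:C * rot st.2).
Definition torus_Tb (st : R * R) : C3 :=
  (1 - eps%:C * rot st.1, 1 + eps%:C * rot st.1,
   1 - rot st.1 * (eps%:C + eps%:C * rot st.2)).

Lemma rot_norm x : `|rot x| = 1. Proof. exact: expi_norm. Qed.
Lemma rot_neq0 x : rot x != 0. Proof. exact: expi_neq0. Qed.
Lemma rot0 : rot 0 = 1. Proof. by rewrite /rot mulr0 expi0. Qed.
Lemma rot1 : rot 1 = 1. Proof. by rewrite /rot mulr1 expi_2pi. Qed.

Lemma near1_bounds (k : R) (z : C) : `|z - 1| <= k%:C -> k < 1 ->
  z != 0 /\ `|z| < 3.
Proof.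
move=> zk k1; split.
  apply/eqP => z0; move: zk; rewrite z0 sub0r normrN normr1.
  by rewrite -[1]/((1 : R)%:C) lecR leNgt k1.
rewrite -[z](subrK 1); apply: (le_lt_trans (ler_normD _ _)); rewrite normr1.
apply: (@le_lt_trans _ _ (k%:C + 1)); first by rewrite lerD2r.
by rewrite -[1]/((1 : R)%:C) -rmorphD -(natC 3) ltcR /=; lra.
Qed.

Lemma admissible_near1 (z : C3) :
  `|z.1.1 - 1| <= (2 * eps)%:C -> `|z.1.2 - 1| <= (2 * eps)%:C ->
  `|z.2 - 1| <= (2 * eps)%:C ->
  z.1.1 != z.1.2 -> z.1.1 != z.2 -> z.1.2 != z.2 -> admissible z.
Proof.
move=> h1 h2 h3 n12 n13 n23.
have e1 := eps_r; have e0 := eps_gt0; have e5 := eps_small.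
have e2 : 2 * eps < 1 by lra.
have small : r%:R * (2 * (2 * eps)) + 2 * eps < 1 by lra.
have [b1 c1] := near1_bounds h1 e2; have [b2 c2] := near1_bounds h2 e2.
have [b3 c3] := near1_bounds h3 e2; split=> //; split=> //; split.
- exact: near1_pow_neq r_gt0 small h1 h2 n12.
- exact: near1_pow_neq r_gt0 small h1 h3 n13.
- exact: near1_pow_neq r_gt0 small h2 h3 n23.
Qed.

Lemma norm_realM_rot (k : R) x : 0 <= k -> `|k%:C * rot x : C| = k%:C.
Proof. by move=> k0; rewrite normrM rot_norm mulr1 norm_real. Qed.

Lemma pair_near x :
  `|1 - eps%:C * rot x - 1 : C| <= (2 * eps)%:C /\
  `|1 + eps%:C * rot x - 1 : C| <= (2 * eps)%:C /\
  1 - eps%:C * rot x != 1 + eps%:C * rot x :> C.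
Proof.
have e0 := eps_gt0; have e1 : eps <= 2 * eps by lra.
split; first by rewrite addrAC subrr sub0r normrN (norm_realM_rot _ (ltW e0)) lecR.
split; first by rewrite addrAC subrr add0r (norm_realM_rot _ (ltW e0)) lecR.
rewrite -subr_eq0.
have -> : 1 - eps%:C * rot x - (1 + eps%:C * rot x) = - (2 * eps)%:C * rot x.
  by rewrite rmorphM /= natC; ring.
by rewrite mulf_neq0 ?rot_neq0 // oppr_eq0 real_neq0 // mulr_gt0.
Qed.

Lemma torus_As_admissible st : admissible (torus_As st).
Proof.
have e0 := eps_gt0; have [h1 [h2 h12]] := pair_near st.1.
have e2 : 0 <= 2 * eps by lra.
have far (u : C) : `|u| = eps%:C -> 1 - u != 1 - (2 * eps)%:C * rot st.2.
  move=> ue; rewrite -subr_eq0.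
  have -> : 1 - u - (1 - (2 * eps)%:C * rot st.2) = (2 * eps)%:C * rot st.2 - u by ring.
  rewrite subr_eq0; apply/eqP => /(congr1 Num.norm); rewrite norm_realM_rot // ue.
  by move/complexI; lra.
apply: admissible_near1 => //=.
- by rewrite addrAC subrr sub0r normrN norm_realM_rot.
- by apply: far; rewrite norm_realM_rot // ltW.
- have -> : 1 + eps%:C * rot st.1 = 1 - (- (eps%:C * rot st.1)) by rewrite opprK.
  by apply: far; rewrite normrN norm_realM_rot // ltW.
Qed.

Lemma torus_Tb_admissible st : admissible (torus_Tb st).
Proof.
have e0 := eps_gt0; have [h1 [h2 h12]] := pair_near st.1.
apply: admissible_near1 => //=.
- rewrite addrAC subrr sub0r normrN normrM rot_norm mul1r.
  apply: (le_trans (ler_normD _ _)).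
  rewrite (norm_realM_rot _ (ltW e0)) (norm_real (ltW e0)).
  by rewrite -rmorphD lecR /=; lra.
- rewrite -subr_eq0.
  have -> : 1 - eps%:C * rot st.1 - (1 - rot st.1 * (eps%:C + eps%:C * rot st.2))
     = rot st.1 * (eps%:C * rot st.2) by ring.
  by rewrite !mulf_neq0 ?rot_neq0 // real_neq0.
- rewrite -subr_eq0.
  have -> : 1 + eps%:C * rot st.1 - (1 - rot st.1 * (eps%:C + eps%:C * rot st.2))
     = rot st.1 * eps%:C * (2 + rot st.2) by ring.
  rewrite !mulf_neq0 ?rot_neq0 ?real_neq0 //.
  apply/eqP => /eqP; rewrite addr_eq0 => /eqP /(congr1 Num.norm).
  by rewrite normrN rot_norm normr_nat => /eqP; rewrite pnatr_eq1.
Qed.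

Lemma torus_Aa_admissible st : admissible (torus_Aa st).
Proof.
have e0 := eps_gt0; have e5 := eps_small; have e1 := eps_r.
have [h1 [h2 h12]] := pair_near st.1.
have e2 : 2 * eps < 1 by lra.
have small : r%:R * (2 * (2 * eps)) + 2 * eps < 1 by lra.
have [b1 c1] := near1_bounds h1 e2; have [b2 c2] := near1_bounds h2 e2.
have n3 : `|(1 - 2 * eps)%:C * rot st.2 : C| = (1 - 2 * eps)%:C.
  by rewrite norm_realM_rot //; lra.
have far (u : C) : `|u| = eps%:C -> (1 - u) ^+ r != ((1 - 2 * eps)%:C * rot st.2) ^+ r.
  move=> ue; apply/eqP => /(congr1 Num.norm)/eqP; rewrite !normrX.
  rewrite eqrXn2 ?normr_ge0 // n3 gt_eqF //.
  have : 1 - eps%:C <= `|1 - u|.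
    rewrite -ue lerBlDr; apply: le_trans (ler_normD _ _); by rewrite subrK normr1.
  have -> : 1 - eps%:C = (1 - eps)%:C :> C by rewrite rmorphB rmorph1.
  by apply: lt_le_trans; rewrite ltcR; lra.
split; [|split].
- split=> //=; rewrite mulf_neq0 ?rot_neq0 // real_neq0 //; lra.
- split=> /=.
  + exact: near1_pow_neq r_gt0 small h1 h2 h12.
  + by apply: far; rewrite norm_realM_rot // ltW.
  + have -> : 1 + eps%:C * rot st.1 = 1 - (- (eps%:C * rot st.1)) by rewrite opprK.
    by apply: far; rewrite normrN norm_realM_rot // ltW.
- split=> //=; rewrite n3 -(natC 3) ltcR; lra.
Qed.

Lemma rot_continuous (X : topologicalType) (u : X -> R) :
  continuous u -> continuous (fun x => rot (u x)).
Proof. by move=> cu; apply: expi_continuous; exact: scale_continuous. Qed.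

Lemma base_row : monomial_Q r (extend base_triple) != 0.
Proof.
have := extend_complement (torus_As_admissible (0, 0)).
by rewrite /torus_As rot0 !mulr1 /base_triple /pt1 /pt2 rmorphB rmorph1.
Qed.
Definition base_point : M := exist _ (extend base_triple) (complementP base_row).

(** Total, with the base point as default, so that it can be composed with any family
of triples that happens to be admissible. *)
Definition to_complement (z : C3) : M :=
  match pselect (admissible z) with
  | left h => exist _ (extend z) (complementP (extend_complement h))
  | right _ => base_point
  end.

Lemma val_to_complement z : admissible z -> val (to_complement z) = extend z.
Proof. by move=> az; rewrite /to_complement; case: pselect. Qed.

Lemma to_complement_continuous (X : topologicalType) (f : X -> C3) :
  continuous f -> (forall x, admissible (f x)) ->
  continuous (fun x => to_complement (f x)).
Proof.
move=> cf af; apply: complement_continuous.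
have -> : (fun x => val (to_complement (f x)) : 'rV[C]_n) = (fun x => extend (f x)).
  by apply/funext => x; rewrite val_to_complement.
have [c1 c2 c3] := triple_coords_continuous cf.
apply: row_continuous => j.
case: (val j == 0%N); first exact: c1.
case: (val j == 1%N); first exact: c2.
by case: (val j == 2%N); [exact: c3|exact: cst_continuous].
Qed.

Lemma ord_lt k : (k < 3)%N -> (k < n)%N.
Proof. by move=> k3; exact: leq_trans k3 n_ge3. Qed.

Definition coords (x : M) : C3 :=
  ((val x : 'rV[C]_n) ord0 (Ordinal (ord_lt (isT : 0 < 3)%N)),
   (val x : 'rV[C]_n) ord0 (Ordinal (ord_lt (isT : 1 < 3)%N)),
   (val x : 'rV[C]_n) ord0 (Ordinal (ord_lt (isT : 2 < 3)%N))).

Lemma coords_continuous : continuous coords.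
Proof.
have cE j : continuous (fun x : M => (val x : 'rV[C]_n) ord0 j).
  apply: (@comp_continuous _ _ _ (fun v : 'rV[C]_n => v ord0 j)).
    exact: coord_continuous.
  exact: val_complement_continuous.
by apply: triple_continuous; exact: cE.
Qed.

Lemma coords_distinct x : distinct4 (coords x).
Proof.
split=> /=; rewrite ?complement_entry //.
by split; rewrite subr_eq0; [|rewrite eq_sym|rewrite eq_sym];
  exact: complement_distinct.
Qed.

Lemma coordsK z : admissible z -> coords (to_complement z) = z.
Proof.
by move=> az; rewrite /coords val_to_complement // !mxE /=; case: z {az} => -[].
Qed.

Local Notation loop := {path I from base_point to base_point in M}.

Lemma loop_exists (f : I -> C3) : continuous f -> (forall t, admissible (f t)) ->
  f zero = base_triple -> f one = base_triple ->
  exists p : loop, forall t, p t = to_complement (f t).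
Proof.
move=> cf af f0 f1; have cp := to_complement_continuous cf af.
have bE : to_complement base_triple = base_point.
  by apply/val_inj; rewrite val_to_complement // -f0.
have p0 : to_complement (f zero) = base_point by rewrite f0.
have p1 : to_complement (f one) = base_point by rewrite f1.
by exists (mk_path cp p0 p1).
Qed.

Lemma torus_continuous :
  [/\ continuous torus_As, continuous torus_Aa & continuous torus_Tb].
Proof.
have c1 : continuous (fun st : R * R => rot st.1).
  by apply: rot_continuous; exact: fst_continuous.
have c2 : continuous (fun st : R * R => rot st.2).
  by apply: rot_continuous; exact: snd_continuous.
have k (X : topologicalType) (c : C) (f : X -> C) : continuous f ->
    continuous (fun x => c * f x : C).
  by move=> cf; apply: cmul_continuous; [exact: cst_continuous|exact: cf].
have a (X : topologicalType) (c : C) (f : X -> C) : continuous f ->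
    continuous (fun x => c + f x : C).
  by move=> cf; apply: cadd_continuous; [exact: cst_continuous|exact: cf].
have b (X : topologicalType) (c : C) (f : X -> C) : continuous f ->
    continuous (fun x => c - f x : C).
  by move=> cf; apply: csub_continuous; [exact: cst_continuous|exact: cf].
have z1 : continuous (fun st : R * R => 1 - eps%:C * rot st.1 : C).
  by apply: b; apply: k; exact: c1.
have z2 : continuous (fun st : R * R => 1 + eps%:C * rot st.1 : C).
  by apply: a; apply: k; exact: c1.
split; (apply: triple_continuous; [exact: z1|exact: z2|]).
- by apply: b; apply: k; exact: c2.
- by apply: k; exact: c2.
apply: b; apply: cmul_continuous; first exact: c1.
by apply: a; apply: k; exact: c2.
Qed.

Lemma rot_circ (t : I) : rot (val t) = circ t. Proof. by []. Qed.

Lemma orbit_config_a t : orbit_config eps (orbit_a eps) t = torus_Aa (0, val t).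
Proof. by rewrite /torus_Aa rot0 !mulr1. Qed.
Lemma orbit_config_s t : orbit_config eps (orbit_s eps) t = torus_As (0, val t).
Proof.
rewrite /torus_As rot0 !mulr1 /orbit_config /orbit_s rot_circ.
by rewrite rmorphM /= natC.
Qed.
Lemma orbit_config_b t : orbit_config eps (orbit_b eps) t = torus_Tb (0, val t).
Proof.
rewrite /torus_Tb rot0 !mulr1 mul1r /orbit_config /orbit_b rot_circ.
by rewrite opprD addrA.
Qed.

Lemma torus_period :
  [/\ forall t, torus_As (1, t) = torus_As (0, t),
      forall s, torus_As (s, 1) = torus_As (s, 0),
      forall t, torus_Aa (1, t) = torus_Aa (0, t),
      forall s, torus_Aa (s, 1) = torus_Aa (s, 0) &
      (forall t, torus_Tb (1, t) = torus_Tb (0, t)) /\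
      forall s, torus_Tb (s, 1) = torus_Tb (s, 0)].
Proof.
by rewrite /torus_As /torus_Aa /torus_Tb; split=> [t|t|t|t|]; [| | | |split=> t];
  rewrite /= ?rot0 ?rot1.
Qed.

Lemma base_As : torus_As (0, 0) = base_triple.
Proof. by rewrite /torus_As /= rot0 !mulr1 /base_triple rmorphB rmorph1. Qed.
Lemma base_Aa : torus_Aa (0, 0) = base_triple.
Proof. by rewrite /torus_Aa rot0 !mulr1. Qed.
Lemma base_Tb : torus_Tb (0, 0) = base_triple.
Proof.
rewrite /torus_Tb /= rot0 !mulr1 mul1r /base_triple rmorphB rmorphM /= natC.
by rewrite rmorph1; congr (_, _, _); ring.
Qed.

Lemma torus_loop1 (Phi : R * R -> C3) : continuous Phi ->
  (forall st, admissible (Phi st)) -> Phi (0, 0) = base_triple ->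
  (forall t, Phi (1, t) = Phi (0, t)) ->
  exists p : loop, forall t, p t = to_complement (Phi (val t, 0)).
Proof.
move=> cPhi aPhi P0 P1; apply: (loop_exists (f := fun t => Phi (val t, 0))) => //.
- apply: comp_continuous; first exact: cPhi.
  by apply: pair_continuous; [exact: val01_continuous|exact: cst_continuous].
- by rewrite val_zero01.
- by rewrite val_one01 P1.
Qed.

Lemma torus_loop2 (Phi : R * R -> C3) : continuous Phi ->
  (forall st, admissible (Phi st)) -> Phi (0, 0) = base_triple ->
  (forall s, Phi (s, 1) = Phi (s, 0)) ->
  exists p : loop, forall t, p t = to_complement (Phi (0, val t)).
Proof.
move=> cPhi aPhi P0 P1; apply: (loop_exists (f := fun t => Phi (0, val t))) => //.
- apply: comp_continuous; first exact: cPhi.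
  by apply: pair_continuous; [exact: cst_continuous|exact: val01_continuous].
- by rewrite val_zero01.
- by rewrite val_one01 P1.
Qed.

(** Each commutation relation is read off a torus.  A homotopy between the two
products of u and v would yield, by its first three coordinates, the homotopy
excluded by [no_commuting_homotopy]. *)
Lemma base_point_not_residually_free : ~ residually_free (pi1 R base_point).
Proof.
have [cAs cAa cTb] := torus_continuous.
have [As1 As2 Aa1 Aa2 [Tb1 Tb2]] := torus_period.
have [pA pAE] := torus_loop1 cAs torus_As_admissible base_As As1.
have [ps psE] := torus_loop2 cAs torus_As_admissible base_As As2.
have [pa paE] := torus_loop2 cAa torus_Aa_admissible base_Aa Aa2.
have [pb pbE] := torus_loop2 cTb torus_Tb_admissible base_Tb Tb2.
have [pT pTE] := torus_loop1 cTb torus_Tb_admissible base_Tb Tb1.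
have M_As := to_complement_continuous cAs torus_As_admissible.
have M_Aa := to_complement_continuous cAa torus_Aa_admissible.
have M_Tb := to_complement_continuous cTb torus_Tb_admissible.
have As_Aa u : torus_As (u, 0) = torus_Aa (u, 0).
  by rewrite /torus_As /torus_Aa /= rot0 !mulr1 rmorphB rmorph1.
(* On the diagonal of the torus, z1, z2 and z3 rotate together. *)
have As_Tb u : torus_As (u, u) = torus_Tb (u, 0).
  rewrite /torus_As /torus_Tb /= rot0; congr (_, _, _).
  by rewrite rmorphM /= natC; ring.
have commAs : path_homotopic (path_cat pA ps) (path_cat ps pA).
  apply: (torus_commute M_As); [exact: pAE|exact: psE| |].
    by move=> t; rewrite As1.
  by move=> u; rewrite As2.
have commAa : path_homotopic (path_cat pA pa) (path_cat pa pA).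
  apply: (torus_commute M_Aa); [|exact: paE| |].
  - by move=> t; rewrite pAE As_Aa.
  - by move=> t; rewrite Aa1.
  - by move=> u; rewrite Aa2.
have commTb : path_homotopic (path_cat pT pb) (path_cat pb pT).
  apply: (torus_commute M_Tb); [exact: pTE|exact: pbE| |].
    by move=> t; rewrite Tb1.
  by move=> u; rewrite Tb2.
have AsT : path_homotopic (path_cat pA ps) pT.
  apply: (torus_diagonal M_As); [exact: pAE|exact: psE| |].
    by move=> t; rewrite As1.
  by move=> t; rewrite pTE As_Tb.
pose cl := @pi1_class R M base_point.
have clM p q : (cl p * cl q)%g = cl (path_cat p q) by exact: pi1_mul_class.
have clV p : ((cl p)^-1)%g = cl (path_rev p) by exact: pi1_inv_class.
have clE p q : path_homotopic p q -> cl p = cl q by move=> /pi1_classP.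
have gAs : (cl pA * cl ps = cl ps * cl pA)%g by rewrite !clM; exact: clE.
have gAa : (cl pA * cl pa = cl pa * cl pA)%g by rewrite !clM; exact: clE.
have gTb : (cl pA * cl ps * cl pb = cl pb * (cl pA * cl ps))%g.
  have -> : (cl pA * cl ps)%g = cl pT by rewrite clM; exact: clE.
  by rewrite !clM; exact: clE.
apply: (not_residually_free_of gAs gAa gTb).
pose u := (cl pb * cl ps / (cl ps * cl pb))%g.
pose v := (cl pa * cl ps / (cl ps * cl pa))%g.
suff : (u * v <> v * u)%g by [].
rewrite /u /v (clM pb ps) (clM ps pb) (clM pa ps) (clM ps pa) !clV.
rewrite (clM _ (path_rev _)) (clM (path_cat pa ps)) !clM => /pi1_classP[H [cH H0 H1 Hx Hy]].
have cK : continuous (fun st => coords (H st)).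
  by apply: comp_continuous; [exact: coords_continuous|exact: cH].
have [e0 e5] := (eps_gt0, eps_small).
have sE t : coords (ps t) = orbit_config eps (orbit_s eps) t.
  by rewrite psE coordsK; [rewrite -orbit_config_s|exact: torus_As_admissible].
have aE t : coords (pa t) = orbit_config eps (orbit_a eps) t.
  by rewrite paE coordsK; [rewrite -orbit_config_a|exact: torus_Aa_admissible].
have bE t : coords (pb t) = orbit_config eps (orbit_b eps) t.
  by rewrite pbE coordsK; [rewrite -orbit_config_b|exact: torus_Tb_admissible].
have base : coords base_point = config (base_lift eps).
  have <- : ps zero = base_point by exact: path_zero.
  by rewrite sE -lift_s0 (lifts_config _ (lifts_s e0 e5)).
have word (p q p' q' : loop) (Zp Zq Zp' Zq' : I -> C) :
    (forall t, coords (p t) = orbit_config eps Zp t) ->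
    (forall t, coords (q t) = orbit_config eps Zq t) ->
    (forall t, coords (p' t) = orbit_config eps Zp' t) ->
    (forall t, coords (q' t) = orbit_config eps Zq' t) ->
    coords \o path_cat (path_cat p q) (path_rev (path_cat p' q')) =
    quotient_word (orbit_config eps Zp) (orbit_config eps Zq)
      (orbit_config eps Zp') (orbit_config eps Zq').
  move=> /funext pE /funext qE /funext p'E /funext q'E.
  rewrite -pE -qE -p'E -q'E; apply/funext => t; exact: quotient_word_app.
have wu := word pb ps ps pb _ _ _ _ bE sE sE bE.
have wv := word pa ps ps pa _ _ _ _ aE sE sE aE.
apply: (no_commuting_homotopy e0 e5 cK (fun st => coords_distinct (H st))).
- by move=> t; rewrite /word_u /word_v -wu -wv H0; exact: path_cat_fun_app.
- by move=> t; rewrite /word_u /word_v -wu -wv H1; exact: path_cat_fun_app.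
- by move=> x; rewrite Hx.
- by move=> x; rewrite Hy.
Qed.
End Loops.

Theorem corollary4p7 (R : realType) (r n : nat) (hr : (1 <= r)%N)
    (hn : (3 <= n)%N) (x0 : monomial_complement R r n) :
  ~ residually_free (pure_monomial_braid_group R r n x0).
Proof.
have [g] := complement_path x0 (base_point n hr).
move=> /(residually_free_change_base g).
exact: base_point_not_residually_free.
Qed.
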